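(* Let $H\in(0,\frac34]$ and let $s=s_H$ be given by $s_H(k)=\frac12\big(|k+1|^{2H}+|k-1|^{2H}-2|k|^{2H}\big)$, $k\in\mathbb{Z}$. Let $\mathcal{W}^{(s_H)}_{n,d}$, $\mathcal{G}^{(s_H)}_{n,d}$ and $\mathcal{Z}^{(s_H)}_n$ (the last one when $s_H\in\ell^2(\mathbb{Z})$) be the $n\times n$ random matrices defined in the context. Then: (i) when $H\in(0,1/2)$: $\mathcal{W}^{(s_H)}_{n,d}$ is $\phi$-close to $\mathcal{G}^{(s_H)}_{n,d}$ for $\phi(n,d)=n^3/d$, whereas $\mathcal{G}^{(s_H)}_{n,d}$ is $\psi$-close to $\mathcal{Z}^{(s_H)}_{n}$ for $\psi(n,d)=n/d$; (ii) when $H=1/2$: $\mathcal{W}^{(s_H)}_{n,d}$ is $\phi$-close to $\mathcal{G}^{(s_H)}_{n,d}$ for $\phi(n,d)=n^3/d$, whereas $\mathcal{G}^{(s_H)}_{n,d}$ and $\mathcal{Z}^{(s_H)}_{n}$ have the same law; (iii) when $H\in(1/2,5/8)$: $\mathcal{W}^{(s_H)}_{n,d}$ is $\phi$-close to $\mathcal{G}^{(s_H)}_{n,d}$ for $\phi(n,d)=n^3/d$, whereas $\mathcal{G}^{(s_H)}_{n,d}$ is $\psi$-close to $\mathcal{Z}^{(s_H)}_{n}$ for $\psi(n,d)=nd^{4H-3}$; (iv) when $H=5/8$: $\mathcal{W}^{(s_H)}_{n,d}$ is $\phi$-close to $\mathcal{G}^{(s_H)}_{n,d}$ for $\phi(n,d)=(n^3\log^3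 d)/d$, whereas $\mathcal{G}^{(s_H)}_{n,d}$ is $\psi$-close to $\mathcal{Z}^{(s_H)}_{n}$ for $\psi(n,d)=n/\sqrt{d}$; (v) when $H\in(5/8,3/4)$: $\mathcal{W}^{(s_H)}_{n,d}$ is $\phi$-close to $\mathcal{G}^{(s_H)}_{n,d}$ for $\phi(n,d)=n^3d^{8H-6}$, whereas $\mathcal{G}^{(s_H)}_{n,d}$ is $\psi$-close to $\mathcal{Z}^{(s_H)}_{n}$ for $\psi(n,d)=nd^{4H-3}$; (vi) when $H=3/4$: $\mathcal{W}^{(s_H)}_{n,d}$ is $\phi$-close to $\mathcal{G}^{(s_H)}_{n,d}$ for $\phi(n,d)=n^3(\log d)^{-1}$, whereas $\mathcal{Z}^{(s_H)}_n$ is not defined (i.e. $s_H\notin\ell^2(\mathbb{Z})$).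
   Context: Setting, for a correlation function $s:\mathbb{Z}\to\mathbb{R}$ with $s(0)=1$: $\{X_{ij}:i,j\ge1\}$ are jointly Gaussian centered random variables with $\mathbb{E}[X_{ij}X_{i'j'}]=\mathbf{1}_{\{i=i'\}}s(j-j')$, $\mathcal{X}^{(s)}_{n,d}=(X_{ij})_{1\le i\le n,1\le j\le d}$, and $\mathcal{W}_{n,d}^{(s)}=\sqrt{d}\big(\frac1d\mathcal{X}_{n,d}^{(s)}(\mathcal{X}_{n,d}^{(s)})^T-\mathcal{I}_n\big)$, with $\mathcal{I}_n$ the identity matrix. $\mathcal{G}^{(s)}_{n,d}$ is a symmetric $n\times n$ random matrix whose entries form a centered Gaussian vector of $\mathbb{R}^{n^2}$ with the same covariance matrix as the vector of entries of $\mathcal{W}^{(s)}_{n,d}$. If $s\in\ell^2(\mathbb{Z})$, $\mathcal{Z}^{(s)}_n=(Z_{ij})$ is a symmetric $n\times n$ random matrix with $\{Z_{ij},i\le j\}$ independent, $Z_{ii}\sim N(0,2\|s\|^2_{\ell^2(\mathbb{Z})})$ and $Z_{ij}\sim N(0,\|s\|^2_{\ell^2(\mathbb{Z})})$ for $i<j$. $\phi$-closeness: for families $\{\mathcal{W}_{n,d}\}$, $\{\mathcal{Z}_{n,d}\}$ of $n\times n$ random matrices ($n,d\ge1$) and a function $\phi:\mathbb{N}^*\times\mathbb{N}^*\to[0,\infty]$, $\mathcal{W}_{n,d}$ is $\phi$-close to $\mathcal{Z}_{n,d}$ if $d_{\rm FM}(\mathcal{W}_{n,d},\mathcal{Z}_{n,d})\to0$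 when $d,n\to\infty$ and $\phi(n,d)\to0$. (Families depending only on $n$ are regarded as constant in $d$.) The Fortet–Mourier distance is $$d_{\rm FM}(\mathcal{X},\mathcal{Y})=\sup\{\mathbb{E}[g(\mathcal{X})]-\mathbb{E}[g(\mathcal{Y})]:\ \|g\|_\infty+\|g\|_{\rm Lip}\le1\},$$ over $g:\mathcal{M}_n(\mathbb{R})\to\mathbb{R}$, where $\|g\|_\infty=\sup_A|g(A)|$, $\|g\|_{\rm Lip}=\sup_{A\ne B}|g(A)-g(B)|/\|A-B\|_{\rm HS}$ and $\|\cdot\|_{\rm HS}$ is the Hilbert–Schmidt norm on the space $\mathcal{M}_n(\mathbb{R})$ of $n\times n$ real matrices. *)

(* Defs.v *)
From HB Require Import structures.
From mathcomp Require Import all_boot all_order all_algebra.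
From mathcomp Require Import all_classical all_reals all_analysis.
From mathcomp Require Import measurable_realfun.
Import Order.TTheory GRing.Theory Num.Theory.
Import numFieldTopology.Exports numFieldNormedType.Exports.

Set Implicit Arguments.
Unset Strict Implicit.
Unset Printing Implicit Defensive.

Local Open Scope classical_set_scope.
Local Open Scope ring_scope.

(* N(m, v), parametrised by its variance, possibly degenerate: the library's
   [normal_prob] takes the standard deviation and is not a point mass when it
   vanishes. *)
Definition gauss_law (R : realType) (m v : R) : set R -> \bar R :=
  fun B => if v == 0 then \d_m B else normal_prob m (Num.sqrt v) B.

Definition has_gauss_law (R : realType) (d : measure_display)
    (T : measurableType d) (P : probability T R) (Y : T -> R) (m v : R) : Prop :=
  measurable_fun setT Y /\
  forall B : set R, measurable B -> P (Y @^-1` B) = gauss_law m v B.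

Definition jointly_gaussian (R : realType) (d : measure_display)
    (T : measurableType d) (P : probability T R) (I : Type) (Y : I -> T -> R) :
    Prop :=
  forall (r : seq I) (a : I -> R), exists m v : R,
    0 <= v /\ has_gauss_law P (fun w => \sum_(i <- r) a i * Y i w) m v.

Definition centered (R : realType) (d : measure_display)
    (T : measurableType d) (P : probability T R) (I : Type) (Y : I -> T -> R) :
    Prop :=
  forall i : I, ('E_P[Y i] = 0)%E.

Definition independent_on (R : realType) (d : measure_display)
    (T : measurableType d) (P : probability T R) (I : finType) (D : pred I)
    (Y : I -> T -> R) : Prop :=
  forall (J : {set I}) (B : I -> set R), {subset J <= D} ->
    (forall i, measurable (B i)) ->
    P (\bigcap_(i in [set` J]) (Y i @^-1` B i)) =
    (\prod_(i in J) P (Y i @^-1` B i))%E.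

Record random_matrix (R : realType) (n : nat) := RandomMatrix {
  rm_display : measure_display ;
  rm_space : measurableType rm_display ;
  rm_prob : probability rm_space R ;
  rm_mx :> rm_space -> 'M[R]_n ;
  rm_measurable : forall i j, measurable_fun setT (fun w => rm_mx w i j) }.

Definition rm_entry (R : realType) (n : nat) (M : random_matrix R n)
    (ij : 'I_n * 'I_n) : rm_space M -> R := fun w => M w ij.1 ij.2.

Definition symmetric_rm (R : realType) (n : nat) (M : random_matrix R n) : Prop :=
  forall w, (M w)^T = M w.

Definition same_law (R : realType) (n : nat) (M N : random_matrix R n) : Prop :=
  forall B : set 'M[R]_n, <<s [set A : set 'M[R]_n | open A] >> B ->
    rm_prob M (M @^-1` B) = rm_prob N (N @^-1` B).

Definition hs_norm (R : realType) (n : nat) (A : 'M[R]_n) : R :=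
  Num.sqrt (\sum_(i < n) \sum_(j < n) A i j ^+ 2).

Definition sup_norm (R : realType) (n : nat) (g : 'M[R]_n -> R) : \bar R :=
  ereal_sup [set x | exists A, x = (`|g A|)%:E].

(* The supremum is over an empty set when [n = 0]; only [n >= 1] is relevant. *)
Definition lip_norm (R : realType) (n : nat) (g : 'M[R]_n -> R) : \bar R :=
  ereal_sup [set x | exists A B, A <> B /\
    x = (`|g A - g B| / hs_norm (A - B))%:E].

Definition dFM (R : realType) (n : nat) (M N : random_matrix R n) : \bar R :=
  ereal_sup [set x | exists g : 'M[R]_n -> R,
    (sup_norm g + lip_norm g <= 1)%E /\
    x = ('E_(rm_prob M)[fun w => g (M w)] -
         'E_(rm_prob N)[fun w => g (N w)])%E].

(* "d_FM -> 0 when d, n -> oo and phi(n, d) -> 0", along arbitrary sequences. *)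
Definition phi_close (R : realType) (phi : nat -> nat -> \bar R)
    (M N : forall n d : nat, random_matrix R n) : Prop :=
  forall n_ d_ : nat -> nat,
    n_ k @[k --> \oo] --> \oo -> d_ k @[k --> \oo] --> \oo ->
    phi (n_ k) (d_ k) @[k --> \oo] --> (0 : \bar R)%E ->
    dFM (M (n_ k) (d_ k)) (N (n_ k) (d_ k)) @[k --> \oo] --> (0 : \bar R)%E.

Definition sq_sum (R : realType) (s : int -> R) : \bar R :=
  \esum_(k in [set: int]) (s k ^+ 2)%:E.

Definition in_ell2 (R : realType) (s : int -> R) : Prop := (sq_sum s < +oo)%E.

Definition ell2_norm (R : realType) (s : int -> R) : R :=
  Num.sqrt (fine (sq_sum s)).

(* Indices start from 0 instead of 1; the covariance only involves [j - j']. *)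
Definition gaussian_array (R : realType) (d : measure_display)
    (T : measurableType d) (P : probability T R) (s : int -> R)
    (X : nat -> nat -> {RV P >-> R}) : Prop :=
  [/\ jointly_gaussian P (fun (ij : nat * nat) w => X ij.1 ij.2 w),
      centered P (fun (ij : nat * nat) w => X ij.1 ij.2 w) &
      forall i j i' j' : nat,
        'E_P[fun w => (X i j w * X i' j' w)%R]%E =
        ((i == i')%:R * s (j%:Z - j'%:Z))%:E].

Section wishart.
Context (R : realType) (d0 : measure_display) (T : measurableType d0)
  (P : probability T R) (X : nat -> nat -> {RV P >-> R}).

Definition data_mx (n d : nat) (w : T) : 'M[R]_(n, d) :=
  \matrix_(i < n, j < d) X i j w.

Definition wishart_mx (n d : nat) (w : T) : 'M[R]_n :=
  Num.sqrt d%:R *: (d%:R^-1 *: (data_mx n d w *m (data_mx n d w)^T) - 1%:M).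

Lemma wishart_measurable (n d : nat) (i j : 'I_n) :
  measurable_fun setT (fun w => wishart_mx n d w i j).
Proof.
rewrite (_ : (fun w => _) = (fun w => Num.sqrt d%:R *
   (d%:R^-1 * (\sum_(k < d) X i k w * X j k w) - (i == j)%:R))); last first.
  apply/funext => w; rewrite !mxE; congr (_ * (_ * _ - _)).
  by apply: eq_bigr => k _; rewrite !mxE.
apply: measurable_funM => //; apply: measurable_funB => //.
apply: measurable_funM => //; apply: measurable_sum => k.
exact: measurable_funM.
Qed.

Definition wishart (n d : nat) : random_matrix R n :=
  RandomMatrix P (@wishart_measurable n d).

End wishart.

Definition gaussian_counterpart (R : realType) (n : nat)
    (W G : random_matrix R n) : Prop :=
  [/\ symmetric_rm G,
      jointly_gaussian (rm_prob G) (@rm_entry R n G),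
      centered (rm_prob G) (@rm_entry R n G) &
      forall p q : 'I_n * 'I_n,
        covariance (rm_prob G) (@rm_entry R n G p) (@rm_entry R n G q) =
        covariance (rm_prob W) (@rm_entry R n W p) (@rm_entry R n W q)].

Definition goe_like (R : realType) (n : nat) (s : int -> R)
    (Z : random_matrix R n) : Prop :=
  [/\ symmetric_rm Z,
      independent_on (rm_prob Z) [pred ij : 'I_n * 'I_n | (ij.1 <= ij.2)%N]
        (@rm_entry R n Z),
      forall i : 'I_n,
        has_gauss_law (rm_prob Z) (fun w => Z w i i) 0 (2 * ell2_norm s ^+ 2) &
      forall i j : 'I_n, (i < j)%N ->
        has_gauss_law (rm_prob Z) (fun w => Z w i j) 0 (ell2_norm s ^+ 2)].

Definition s_fgn (R : realType) (H : R) (k : int) : R :=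
  2^-1 * (`|k%:~R + 1| `^ (2 * H) + `|k%:~R - 1| `^ (2 * H)
          - 2 * `|k%:~R| `^ (2 * H)).

(* Main.v *)
(** For symmetric [a], the entry [<a, W>] of the Wishart matrix is a centered
    quadratic form in the Gaussian data [x].  Rotation invariance of two
    independent copies of [x] yields the Stein identity
      [E <a, W> sin (t <a, W> + b) = 2 t E <a, a M> cos (t <a, W> + b)],
    [M := x S x^T / d], [S := (s (k - l))_(k, l < d)], whose mean is
    [sg2 I] with [sg2 := |S|^2 / d].  Interpolating trigonometric polynomials
    between [W] and [G] along [cos th W + sin th G] only leaves [M - sg2 I], so
      [d_FM (W, G) <= 2 (n^3 tr S^4 / (d^2 sg2))^(1/2)],
    once Lipschitz functions are approximated by trigonometric polynomials whose
    gradient is controlled by Gaussian smoothing.  The centered Gaussian matrices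
    [G] and [Z] have proportional covariances, whence
      [d_FM (G, Z) <= 2 n | sg2 - ||s||^2 |].
    The rates follow from [|s_H k| <= 2 k^(2H - 2)], from
    [tr S^4 <= d (sum_(|k| < d) |s k|^(4/3))^3], and from
    [||s||^2 - sg2 = (2 / d) sum_(D = 1)^d sum_(k >= D) s_k^2]; at [H = 3/4],
    [s_k^2] is at least of order [1 / k] and [sg2] at least of order [ln d]. *)

Require Import Defs.
From HB Require Import structures.
From mathcomp Require Import all_boot all_order all_algebra.
From mathcomp Require Import all_classical all_reals all_analysis.
From mathcomp Require Import measurable_realfun ring lra.
Import Order.TTheory GRing.Theory Num.Theory.
Import numFieldTopology.Exports numFieldNormedType.Exports.
Set Implicit Arguments.
Unset Strict Implicit.
Unset Printing Implicit Defensive.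
Local Open Scope classical_set_scope.
Local Open Scope ring_scope.

(** * Real-valued expectations *)

(** Cosines of linear forms serve as test functions because every expectation then involves a
    one-dimensional Gaussian law only, and every identity (Stein's, integration by parts, the
    quadratic one) comes from differentiating in one real parameter under the expectation. Two
    obstacles shape the passage to Lipschitz functions. Trigonometric polynomials are almost
    periodic, hence cannot be uniformly close to an arbitrary bounded Lipschitz function on the
    whole space: matrices are first contracted entrywise by [x -> L sin (x / L)], at a cost of order
    [E |x|^2 / L]. And uniform closeness says nothing about gradients: the polynomial is averaged
    over [x + eps G], which moves its derivative onto a Gaussian weight. With [G] itself as noise,
    only symmetric directions are regularized, and only those occur in the interpolation. There the
    direction of differentiation is the symmetric part of [G (M - sg2 I)]; the bounds
    [E |G B| <= (2 n sg2)^(1/2) |B|] and [E |M - sg2 I|^2 <= 2 n^2 tr S^4 / d^2] together produce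
    the factor [n^3]. *)

Section expectation.
Context {R : realType} {d : measure_display} {T : measurableType d}
  (P : probability T R).
Implicit Types f g : T -> R.

Definition itg f := P.-integrable setT (EFin \o f).
Definition Ex f : R := \int[P]_w f w.

Lemma itg_meas f : itg f -> measurable_fun setT f.
Proof. by move=> /integrableP[/measurable_EFinP]. Qed.

Lemma itg_dom f g : measurable_fun setT f -> itg g ->
  (forall w, `|f w| <= g w) -> itg f.
Proof.
move=> mf ig fg; apply: (le_integrable _ _ _ ig) => //.
  exact/measurable_EFinP.
by move=> w _ /=; rewrite lee_fin (le_trans (fg w))// ler_norm.
Qed.

Lemma itg_cst c : itg (cst c).
Proof. exact: finite_measure_integrable_cst. Qed.

Lemma itg_bnd f (c : R) : measurable_fun setT f -> (forall w, `|f w| <= c) ->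
  itg f.
Proof. by move=> mf fc; apply: (itg_dom mf (itg_cst c)). Qed.

Lemma itgD f g : itg f -> itg g -> itg (fun w => f w + g w).
Proof.
move=> hf hg; have := integrableD measurableT hf hg.
by apply: eq_integrable => // w _.
Qed.

Lemma itgN f : itg f -> itg (fun w => - f w).
Proof. by move=> hf; have := integrableN hf; apply: eq_integrable. Qed.

Lemma itgB f g : itg f -> itg g -> itg (fun w => f w - g w).
Proof. by move=> hf hg; apply: itgD => //; apply: itgN. Qed.

Lemma itgZ c f : itg f -> itg (fun w => c * f w).
Proof.
move=> hf; have := integrableZl measurableT c hf.
by apply: eq_integrable => // w _.
Qed.

Lemma itg_sum (I : Type) (r : seq I) (F : I -> T -> R) :
  (forall i, itg (F i)) -> itg (fun w => \sum_(i <- r) F i w).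
Proof.
move=> h; elim: r => [|i r IH].
  by under [X in itg X]eq_fun do rewrite big_nil; exact: itg_cst.
by under [X in itg X]eq_fun do rewrite big_cons; exact: itgD.
Qed.

Lemma itg_norm f : itg f -> itg (fun w => `|f w|).
Proof. by move=> /integrable_norm. Qed.

Lemma eq_Ex f g : f =1 g -> Ex f = Ex g.
Proof. by move=> fg; congr Ex; apply/funext. Qed.

Lemma ExD f g : itg f -> itg g -> Ex (fun w => f w + g w) = Ex f + Ex g.
Proof. by move=> hf hg; rewrite /Ex RintegralD. Qed.

Lemma ExB f g : itg f -> itg g -> Ex (fun w => f w - g w) = Ex f - Ex g.
Proof. by move=> hf hg; rewrite /Ex RintegralB. Qed.

Lemma ExZ c f : itg f -> Ex (fun w => c * f w) = c * Ex f.
Proof. by move=> hf; rewrite /Ex RintegralZl. Qed.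

Lemma ExZr c f : itg f -> Ex (fun w => f w * c) = Ex f * c.
Proof. by move=> hf; rewrite /Ex RintegralZr. Qed.

Lemma ExN f : itg f -> Ex (fun w => - f w) = - Ex f.
Proof.
by move=> hf; under eq_Ex do rewrite -mulN1r; rewrite ExZ// mulN1r.
Qed.

Lemma Ex_cst c : Ex (fun=> c) = c.
Proof.
have h := @probability_setT _ _ _ P.
rewrite /Ex Rintegral_cst// -[RHS]mulr1; congr (_ * _).
by rewrite -[RHS]/(fine 1%E); congr fine.
Qed.

Lemma Ex_sum (I : Type) (r : seq I) (F : I -> T -> R) :
  (forall i, itg (F i)) ->
  Ex (fun w => \sum_(i <- r) F i w) = \sum_(i <- r) Ex (F i).
Proof.
move=> h; elim: r => [|i r IH].
  by rewrite big_nil; under eq_Ex do rewrite big_nil; rewrite Ex_cst.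
rewrite big_cons -IH -ExD//; last exact: itg_sum.
by apply: eq_Ex => w; rewrite big_cons.
Qed.

Lemma Ex_ge0 f : (forall w, 0 <= f w) -> 0 <= Ex f.
Proof. by move=> h; apply: Rintegral_ge0. Qed.

Lemma Ex_le f g : itg f -> itg g -> (forall w, f w <= g w) -> Ex f <= Ex g.
Proof. by move=> hf hg h; apply: le_Rintegral. Qed.

Lemma Ex_norm f : itg f -> `|Ex f| <= Ex (fun w => `|f w|).
Proof. by move=> hf; apply: le_normr_Rintegral. Qed.

Lemma Ex_norm_le f g : itg f -> itg g -> (forall w, `|f w| <= g w) ->
  `|Ex f| <= Ex g.
Proof.
move=> hf hg h; apply: (le_trans (Ex_norm hf)); apply: Ex_le => //.
exact: itg_norm.
Qed.

Lemma Ex_bnd f c : measurable_fun setT f -> (forall w, `|f w| <= c) ->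
  `|Ex f| <= c.
Proof.
move=> mf fc; rewrite -[leRHS]Ex_cst; apply: Ex_norm_le => //.
  exact: itg_bnd fc.
exact: itg_cst.
Qed.

Lemma EFin_Ex f : itg f -> (Ex f)%:E = (\int[P]_w (f w)%:E)%E.
Proof. by move=> hf; rewrite /Ex /Rintegral fineK//; apply: integrable_fin_num. Qed.

Lemma expectation_Ex f : itg f -> ('E_P[f] = (Ex f)%:E)%E.
Proof. by move=> hf; rewrite unlock EFin_Ex. Qed.

(** Optimises [|f| <= (f^2 / r + r) / 2] over [r > 0]: the best choice is [r = sqrt V], and [V = 0]
    is handled by letting [r] tend to 0. *)
Lemma Ex_abs_sqrt f : itg (fun w => f w ^+ 2) -> measurable_fun setT f ->
  Ex (fun w => `|f w|) <= Num.sqrt (Ex (fun w => f w ^+ 2)).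
Proof.
move=> i2 mf; set V := Ex (fun w => f w ^+ 2).
have V0 : 0 <= V by apply: Ex_ge0 => w; exact: sqr_ge0.
have i1 : itg (fun w => `|f w|).
  apply: (@itg_dom _ (fun w => 1 + f w ^+ 2)).
  - exact: measurableT_comp.
  - by apply: itgD => //; exact: itg_cst.
  - move=> w; rewrite normr_id -(real_normK (num_real (f w))).
    by nra.
have key r : 0 < r -> Ex (fun w => `|f w|) <= (V / r + r) / 2.
  move=> r0.
  have -> : (V / r + r) / 2 = Ex (fun w => (r * 2)^-1 * (f w ^+ 2) + r / 2).
    rewrite ExD; last 2 first.
    - exact: itgZ.
    - exact: itg_cst.
    rewrite ExZ// Ex_cst -/V; field; lra.
  apply: Ex_le => //.
    by apply: itgD; [exact: itgZ|exact: itg_cst].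
  move=> w; rewrite -(real_normK (num_real (f w))).
  rewrite -subr_ge0 (_ : _ - _ = (r * 2)^-1 * (`|f w| - r) ^+ 2).
    by rewrite mulr_ge0 ?sqr_ge0// invr_ge0; lra.
  field; lra.
have [V00|V1] := eqVneq V 0.
  rewrite V00 sqrtr0; apply/ler_addgt0Pl => e e0; rewrite addr0.
  by have := key (e * 2); rewrite V00 mul0r add0r mulfK//; apply; lra.
have sV : 0 < Num.sqrt V by rewrite sqrtr_gt0 lt_neqAle eq_sym V1.
apply: (le_trans (key _ sV)).
rewrite -{1}(sqr_sqrtr V0) expr2 mulfK ?gt_eqF//.
by rewrite -mulr2n -[X in X / 2]mulr_natr mulfK.
Qed.

(** Differentiation under the expectation, with domination only on the unit neighbourhood of [a]:
    exponential weights are dominated only for bounded parameters. *)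
Lemma Ex_is_derive (f df : R -> T -> R) (a : R) (G : T -> R) :
  (forall x, `|x - a| < 1 -> itg (f x)) -> itg G ->
  (forall x w, is_derive x (1 : R) (f ^~ w) (df x w)) ->
  (forall x w, `|x - a| < 1 -> `|df x w| <= G w) ->
  is_derive a (1 : R) (fun x => Ex (f x)) (Ex (df a)).
Proof.
move=> intf iG hd hG.
have Ia : (`](a - 1), (a + 1)[%classic : set R) a by rewrite /= in_itv/=; lra.
have I1 x : (`](a - 1), (a + 1)[%classic : set R) x -> `|x - a| < 1.
  by rewrite /= in_itv/= => h; rewrite ltr_norml; lra.
have dfE x w : partial1of2 f x w = df x w.
  by rewrite partial1of2E; apply: derive_val.
have G0 w : 0 <= G w by apply: le_trans (hG a w _); rewrite // subrr normr0.
have h1 x : (`](a - 1), (a + 1)[%classic : set R) x ->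
    P.-integrable setT (EFin \o f x) by move=> /I1; exact: intf.
have h2 x w : (`](a - 1), (a + 1)[%classic : set R) x -> setT w ->
    derivable (f ^~ w) x 1 by [].
have h3 x w : (`](a - 1), (a + 1)[%classic : set R) x -> setT w ->
    `|partial1of2 f x w| <= G w.
  by move=> /I1 hx _; rewrite dfE; exact: hG.
apply: DeriveDef.
  exact: (derivable_under_integral measurableT Ia h1 h2 G0 iG h3).
rewrite -derive1E.
have -> := differentiation_under_integral measurableT Ia h1 h2 G0 iG h3.
by apply: eq_Ex => w; rewrite dfE.
Qed.

End expectation.

Lemma Ex_dominated (R : realType) (d : measure_display) (T : measurableType d)
    (P : probability T R) (f : nat -> T -> R) (g G : T -> R) :
  (forall n, measurable_fun setT (f n)) -> measurable_fun setT g ->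
  itg P G -> (forall n w, `|f n w| <= G w) ->
  (forall w, f ^~ w @ \oo --> g w) ->
  Ex P (f n) @[n --> \oo] --> Ex P g.
Proof.
move=> mf mg iG fG fg.
have [|||||_ _ h] := @dominated_convergence _ _ _ P setT measurableT
  (fun n w => (f n w)%:E) (EFin \o g) (EFin \o G).
- by move=> n; exact/measurable_EFinP.
- exact/measurable_EFinP.
- apply: aeW => w _; apply: cvg_EFin; last exact: fg.
  exact: nearW.
- exact: iG.
- by apply: aeW => w n _; rewrite lee_fin.
apply: fine_cvg; rewrite fineK//.
have ig : itg P g.
  apply: (itg_dom mg iG) => w.
  have : `|f n w| @[n --> \oo] --> `|g w| by apply: cvg_norm; exact: fg.
  move=> /cvg_lim <-//; apply: limr_le; last exact: nearW.
  by apply: is_cvg_norm; apply: cvgP (fg w).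
exact: integrable_fin_num ig.
Qed.

(** * Integration against a density *)

Section density.
Import HBNNSimple.

(** Both sides are limits over the same increasing simple functions. It turns integrals against
    [normal_prob], known through its values on sets, into Lebesgue integrals. *)
Lemma ge0_integral_density (R : realType) (d : measure_display)
    (T : measurableType d) (mu nu : {measure set T -> \bar R}) (p f : T -> R) :
  measurable_fun setT p -> (forall x, 0 <= p x) ->
  (forall A, measurable A -> nu A = (\int[mu]_(x in A) (p x)%:E)%E) ->
  measurable_fun setT f -> (forall x, 0 <= f x) ->
  (\int[nu]_x (f x)%:E = \int[mu]_x (f x * p x)%:E)%E.
Proof.
move=> mp p0 nuE mf f0.
have mEf : measurable_fun setT (EFin \o f) by exact/measurable_EFinP.
pose f_ := nnsfun_approx measurableT mEf.
have cvf x : (f_ n x)%:E @[n --> \oo] --> (f x)%:E.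
  by apply: cvg_nnsfun_approx => // y _; rewrite /= lee_fin.
have ndf n m : (n <= m)%N -> forall x, f_ n x <= f_ m x.
  by move=> nm x; exact/lefP/nd_nnsfun_approx.
transitivity (limn (fun n => \int[nu]_x (f_ n x)%:E)%E).
  rewrite -monotone_convergence//.
  - by apply: eq_integral => x _; apply/esym/cvg_lim => //; exact: cvf.
  - by move=> n; exact/measurable_EFinP.
  - by move=> n x _; rewrite lee_fin.
  - by move=> x _ m n mn; rewrite lee_fin ndf.
transitivity (limn (fun n => \int[mu]_x (f_ n x * p x)%:E)%E); last first.
  rewrite -monotone_convergence//.
  - apply: eq_integral => x _; apply/cvg_lim => //.
    under eq_fun do rewrite EFinM.
    by rewrite EFinM; apply: cvgeZr => //; exact: cvf.
  - by move=> n; apply/measurable_EFinP/measurable_funM.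
  - by move=> n x _; rewrite lee_fin mulr_ge0.
  - by move=> x _ m n mn; rewrite lee_fin ler_wpM2r// ndf.
congr (limn _); apply/funext => n.
rewrite integralT_nnsfun sintegralE.
transitivity (\int[mu]_x (\sum_(y \in range (f_ n))
    ((y * \1_(f_ n @^-1` [set y]) x)%:E * (p x)%:E)%E))%E; last first.
  apply: eq_integral => x _; rewrite EFinM fimfunE -fsumEFin//.
  rewrite ge0_mule_fsuml// => y; rewrite lee_fin.
  exact: nnfun_muleindic_ge0.
rewrite ge0_integral_fsum//; last 2 first.
  - move=> y; apply/measurable_EFinP/measurable_funM => //.
    exact: measurable_funM.
  - move=> y x _; rewrite mule_ge0 ?lee_fin//.
    exact: nnfun_muleindic_ge0.
apply: eq_fsbigr => y /[1!inE] -[x _ <-].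
rewrite nuE// -ge0_integralZl//; last 3 first.
  - exact/measurable_EFinP/measurable_funTS.
  - by move=> z _; rewrite lee_fin.
  - by rewrite lee_fin.
rewrite integral_mkcond; apply: eq_integral => z _.
rewrite patchE; case: ifPn => [zy|zy].
  by rewrite indicE zy mulr1.
by rewrite indicE (negbTE zy) mulr0 mul0e.
Qed.

End density.

(** * One-dimensional Gaussian laws *)

Section derivation_rules.
Context {R : realType}.
Implicit Types (f g : R -> R) (x a b c : R).

Lemma dr_eq f x a b : is_derive x (1 : R) f a -> a = b -> is_derive x (1 : R) f b.
Proof. by move=> h <-. Qed.

Lemma dr_cst c x : is_derive x (1 : R) (fun=> c) 0.
Proof. exact: is_derive_cst. Qed.

Lemma dr_id x : is_derive x (1 : R) (fun y => y) 1.
Proof. exact: is_derive_id. Qed.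

Lemma dr_add f g x a b : is_derive x (1 : R) f a -> is_derive x (1 : R) g b ->
  is_derive x (1 : R) (fun y => f y + g y) (a + b).
Proof. by move=> hf hg; apply: is_deriveD. Qed.

Lemma dr_opp f x a : is_derive x (1 : R) f a ->
  is_derive x (1 : R) (fun y => - f y) (- a).
Proof. by move=> hf; apply: is_deriveN. Qed.

Lemma dr_mul f g x a b : is_derive x (1 : R) f a -> is_derive x (1 : R) g b ->
  is_derive x (1 : R) (fun y => f y * g y) (f x * b + g x * a).
Proof. by move=> hf hg; apply: (is_deriveM hf hg). Qed.

Lemma dr_comp f g x a b : is_derive (f x) (1 : R) g b -> is_derive x (1 : R) f a ->
  is_derive x (1 : R) (fun y => g (f y)) (b * a).
Proof.
move=> hg hf; have := @is_derive1_comp _ g f x b a hg hf.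
by rewrite /comp mulrC.
Qed.

Lemma dr_exp f x a : is_derive x (1 : R) f a ->
  is_derive x (1 : R) (fun y => expR (f y)) (expR (f x) * a).
Proof. by apply: dr_comp; exact: is_derive_expR. Qed.

Lemma dr_cos f x a : is_derive x (1 : R) f a ->
  is_derive x (1 : R) (fun y => cos (f y)) (- sin (f x) * a).
Proof. by apply: dr_comp; exact: is_derive_cos. Qed.

Lemma dr_sin f x a : is_derive x (1 : R) f a ->
  is_derive x (1 : R) (fun y => sin (f y)) (cos (f x) * a).
Proof. by apply: dr_comp; exact: is_derive_sin. Qed.

Lemma dr_sqr f x a : is_derive x (1 : R) f a ->
  is_derive x (1 : R) (fun y => f y ^+ 2) (2 * f x * a).
Proof.
move=> hf; have := dr_mul hf hf.
under [X in is_derive _ _ X]eq_fun do rewrite -expr2.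
by move=> h; apply: (dr_eq h); ring.
Qed.

Lemma dr_sum (I : Type) (r : seq I) (F : I -> R -> R) (D : I -> R) x :
  (forall i, is_derive x (1 : R) (F i) (D i)) ->
  is_derive x (1 : R) (fun y => \sum_(i <- r) F i y) (\sum_(i <- r) D i).
Proof.
move=> h; elim: r => [|i r IH].
  rewrite big_nil; under [X in is_derive _ _ X]eq_fun do rewrite big_nil.
  exact: dr_cst.
rewrite big_cons; under [X in is_derive _ _ X]eq_fun do rewrite big_cons.
exact: dr_add.
Qed.

Lemma dr_unique f x a b : is_derive x (1 : R) f a -> is_derive x (1 : R) f b ->
  a = b.
Proof. by move=> h1 h2; rewrite -(@derive_val _ _ _ _ _ _ _ h1); apply: derive_val. Qed.

End derivation_rules.

(** Differentiates by recursion on the syntax; [eassumption] supplies the derivatives of opaque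
    functions found in the context. [der] then leaves one equation between the computed and the
    announced derivative. *)
Ltac dr := repeat first
  [ eassumption
  | notypeclasses refine (dr_cst _ _) | notypeclasses refine (dr_id _)
  | notypeclasses refine (dr_exp _) | notypeclasses refine (dr_cos _)
  | notypeclasses refine (dr_sin _) | notypeclasses refine (dr_sqr _)
  | notypeclasses refine (dr_opp _) | notypeclasses refine (dr_add _ _)
  | notypeclasses refine (dr_mul _ _) ].

Ltac der := notypeclasses refine (dr_eq _ _); [dr|cbv beta].

Section normal.
Context {R : realType}.
Implicit Types (m v c t x : R).
Notation mu := (@lebesgue_measure R).

(** Completing the square in the exponent: tilting a Gaussian density translates it by [v t], up to
    the moment generating function. *)
Lemma normal_pdf_tilt m v t x : 0 < v ->
  expR (t * x) * normal_pdf m (Num.sqrt v) x =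
  expR (t * m + v * t ^+ 2 / 2) * normal_pdf (m + v * t) (Num.sqrt v) x.
Proof.
move=> v0; have s0 : Num.sqrt v != 0 by rewrite gt_eqF// sqrtr_gt0.
rewrite !normal_pdfE// mulrCA [RHS]mulrCA; congr (_ * _).
rewrite /normal_fun -!expRD; congr expR.
rewrite sqr_sqrtr ?ltW// -[v *+ 2]mulr_natr; field; exact: lt0r_neq0.
Qed.

Lemma normal_pdf_shift m c x v : v != 0 ->
  normal_pdf (m + c) v (x + c) = normal_pdf m v x.
Proof.
move=> v0; rewrite /normal_pdf (negbTE v0) /normal_fun.
by rewrite (_ : x + c - (m + c) = x - m)//; ring.
Qed.

Lemma normal_translate m v c (f : R -> R) : v != 0 -> continuous f ->
  (forall x, 0 <= f x) ->
  (\int[mu]_x (f x * normal_pdf (m + c) v x)%:E =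
   \int[mu]_x (f (x + c) * normal_pdf m v x)%:E)%E.
Proof.
move=> v0 cf f0.
have dF x : is_derive x (1 : R) (fun y : R => y + c) 1.
  by der; rewrite addr0.
have F'E : (fun y : R => y + c)^`()%classic = cst (1 : R).
  by apply/funext => x; rewrite derive1E; apply: derive_val.
rewrite (@increasing_ge0_integration_by_substitutionT R (fun y => y + c)
   (fun x => f x * normal_pdf (m + c) v x)).
- apply: eq_integral => x _; rewrite F'E.
  rewrite -(normal_pdf_shift m c x v0).
  by rewrite -[RHS]/(_ %:E) -(mulr1 (f _ * _)).
- by move=> x y; rewrite ltrD2r.
- by rewrite F'E => x; exact: cvg_cst.
- by rewrite F'E; exact: is_cvg_cst.
- by rewrite F'E; exact: is_cvg_cst.
- by [].
- exact: cvg_addrr_Ny.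
- exact: cvg_addrr.
- move=> x; apply: continuousM; first exact: cf.
  exact: continuous_normal_pdf.
- by move=> x; rewrite mulr_ge0// normal_pdf_ge0.
Qed.

End normal.

Section gauss_rv.
Context {R : realType} {d : measure_display} {T : measurableType d}
  (P : probability T R).
Implicit Types (Y : T -> R) (m v t : R).

Lemma ge0_integral_gauss Y m v (f : R -> R) : 0 <= v -> has_gauss_law P Y m v ->
  measurable_fun setT f -> (forall x, 0 <= f x) ->
  (\int[P]_w (f (Y w))%:E = if v == 0%R then (f m)%:E else
    \int[lebesgue_measure]_x (f x * normal_pdf m (Num.sqrt v) x)%:E)%E.
Proof.
move=> v0 [mY lY] mf f0.
have mEf : measurable_fun setT (EFin \o f) by exact/measurable_EFinP.
have mY' : measurable_fun setT (Y : T -> measurableTypeR R) := mY.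
have -> : (\int[P]_w (f (Y w))%:E =
    \int[pushforward P (Y : T -> measurableTypeR R)]_x (f x)%:E)%E.
  by rewrite (ge0_integral_pushforward mY')// => x _; rewrite lee_fin.
case: ifPn => vz.
  rewrite (eq_measure_integral (\d_(m : measurableTypeR R) : measure _ R)).
    by rewrite integral_dirac// diracE in_setT mul1e.
  by move=> A mA _; rewrite -[LHS]/(P (Y @^-1` A)) lY// /gauss_law vz.
rewrite (eq_measure_integral (normal_prob m (Num.sqrt v) : measure _ R)).
  apply: ge0_integral_density => //.
  - exact: measurable_normal_pdf.
  - by move=> x; exact: normal_pdf_ge0.
by move=> A mA _; rewrite -[LHS]/(P (Y @^-1` A)) lY// /gauss_law (negbTE vz).
Qed.

(** The Cameron-Martin formula in dimension one. Moments and characteristic functions are all drawn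
    from it, so the degenerate case [v = 0] is settled here once and for all. *)
Lemma gauss_tilt Y m v t (f : R -> R) : 0 <= v -> has_gauss_law P Y m v ->
  continuous f -> (forall x, 0 <= f x) ->
  (\int[P]_w (f (Y w) * expR (t * Y w))%:E =
   (expR (t * m + v * t ^+ 2 / 2))%:E * \int[P]_w (f (Y w + v * t))%:E)%E.
Proof.
move=> v0 hY cf f0.
have mf : measurable_fun setT f by exact: continuous_measurable_fun.
rewrite (ge0_integral_gauss (f := fun y => f y * expR (t * y)) v0 hY); last 2 first.
- apply: measurable_funM => //.
  by apply: measurableT_comp => //; exact: measurable_funM.
- by move=> x; rewrite mulr_ge0 ?expR_ge0.
rewrite (ge0_integral_gauss (f := fun y => f (y + v * t)) v0 hY); last 2 first.
- by apply: measurableT_comp => //; exact: measurable_funD.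
- by [].
case: eqVneq => [->|vn0]; first by rewrite !mul0r !addr0 EFinM muleC.
have vp : 0 < v by rewrite lt_neqAle eq_sym vn0.
have sn0 : Num.sqrt v != 0 by rewrite gt_eqF// sqrtr_gt0.
rewrite -normal_translate// -ge0_integralZl//.
- apply: eq_integral => x _; rewrite -EFinM; congr EFin.
  by rewrite -mulrA normal_pdf_tilt// mulrCA.
- apply/measurable_EFinP/measurable_funM => //.
  exact: measurable_normal_pdf.
- by move=> x _; rewrite lee_fin mulr_ge0// normal_pdf_ge0.
Qed.

Lemma gauss_mgfE Y m v t : 0 <= v -> has_gauss_law P Y m v ->
  (\int[P]_w (expR (t * Y w))%:E = (expR (t * m + v * t ^+ 2 / 2))%:E)%E.
Proof.
move=> v0 hY.
have c1 : continuous ((fun=> 1) : R -> R) by move=> ?; exact: cvg_cst.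
have h := @gauss_tilt Y m v t (fun=> 1) v0 hY c1 (fun=> ler01).
transitivity (\int[P]_w (1 * expR (t * Y w))%:E)%E.
  by apply: eq_integral => w _; rewrite mul1r.
rewrite h -[RHS]mule1; congr (_ * _)%E.
by rewrite -[RHS](@probability_setT _ _ _ P) -[RHS]mul1e; exact: integral_cst.
Qed.

Lemma gauss_itg_exp Y m v t : 0 <= v -> has_gauss_law P Y m v ->
  itg P (fun w => expR (t * Y w)).
Proof.
move=> v0 hY; have mY := hY.1.
apply/integrableP; split.
  apply/measurable_EFinP; apply: measurableT_comp => //.
  exact: measurable_funM.
rewrite (_ : (\int[P]_x _)%E = (expR (t * m + v * t ^+ 2 / 2))%:E) ?ltry//.
rewrite -(gauss_mgfE t v0 hY); apply: eq_integral => w _.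
by rewrite /= ger0_norm ?expR_ge0.
Qed.

Lemma gauss_mgf Y m v t : 0 <= v -> has_gauss_law P Y m v ->
  Ex P (fun w => expR (t * Y w)) = expR (t * m + v * t ^+ 2 / 2).
Proof.
move=> v0 hY; apply: EFin_inj; rewrite EFin_Ex ?(gauss_mgfE t v0 hY)//.
exact: gauss_itg_exp hY.
Qed.

(** From [z <= exp z] at [z = y / (k + 1)]; dividing by [k + 1] rather than [k] also covers
    [k = 0]. *)
Lemma pow_le_exp k (y : R) : 0 <= y -> y ^+ k <= k.+1%:R ^+ k * expR y.
Proof.
move=> y0; have k0 : 0 < k.+1%:R :> R by [].
have y'0 : 0 <= y / k.+1%:R by rewrite divr_ge0.
have h : y / k.+1%:R <= expR (y / k.+1%:R).
  by apply: le_trans (expR_ge1Dx _); rewrite lerDr.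
have -> : y ^+ k = k.+1%:R ^+ k * (y / k.+1%:R) ^+ k.
  by rewrite -exprMn mulrC divfK ?gt_eqF.
rewrite ler_pM2l ?exprn_gt0//.
apply: (@le_trans _ _ (expR (y / k.+1%:R) ^+ k)).
  by rewrite lerXn2r// ?nnegrE ?expR_ge0.
rewrite -expRM_natl ler_expR mulrCA ler_piMr// ler_pdivrMr// mul1r ler_nat.
exact: leqnSn.
Qed.

Lemma expR_norm_le (x : R) : expR `|x| <= expR x + expR (- x).
Proof.
have [x0|x0] := leP 0 x; first by rewrite ger0_norm// lerDl expR_ge0.
by rewrite ltr0_norm// lerDr expR_ge0.
Qed.

Lemma gauss_itg_pow_exp Y m v k t : 0 <= v -> has_gauss_law P Y m v ->
  itg P (fun w => Y w ^+ k * expR (t * Y w)).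
Proof.
move=> v0 hY; have mY := hY.1.
(* The power costs one more unit in the exponent, and [exp |z| <= exp z + exp (- z)] brings back two
   moment generating functions. *)
pose G w := k.+1%:R ^+ k * (expR ((1 + `|t|) * Y w) + expR (- (1 + `|t|) * Y w)).
apply: (@itg_dom _ _ _ _ _ G).
- apply: measurable_funM; first exact: measurable_funX.
  by apply: measurableT_comp => //; exact: measurable_funM.
- by apply: itgZ; apply: itgD; exact: gauss_itg_exp hY.
- move=> w; rewrite normrM normrX (ger0_norm (expR_ge0 _)) /G.
  have h1 := pow_le_exp k (normr_ge0 (Y w)).
  have h2 : expR (t * Y w) <= expR (`|t| * `|Y w|).
    by rewrite ler_expR -normrM ler_norm.
  apply: (le_trans (ler_pM _ _ h1 h2)); rewrite ?exprn_ge0 ?expR_ge0//.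
  rewrite -mulrA ler_pM2l ?exprn_gt0// -expRD.
  rewrite -{1}[`|Y w|]mul1r -mulrDl mulNr.
  rewrite -[(1 + `|t|) * `|Y w|]ger0_norm ?mulr_ge0 ?addr_ge0//.
  rewrite normrM normr_id -normrM; exact: expR_norm_le.
Qed.

Lemma gauss_itg_pow Y m v k : 0 <= v -> has_gauss_law P Y m v ->
  itg P (fun w => Y w ^+ k).
Proof.
move=> v0 hY; have := gauss_itg_pow_exp k 0 v0 hY.
by under [X in itg _ X]eq_fun do rewrite mul0r expR0 mulr1.
Qed.

Lemma gauss_pow_exp_derive Y m v k t : 0 <= v -> has_gauss_law P Y m v ->
  is_derive t (1 : R) (fun t => Ex P (fun w => Y w ^+ k * expR (t * Y w)))
    (Ex P (fun w => Y w ^+ k.+1 * expR (t * Y w))).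
Proof.
move=> v0 hY; have mY := hY.1.
pose c := 1 + `|t|.
pose G w := k.+2%:R ^+ k.+1 * (expR ((1 + c) * Y w) + expR (- (1 + c) * Y w)).
apply: (@Ex_is_derive _ _ _ P (fun t w => Y w ^+ k * expR (t * Y w))
   (fun t w => Y w ^+ k.+1 * expR (t * Y w)) t G).
- by move=> x _; exact: gauss_itg_pow_exp hY.
- by apply: itgZ; apply: itgD; exact: gauss_itg_exp hY.
- by move=> x w; der; rewrite exprS; ring.
- move=> x w xt; rewrite normrM normrX (ger0_norm (expR_ge0 _)) /G.
  have h1 := pow_le_exp k.+1 (normr_ge0 (Y w)).
  have xc : `|x| <= c.
    rewrite -[x](subrK t) (le_trans (ler_normD _ _))// /c lerD2r.
    exact: ltW.
  have h2 : expR (x * Y w) <= expR (c * `|Y w|).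
    rewrite ler_expR (le_trans (ler_norm _))// normrM ler_wpM2r//.
  apply: (le_trans (ler_pM _ _ h1 h2)); rewrite ?exprn_ge0 ?expR_ge0//.
  rewrite -mulrA ler_pM2l ?exprn_gt0// -expRD.
  rewrite -{1}[`|Y w|]mul1r -mulrDl mulNr.
  have c0 : 0 <= 1 + c by rewrite !addr_ge0.
  rewrite -[(1 + c) * `|Y w|]ger0_norm ?mulr_ge0//.
  rewrite normrM normr_id -normrM; exact: expR_norm_le.
Qed.

(** The [k]-th derivative of the moment generating function [e] is [p_k e] with
    [p_(k+1) = p_k' + p_k (m + v t)]; the moments are the values of [p_k] at 0. *)
Lemma gauss_moments Y m v : 0 <= v -> has_gauss_law P Y m v ->
  [/\ Ex P Y = m, Ex P (fun w => Y w ^+ 2) = m ^+ 2 + v &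
      m = 0 -> Ex P (fun w => Y w ^+ 4) = 3 * v ^+ 2].
Proof.
move=> v0 hY.
pose e t := expR (t * m + v * t ^+ 2 / 2).
pose M k t := Ex P (fun w => Y w ^+ k * expR (t * Y w)).
have dM k t : is_derive t (1 : R) (M k) (M k.+1 t).
  exact: gauss_pow_exp_derive hY.
have de t : is_derive t (1 : R) e (e t * (m + v * t)).
  by rewrite /e; der; field.
have M0 t : M 0 t = e t.
  by rewrite /M /e -(gauss_mgf t v0 hY); apply: eq_Ex => w; rewrite expr0 mul1r.
have step k (p : R -> R) (dp : R -> R) : (forall t, M k t = p t * e t) ->
    (forall t, is_derive t (1 : R) p (dp t)) ->
    forall t, M k.+1 t = (dp t + p t * (m + v * t)) * e t.
  move=> hM hp t; apply: (dr_unique (dM k t)).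
  rewrite (_ : M k = fun t => p t * e t); last by apply/funext.
  have hpt := hp t; have het := de t.
  by der; ring.
have MY k : Ex P (fun w => Y w ^+ k) = M k 0.
  by apply: eq_Ex => w; rewrite mul0r expR0 mulr1.
have e0 : e 0 = 1 by rewrite /e mul0r expr0n /= mulr0 mul0r addr0 expR0.
have d1 t : is_derive t (1 : R) (fun t => m + v * t) v by der; ring.
have h0 t : M 0 t = (fun=> 1) t * e t by rewrite M0 mul1r.
have h1 t : M 1 t = (fun t => m + v * t) t * e t.
  by rewrite (step _ _ _ h0 (fun t => dr_cst 1 t)) add0r mul1r.
have h2 t : M 2 t = (fun t => v + (m + v * t) ^+ 2) t * e t.
  by rewrite (step _ _ _ h1 d1) expr2.
have h3 t : M 3 t = (fun t => 3 * v * (m + v * t) + (m + v * t) ^+ 2 * (m + v * t)) t * e t.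
  have d2 t' : is_derive t' (1 : R) (fun t => v + (m + v * t) ^+ 2)
      (2 * v * (m + v * t')) by have := d1 t' => ?; der; ring.
  by rewrite (step _ _ _ h2 d2); congr (_ * _); ring.
have h4 t : M 4 t = (3 * v ^+ 2 + 6 * v * (m + v * t) ^+ 2 + (m + v * t) ^+ 4) * e t.
  have d3 t' : is_derive t' (1 : R)
      (fun t => 3 * v * (m + v * t) + (m + v * t) ^+ 2 * (m + v * t))
      (3 * v ^+ 2 + 3 * v * (m + v * t') ^+ 2) by have := d1 t' => ?; der; ring.
  by rewrite (step _ _ _ h3 d3); congr (_ * _); ring.
split.
- by rewrite -[Y]/(fun w => Y w ^+ 1) MY h1 e0 mulr0 addr0 mulr1.
- by rewrite MY h2 e0 mulr0 addr0 mulr1 addrC.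
- by move=> m0; rewrite MY h4 e0 m0; ring.
Qed.

(** The tilt formula for a function that changes sign: it is applied to [1 + cos], and the part due
    to 1, the moment generating function, is subtracted. *)
Lemma gauss_cos_tilt Y m v s b t : 0 <= v -> has_gauss_law P Y m v ->
  Ex P (fun w => cos (s * Y w + b) * expR (t * Y w)) =
  expR (t * m + v * t ^+ 2 / 2) * Ex P (fun w => cos (s * Y w + (s * (v * t) + b))).
Proof.
move=> v0 hY; have mY := hY.1.
have mc c : measurable_fun setT (fun w => cos (s * Y w + c)).
  apply: measurableT_comp; first exact: continuous_measurable_fun (@continuous_cos R).
  by apply: measurable_funD => //; exact: measurable_funM.
have ic c : itg P (fun w => cos (s * Y w + c)).
  by apply: (@itg_bnd _ _ _ P _ 1) => // w; exact: cos_max.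
have ie : itg P (fun w => expR (t * Y w)) by exact: gauss_itg_exp hY.
have ice : itg P (fun w => cos (s * Y w + b) * expR (t * Y w)).
  apply: (itg_dom _ ie) => [|w].
    by apply: measurable_funM => //; exact: itg_meas ie.
  rewrite normrM (ger0_norm (expR_ge0 _)) ler_piMl ?expR_ge0//.
  exact: cos_max.
pose f y := 1 + cos (s * y + b).
have cf : continuous f.
  move=> y; apply: cvgD; first exact: cvg_cst.
  apply: continuous_comp; last exact: continuous_cos.
  by apply: cvgD; [apply: cvgM; [exact: cvg_cst|exact: cvg_id]|exact: cvg_cst].
have f0 y : 0 <= f y.
  by have := cos_max (s * y + b); rewrite /f ler_norml => /andP[]; lra.
have := gauss_tilt t v0 hY cf f0.
rewrite -(@EFin_Ex _ _ _ P (fun w => f (Y w) * expR (t * Y w))); last first.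
  have := itgD ie ice; congr (itg _ _); apply/funext => w.
  by rewrite /f mulrDl mul1r.
rewrite -(@EFin_Ex _ _ _ P (fun w => f (Y w + v * t))); last first.
  have := itgD (itg_cst P 1) (ic (s * (v * t) + b)); congr (itg _ _).
  by apply/funext => w; rewrite /f mulrDr addrA.
rewrite -EFinM => -[].
rewrite (_ : Ex P _ = Ex P (fun w => expR (t * Y w)) +
    Ex P (fun w => cos (s * Y w + b) * expR (t * Y w))); last first.
  by rewrite -ExD//; apply: eq_Ex => w; rewrite /f mulrDl mul1r.
rewrite (_ : Ex P (fun w => f _) = 1 + Ex P (fun w => cos (s * Y w + (s * (v * t) + b)))); last first.
  rewrite -{1}(Ex_cst P 1) -ExD//; last exact: itg_cst.
  by apply: eq_Ex => w; rewrite /f mulrDr addrA.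
by rewrite (gauss_mgf t v0 hY) mulrDr mulr1 => /addrI.
Qed.

(** The derivative of [E cos (s Y + b) exp (t Y)] at [t = 0], computed in two ways: under the
    expectation, and after the tilt formula has moved [t] into the phase. *)
Lemma gauss_stein_cos Y v s b : 0 <= v -> has_gauss_law P Y 0 v ->
  Ex P (fun w => Y w * cos (s * Y w + b)) =
  - (s * v) * Ex P (fun w => sin (s * Y w + b)).
Proof.
move=> v0 hY; have mY := hY.1.
have msY c : measurable_fun setT (fun w => s * Y w + c).
  by apply: measurable_funD => //; exact: measurable_funM.
have mc c : measurable_fun setT (fun w => cos (s * Y w + c)).
  by apply: measurableT_comp (msY c); exact: continuous_measurable_fun (@continuous_cos R).
have ms c : measurable_fun setT (fun w => sin (s * Y w + c)).
  by apply: measurableT_comp (msY c); exact: continuous_measurable_fun (@continuous_sin R).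
have ic c : itg P (fun w => cos (s * Y w + c)).
  by apply: (@itg_bnd _ _ _ P _ 1) => // w; exact: cos_max.
have isn c : itg P (fun w => sin (s * Y w + c)).
  by apply: (@itg_bnd _ _ _ P _ 1) => // w; exact: sin_max.
pose L t := Ex P (fun w => cos (s * Y w + b) * expR (t * Y w)).
pose Ec := Ex P (fun w => cos (s * Y w + b)).
pose Es := Ex P (fun w => sin (s * Y w + b)).
pose r t := expR (v * t ^+ 2 / 2) *
  (cos (s * (v * t)) * Ec - sin (s * (v * t)) * Es).
have LE t : L t = r t.
  rewrite /L (gauss_cos_tilt _ _ _ v0 hY) mulr0 add0r; congr (_ * _).
  rewrite /Ec /Es -!ExZ// -ExB; last 2 first.
  - exact: itgZ.
  - exact: itgZ.
  by apply: eq_Ex => w; rewrite addrCA cosD.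
have dr0 : is_derive 0 (1 : R) r (- (s * v) * Es).
  rewrite /r; der.
  by rewrite !(mulr0, expr0n, mul0r, mulr1, cos0, sin0, expR0, add0r, addr0)/=; ring.
pose G w := 2 * (expR (2 * Y w) + expR (- 2 * Y w)).
have dL : is_derive 0 (1 : R) L (Ex P (fun w => Y w * cos (s * Y w + b))).
  have -> : (fun w => Y w * cos (s * Y w + b)) =
    (fun w => Y w * (cos (s * Y w + b) * expR (0 * Y w))).
    by apply/funext => w; rewrite mul0r expR0 mulr1.
  apply: (@Ex_is_derive _ _ _ P (fun t w => cos (s * Y w + b) * expR (t * Y w))
    (fun t w => Y w * (cos (s * Y w + b) * expR (t * Y w))) 0 G).
  - move=> x _; have ie := gauss_itg_exp x v0 hY.
    apply: (itg_dom _ ie) => [|w].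
      by apply: measurable_funM => //; exact: itg_meas ie.
    rewrite normrM (ger0_norm (expR_ge0 _)) ler_piMl ?expR_ge0//.
    exact: cos_max.
  - by apply: itgZ; apply: itgD; exact: gauss_itg_exp hY.
  - by move=> x w; der; ring.
  - move=> x w; rewrite subr0 => x1.
    have h1 := pow_le_exp 1 (normr_ge0 (Y w)).
    rewrite !normrM (ger0_norm (expR_ge0 _)).
    have h2 : `|cos (s * Y w + b)| * expR (x * Y w) <= expR `|Y w|.
      rewrite -[leRHS]mul1r ler_pM ?expR_ge0// ?cos_max//.
      rewrite ler_expR (le_trans (ler_norm _))// normrM ler_piMl// ltW//.
    rewrite expr1 in h1.
    apply: (le_trans (ler_pM _ _ h1 h2)) => //.
    rewrite /G -mulrA expr1 ler_pM2l// -expRD.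
    have -> : `|Y w| + `|Y w| = `|2 * Y w|.
      by rewrite normrM ger0_norm//; ring.
    by rewrite mulNr; exact: expR_norm_le.
apply: (dr_unique dL); rewrite (_ : L = r)//; exact/funext.
Qed.

(** By [gauss_stein_cos], [phi] solves [phi' = - v t phi], so [exp (v t^2 / 2) phi t] is
    constant. *)
Lemma gauss_cos Y v s b : 0 <= v -> has_gauss_law P Y 0 v ->
  Ex P (fun w => cos (s * Y w + b)) = expR (- (v * s ^+ 2 / 2)) * cos b.
Proof.
move=> v0 hY; have mY := hY.1.
have msY t : measurable_fun setT (fun w => t * Y w + b).
  by apply: measurable_funD => //; exact: measurable_funM.
pose phi t := Ex P (fun w => cos (t * Y w + b)).
have iY : itg P Y by have := gauss_itg_pow 1 v0 hY.
have dphi t : is_derive t (1 : R) phi (- (v * t * phi t)).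
  have -> : - (v * t * phi t) = Ex P (fun w => - (Y w * sin (t * Y w + b))).
    transitivity (Ex P (fun w => Y w * cos (t * Y w + (b + pi / 2)))); last first.
      by apply: eq_Ex => w; rewrite addrA cosDpihalf mulrN.
    rewrite (gauss_stein_cos _ _ v0 hY).
    under eq_Ex do rewrite addrA sinDpihalf.
    by rewrite -/(phi t); ring.
  apply: (@Ex_is_derive _ _ _ P (fun t w => cos (t * Y w + b))
    (fun t w => - (Y w * sin (t * Y w + b))) t (fun w => `|Y w|)).
  - move=> x _; apply: (@itg_bnd _ _ _ P _ 1) => [|w]; last exact: cos_max.
    by apply: measurableT_comp (msY x); exact: continuous_measurable_fun (@continuous_cos R).
  - exact: itg_norm.
  - by move=> x w; der; ring.
  - by move=> x w _; rewrite normrN normrM ler_piMr// sin_max.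
pose h t := expR (v * t ^+ 2 / 2) * phi t.
have dh t : is_derive t (1 : R) h 0.
  by have hp := dphi t; rewrite /h; der; field.
have := is_derive_0_is_cst s 0 dh.
rewrite /h /phi; under [in RHS]eq_Ex do rewrite mul0r add0r.
rewrite Ex_cst expr0n /= mulr0 mul0r expR0 mul1r => <-.
by rewrite expRN mulKf// gt_eqF// expR_gt0.
Qed.

End gauss_rv.

(** * Frobenius product and trigonometric approximation *)

Section frobenius.
Context {R : realType}.

(** Lagrange's identity. *)
Lemma cauchy_sum (I : finType) (a b : I -> R) :
  (\sum_i a i * b i) ^+ 2 <= (\sum_i a i ^+ 2) * (\sum_i b i ^+ 2).
Proof.
have h : 0 <= \sum_i \sum_j (a i * b j - a j * b i) ^+ 2.
  by apply: sumr_ge0 => i _; apply: sumr_ge0 => j _; exact: sqr_ge0.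
have e : \sum_i \sum_j (a i * b j - a j * b i) ^+ 2 =
    2 * ((\sum_i a i ^+ 2) * (\sum_i b i ^+ 2)) - 2 * (\sum_i a i * b i) ^+ 2.
  transitivity (\sum_i \sum_j (a i ^+ 2 * b j ^+ 2 + a j ^+ 2 * b i ^+ 2
      - 2 * (a i * b i * (a j * b j)))).
    by apply: eq_bigr => i _; apply: eq_bigr => j _; ring.
  under eq_bigr do rewrite sumrB big_split/=.
  rewrite sumrB big_split /= [X in _ = X - _]mulrDl mul1r expr2.
  congr (_ + _ - _).
  - by rewrite big_distrlr.
  - by rewrite exchange_big big_distrlr.
  - by rewrite big_distrlr /= mulr_sumr; apply: eq_bigr => i _; rewrite mulr_sumr.
lra.
Qed.

Context {m n : nat}.
Implicit Types (A B C : 'M[R]_(m, n)).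

Definition dot A B : R := \sum_i \sum_j A i j * B i j.
Definition nrm A : R := Num.sqrt (dot A A).

Lemma dotC A B : dot A B = dot B A.
Proof. by apply: eq_bigr => i _; apply: eq_bigr => j _; rewrite mulrC. Qed.

Lemma dotDl A B C : dot (A + B) C = dot A C + dot B C.
Proof.
rewrite /dot -big_split; apply: eq_bigr => i _.
by rewrite -big_split; apply: eq_bigr => j _; rewrite mxE mulrDl.
Qed.

Lemma dotZl c A B : dot (c *: A) B = c * dot A B.
Proof.
rewrite /dot mulr_sumr; apply: eq_bigr => i _.
by rewrite mulr_sumr; apply: eq_bigr => j _; rewrite mxE mulrA.
Qed.

Lemma dotNl A B : dot (- A) B = - dot A B.
Proof. by rewrite -scaleN1r dotZl mulN1r. Qed.

Lemma dotBl A B C : dot (A - B) C = dot A C - dot B C.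
Proof. by rewrite dotDl dotNl. Qed.

Lemma dotDr A B C : dot A (B + C) = dot A B + dot A C.
Proof. by rewrite dotC dotDl !(dotC A). Qed.

Lemma dotZr c A B : dot A (c *: B) = c * dot A B.
Proof. by rewrite dotC dotZl dotC. Qed.

Lemma dotNr A B : dot A (- B) = - dot A B.
Proof. by rewrite dotC dotNl dotC. Qed.

Lemma dotBr A B C : dot A (B - C) = dot A B - dot A C.
Proof. by rewrite dotDr dotNr. Qed.

Lemma dot0l A : dot 0 A = 0.
Proof. by rewrite -(scale0r 0) dotZl mul0r. Qed.

Lemma dot_pair A B : dot A B = \sum_(p : 'I_m * 'I_n) A p.1 p.2 * B p.1 p.2.
Proof. by rewrite /dot pair_bigA. Qed.

Lemma dot_ge0 A : 0 <= dot A A.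
Proof.
by apply: sumr_ge0 => i _; apply: sumr_ge0 => j _; rewrite -expr2 sqr_ge0.
Qed.

Lemma dot_cauchy A B : dot A B ^+ 2 <= dot A A * dot B B.
Proof.
rewrite !dot_pair; apply: le_trans (cauchy_sum _ _) _.
by rewrite !(eq_bigr _ (fun p _ => expr2 _)).
Qed.

Lemma nrm_ge0 A : 0 <= nrm A. Proof. exact: sqrtr_ge0. Qed.

Lemma nrm_sqr A : nrm A ^+ 2 = dot A A.
Proof. by rewrite sqr_sqrtr// dot_ge0. Qed.

Lemma dot_le_nrm A B : `|dot A B| <= nrm A * nrm B.
Proof.
rewrite -(@ler_pXn2r _ 2)// ?nnegrE ?mulr_ge0 ?nrm_ge0//.
by rewrite real_normK ?num_real// exprMn !nrm_sqr dot_cauchy.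
Qed.

Lemma nrmZ c A : nrm (c *: A) = `|c| * nrm A.
Proof.
by rewrite /nrm dotZl dotZr mulrA -expr2 sqrtrM ?sqr_ge0// sqrtr_sqr.
Qed.

Lemma nrmD A B : nrm (A + B) <= nrm A + nrm B.
Proof.
rewrite -(@ler_pXn2r _ 2)// ?nnegrE ?addr_ge0 ?nrm_ge0//.
rewrite nrm_sqr dotDl !dotDr -!nrm_sqr (dotC B A).
have := le_trans (ler_norm _) (dot_le_nrm A B); nra.
Qed.

Lemma nrmN A : nrm (- A) = nrm A.
Proof. by rewrite /nrm dotNl dotNr opprK. Qed.

Lemma nrm_entry A i j : `|A i j| <= nrm A.
Proof.
rewrite -(@ler_pXn2r _ 2)// ?nnegrE ?nrm_ge0// nrm_sqr real_normK ?num_real//.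
rewrite dot_pair (bigD1 (i, j))//= -expr2 lerDl.
by apply: sumr_ge0 => p _; rewrite -expr2 sqr_ge0.
Qed.

Lemma nrm_le_sum A : nrm A <= \sum_i \sum_j `|A i j|.
Proof.
have s0 : 0 <= \sum_i \sum_j `|A i j|.
  by apply: sumr_ge0 => i _; exact: sumr_ge0.
rewrite -(@ler_pXn2r _ 2)// ?nnegrE ?nrm_ge0// nrm_sqr expr2.
rewrite dot_pair pair_bigA /= big_distrl /=; apply: ler_sum => p _.
rewrite -expr2 -(real_normK (num_real (A _ _))) expr2 ler_wpM2l//.
by rewrite (bigD1 p)//= lerDl sumr_ge0.
Qed.

End frobenius.

Lemma dot_delta (R : realType) m n (x : 'M[R]_(m, n)) i j :
  dot (delta_mx i j) x = x i j.
Proof.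
rewrite dot_pair (bigD1 (i, j))//= !mxE !eqxx mul1r big1 ?addr0// => -[k l] /=.
by rewrite xpair_eqE mxE => /negbTE ->; rewrite mul0r.
Qed.

Section frobenius_mul.
Context {R : realType}.

Lemma dot_mulmxl m n p (A : 'M[R]_(m, n)) (B : 'M[R]_(n, p)) (C : 'M[R]_(m, p)) :
  dot (A *m B) C = dot B (A^T *m C).
Proof.
transitivity (\sum_i \sum_j \sum_k A i k * B k j * C i j).
  apply: eq_bigr => i _; apply: eq_bigr => j _.
  by rewrite mxE mulr_suml.
transitivity (\sum_k \sum_j \sum_i A i k * B k j * C i j).
  rewrite [RHS](eq_bigr _ (fun k _ => exchange_big _ _ _ _ _ _))/=.
  rewrite [RHS]exchange_big /=; apply: eq_bigr => i _.
  by rewrite exchange_big.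
apply: eq_bigr => k _; apply: eq_bigr => j _; rewrite mxE mulr_sumr.
by apply: eq_bigr => i _; rewrite mxE mulrCA mulrA.
Qed.

Lemma dot_tr m n (A B : 'M[R]_(m, n)) : dot A^T B^T = dot A B.
Proof.
rewrite /dot exchange_big; apply: eq_bigr => i _; apply: eq_bigr => j _.
by rewrite !mxE.
Qed.

Lemma dot_mulmxr m n p (A : 'M[R]_(m, n)) (B : 'M[R]_(n, p)) (C : 'M[R]_(m, p)) :
  dot (A *m B) C = dot A (C *m B^T).
Proof. by rewrite -dot_tr trmx_mul dot_mulmxl -[RHS]dot_tr trmx_mul trmxK. Qed.

Lemma nrm_mulmx m n p (A : 'M[R]_(m, n)) (B : 'M[R]_(n, p)) :
  nrm (A *m B) <= nrm A * nrm B.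
Proof.
rewrite -(@ler_pXn2r _ 2)// ?nnegrE ?mulr_ge0 ?nrm_ge0// exprMn !nrm_sqr.
rewrite /dot [X in _ <= _ * X]exchange_big /= big_distrlr /=.
apply: ler_sum => i _; apply: ler_sum => j _.
by rewrite mxE -expr2 (le_trans (cauchy_sum _ _)).
Qed.

End frobenius_mul.

(** * Trigonometric polynomials and their Bernstein approximation *)

Section trig.
Context {R : realType} {m n : nat}.
Local Notation MX := 'M[R]_(m, n).
Implicit Types (x a : MX) (f g : MX -> R).

(* A trigonometric polynomial is the list of its terms (coefficient, frequency,
   phase). *)
Definition tp (s : seq (R * MX * R)) x : R :=
  \sum_(t <- s) t.1.1 * cos (dot t.1.2 x + t.2).

Definition is_trig f := exists s, forall x, f x = tp s x.

Lemma is_trig_cos c a b : is_trig (fun x => c * cos (dot a x + b)).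
Proof. by exists [:: (c, a, b)] => x; rewrite /tp big_seq1. Qed.

Lemma is_trigD f g : is_trig f -> is_trig g -> is_trig (fun x => f x + g x).
Proof.
by move=> [s hs] [u hu]; exists (s ++ u) => x; rewrite /tp big_cat hs hu.
Qed.

Lemma is_trig_cst c : is_trig (fun=> c).
Proof. by exists [:: (c, 0, 0)] => x; rewrite /tp big_seq1 dot0l addr0 cos0 mulr1. Qed.

Lemma is_trig_ext f g : f =1 g -> is_trig f -> is_trig g.
Proof. by move=> fg [s hs]; exists s => x; rewrite -fg. Qed.

Lemma is_trigM f g : is_trig f -> is_trig g -> is_trig (fun x => f x * g x).
Proof.
move=> [s hs] [u hu].
have key : is_trig (fun x => tp s x * tp u x).
  elim: s {hs} => [|[[c a] b] s IH].
    by apply: is_trig_ext (is_trig_cst 0) => x; rewrite /tp big_nil mul0r.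
  apply: (@is_trig_ext (fun x => c * cos (dot a x + b) * tp u x + tp s x * tp u x)).
    by move=> x; rewrite /tp big_cons mulrDl.
  apply: is_trigD => //.
  elim: u {hu IH} => [|[[c' a'] b'] u IH].
    by apply: is_trig_ext (is_trig_cst 0) => x; rewrite /tp big_nil mulr0.
  apply: (@is_trig_ext (fun x => (c * c' / 2 * cos (dot (a + a') x + (b + b')) +
     c * c' / 2 * cos (dot (a - a') x + (b - b'))) +
     c * cos (dot a x + b) * tp u x)).
    move=> x; rewrite /tp big_cons mulrDr; congr (_ + _).
    rewrite dotDl dotBl /=.
    rewrite (addrACA (dot a x)) (_ : dot a x - dot a' x + (b - b') =
      (dot a x + b) - (dot a' x + b')); last by ring.
    by rewrite !(cosD (dot a x + b)) cosN sinN; field.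
  by apply: is_trigD => //; apply: is_trigD; exact: is_trig_cos.
by apply: is_trig_ext key => x; rewrite hs hu.
Qed.

Lemma tp_bound s : exists C, forall x, `|tp s x| <= C.
Proof.
exists (\sum_(t <- s) `|t.1.1|) => x; apply: le_trans (ler_norm_sum _ _ _) _.
by apply: ler_sum => t _; rewrite normrM ler_piMr// cos_max.
Qed.

Definition upd x i j (t : R) : MX :=
  \matrix_(k, l) if (k == i) && (l == j) then t else x k l.

(* A contractive substitute for truncation under which Lipschitz functions become
   uniformly approximable by trigonometric polynomials. *)
Definition sinm (L : R) x : MX := \matrix_(i, j) (L * sin (x i j / L)).

Lemma upd_id x i j : upd x i j (x i j) = x.
Proof. by apply/matrixP => k l; rewrite mxE; case: ifP => // /andP[/eqP-> /eqP->]. Qed.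

Lemma upd_upd x i j t t' : upd (upd x i j t) i j t' = upd x i j t'.
Proof. by apply/matrixP => k l; rewrite !mxE; case: ifP => // ->. Qed.

Lemma upd_comm x i j i' j' t t' : (i, j) != (i', j') ->
  upd (upd x i j t) i' j' t' = upd (upd x i' j' t') i j t.
Proof.
move=> ne; apply/matrixP => k l; rewrite !mxE.
case: ifP => // /andP[/eqP ki /eqP lj]; case: ifP => // /andP[/eqP ki' /eqP lj'].
by move: ne; rewrite -ki -lj ki' lj' eqxx.
Qed.

(** The approximation changes one entry at a time, and fixing an entry at a node of the kernel
    preserves this condition. *)
Definition coord_lip K f := forall x i j t t',
  `|f (upd x i j t) - f (upd x i j t')| <= K * `|t - t'|.

Lemma is_trig_sum (I : Type) (r : seq I) (F : I -> MX -> R) :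
  (forall i, is_trig (F i)) -> is_trig (fun x => \sum_(i <- r) F i x).
Proof.
move=> h; elim: r => [|i r IH].
  by apply: is_trig_ext (is_trig_cst 0) => x; rewrite big_nil.
by apply: is_trig_ext (is_trigD (h i) IH) => x; rewrite big_cons.
Qed.

Lemma is_trig_sin (L : R) i j : is_trig (fun x => sin (x i j / L)).
Proof.
apply: is_trig_ext (is_trig_cos 1 (L^-1 *: delta_mx i j) (- (pi / 2))) => x.
rewrite mul1r cosBpihalf dotZl dot_delta.
by rewrite mulrC.
Qed.

(* The weights are the law of a random walk with success probability
   [(1 + sin (x i j / L)) / 2]: this is the Bernstein kernel read in an angular
   variable. *)
Lemma trig_kernel (L : R) i j (D : nat) :
  exists (I : finType) (b : I -> MX -> R) (t : I -> R),
  [/\ forall k, is_trig (b k), forall k x, 0 <= b k x,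
      forall x, \sum_k b k x = 1 &
      forall x, let z := (1 + sin (x i j / L)) / 2 in
        \sum_k b k x * (t k - D%:R * z) ^+ 2 = D%:R * (z * (1 - z))].
Proof.
pose z x := (1 + sin (x i j / L)) / 2.
have z01 x : 0 <= z x <= 1.
  by have := sin_max (x i j / L); rewrite ler_norml /z; lra.
have tz : is_trig z.
  apply: (@is_trig_ext (fun x => 2^-1 + 2^-1 * sin (x i j / L))).
    by move=> x; rewrite /z; field.
  apply: is_trigD; first exact: is_trig_cst.
  by apply: is_trigM; [exact: is_trig_cst|exact: is_trig_sin].
have tz1 : is_trig (fun x => 1 - z x).
  apply: (@is_trig_ext (fun x => 1 + (- 1) * z x)); first by move=> x; ring.
  apply: is_trigD; first exact: is_trig_cst.
  by apply: is_trigM => //; exact: is_trig_cst.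
elim: D => [|D [I [b [t [bt b0 b1 bv]]]]].
  exists unit, (fun=> cst 1), (fun=> 0); split => //.
  - by move=> k; exact: is_trig_cst.
  - by move=> x; rewrite big_const card_unit /= addr0.
  - by move=> x /=; rewrite big_const card_unit /= mul0r subrr expr0n /= mulr0 mul0r addr0.
(* One more step of the walk: the boolean records its success, and the variance grows by
   [z (1 - z)]. *)
exists (bool * I)%type,
  (fun (p : bool * I) x => (if p.1 then z x else 1 - z x) * b p.2 x),
  (fun p : bool * I => t p.2 + p.1%:R); split.
- by move=> [[] k] /=; exact: is_trigM.
- by move=> [[] k] x /=; rewrite mulr_ge0//; have := z01 x; lra.
- move=> x; rewrite -(pair_bigA _ (fun c k => (if c then z x else 1 - z x) * b k x)) /=.
  by rewrite big_bool /= -!mulr_sumr b1; ring.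
- move=> x /=; rewrite -/(z x).
  rewrite -(pair_bigA _ (fun c k => (if c then z x else 1 - z x) * b k x *
     (t k + c%:R - D.+1%:R * z x) ^+ 2)) /=.
  rewrite big_bool /= -big_split /=.
  have := bv x; rewrite -/(z x) /= => e.
  transitivity (\sum_k (b k x * (t k - D%:R * z x) ^+ 2 + z x * (1 - z x) * b k x)).
    by apply: eq_bigr => k _; rewrite -natr1; ring.
  by rewrite big_split /= e -mulr_sumr b1 -natr1; ring.
Qed.

(** Induction over the entries on which [f] depends. One entry is averaged over the nodes of its
    Bernstein kernel, at a cost [e]; with that entry fixed at a node, [f] depends on the remaining
    entries only. *)
Lemma trig_approx_on (K L e : R) : 0 <= K -> 0 < L -> 0 < e ->
  forall (s : seq ('I_m * 'I_n)) f, coord_lip K f ->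
  (forall x y : MX, (forall p, p \in s -> x p.1 p.2 = y p.1 p.2) -> f x = f y) ->
  exists2 p, is_trig p & forall x, `|p x - f (sinm L x)| <= e * (size s)%:R.
Proof.
move=> K0 L0 e0; elim => [|[i j] s IH] f fK fs.
  exists (fun=> f 0); first exact: is_trig_cst.
  by move=> x; rewrite (fs 0 (sinm L x))// subrr normr0 mulr0.
have [N N0 hN] : exists2 N : nat, (0 < N)%N & 2 * L * K <= e * N%:R.
  exists (Num.truncn (2 * L * K / e)).+1 => //.
  rewrite -ler_pdivrMl// mulrC; apply: ltW; exact: truncnS_gt.
(* A walk of [N^2] steps makes the spread of the rescaled nodes [tk] of order [L / N]. *)
pose D := (N * N)%N.
have [I [b [t [bt b0 b1 bv]]]] := trig_kernel L i j D.
pose tk k := L * (2 * t k / D%:R - 1).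
have /choice[p hp] k : exists p, is_trig p /\
    forall x, `|p x - f (upd (sinm L x) i j (tk k))| <= e * (size s)%:R.
  have [||p pt hp] := IH (fun x => f (upd x i j (tk k))); last by exists p.
  - move=> x i' j' u u'; have [[<- <-]|ne] := eqVneq (i, j) (i', j').
      by rewrite !upd_upd subrr normr0 mulr_ge0.
    rewrite eq_sym in ne.
    by rewrite !(upd_comm _ _ _ ne); exact: fK.
  - move=> x y xy; apply: fs => -[k' l']; rewrite !mxE /= in_cons xpair_eqE.
    by case: ifP => //= _; exact: xy.
exists (fun x => \sum_k b k x * p k x).
  by apply: is_trig_sum => k; apply: is_trigM => //; have [] := hp k.
move=> x; pose y := sinm L x; pose z := (1 + sin (x i j / L)) / 2.
have yij : y i j = L * (2 * z - 1) by rewrite mxE /z; congr (_ * _); field.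
have D0 : 0 < D%:R :> R by rewrite ltr0n muln_gt0 N0.
have NR0 : 0 < N%:R :> R by rewrite ltr0n.
have -> : \sum_k b k x * p k x - f y =
    \sum_k b k x * (p k x - f (upd y i j (tk k))) +
    \sum_k b k x * (f (upd y i j (tk k)) - f (upd y i j (y i j))).
  rewrite -[in LHS](mul1r (f y)) -(b1 x) mulr_suml -sumrB -big_split /=.
  by apply: eq_bigr => k _; rewrite upd_id; ring.
rewrite (le_trans (ler_normD _ _))//= -natr1 mulrDr mulr1 lerD//.
  rewrite (_ : e * (size s)%:R = \sum_k b k x * (e * (size s)%:R)); last first.
    by rewrite -mulr_suml b1 mul1r.
  rewrite (le_trans (ler_norm_sum _ _ _))//; apply: ler_sum => k _; rewrite normrM ger0_norm// ler_wpM2l//.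
  exact: (hp k).2.
rewrite (le_trans (ler_norm_sum _ _ _))//.
(* [2 u <= u^2 / N + N] with [u = |t k - D z|] replaces the first absolute moment by the variance
   given by the kernel. *)
apply: (@le_trans _ _ (\sum_k (K * L / (D%:R * N%:R) * (b k x * (t k - D%:R * z) ^+ 2)
   + K * L / D%:R * N%:R * b k x))).
  apply: ler_sum => k _; rewrite normrM ger0_norm//.
  apply: (@le_trans _ _ (b k x * (K * `|tk k - y i j|))).
    by rewrite ler_wpM2l.
  have -> : tk k - y i j = 2 * L / D%:R * (t k - D%:R * z).
    by rewrite yij /tk; field; rewrite gt_eqF.
  rewrite normrM (@ger0_norm _ (2 * L / D%:R)); last first.
    by rewrite divr_ge0 ?ltW// mulr_gt0.
  rewrite -(real_normK (num_real (t k - D%:R * z))).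
  set u : R := `|t k - _|.
  rewrite -subr_ge0.
  have -> : forall B, K * L / (D%:R * N%:R) * (B * u ^+ 2) + K * L / D%:R * N%:R * B
    - B * (K * (2 * L / D%:R * u)) = B * (K * (L / (D%:R * N%:R) * (u - N%:R) ^+ 2)).
    by move=> B; field; rewrite !gt_eqF.
  apply: mulr_ge0 => //; apply: mulr_ge0 => //; apply: mulr_ge0.
    by rewrite divr_ge0 ?mulr_ge0// ltW.
  exact: sqr_ge0.
rewrite big_split /= -!mulr_sumr b1 bv -/z mulr1.
have z1 : z * (1 - z) <= 1.
  have : 0 <= z <= 1 by have := sin_max (x i j / L); rewrite ler_norml /z; lra.
  by nra.
have z0 : 0 <= z * (1 - z).
  have : 0 <= z <= 1 by have := sin_max (x i j / L); rewrite ler_norml /z; lra.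
  by move=> /andP[? ?]; rewrite mulr_ge0// subr_ge0.
have -> : K * L / (D%:R * N%:R) * (D%:R * (z * (1 - z))) + K * L / D%:R * N%:R =
   (K * L / N%:R) * (z * (1 - z)) + K * L / N%:R.
  by rewrite /D natrM; field; rewrite gt_eqF.
have KL : 0 <= K * L / N%:R by rewrite divr_ge0 ?mulr_ge0// ltW.
apply: (@le_trans _ _ (K * L / N%:R + K * L / N%:R)).
  by rewrite lerD2r ler_piMr.
by rewrite -mulrDl ler_pdivrMr//; apply: le_trans hN; lra.
Qed.

Lemma lip_coord_lip K f : (forall x y, `|f x - f y| <= K * nrm (x - y)) -> coord_lip K f.
Proof.
move=> fK x i j t t'; apply: (le_trans (fK _ _)).
have -> : upd x i j t - upd x i j t' = (t - t') *: delta_mx i j.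
  apply/matrixP => k l; rewrite !mxE.
  by case: ifP => _; rewrite ?mulr1// subrr mulr0.
rewrite nrmZ (_ : nrm _ = 1) ?mulr1//.
rewrite /nrm dot_pair (bigD1 (i, j))//= big1 => [|[k l]].
  by rewrite !mxE !eqxx /= mulr1 addr0 sqrtr1.
by rewrite xpair_eqE /= !mxE => /negbTE ->; rewrite mul0r.
Qed.

Lemma lip_trig_approx (K L e : R) f : 0 <= K -> 0 < L -> 0 < e ->
  (forall x y, `|f x - f y| <= K * nrm (x - y)) ->
  exists s, forall x, `|tp s x - f (sinm L x)| <= e.
Proof.
(* The successor keeps the tolerance positive for a matrix without entries. *)
move=> K0 L0 e0 fK; pose M := (size (enum {: 'I_m * 'I_n})).+1.
have M0 : 0 < M%:R :> R by [].
have [|||p [s ps] hp] := @trig_approx_on K L (e / M%:R) K0 L0 _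
   (enum {: 'I_m * 'I_n}) f.
- by rewrite divr_gt0.
- exact: lip_coord_lip.
- move=> x y xy; congr f; apply/matrixP => i j.
  by apply: (xy (i, j)); rewrite mem_enum.
exists s => x; rewrite -ps; apply: (le_trans (hp x)).
by rewrite mulrAC ler_pdivrMr// ler_wpM2l ?(ltW e0)// ?ler_nat.
Qed.

Lemma sin_lip (x y : R) : `|sin x - sin y| <= `|x - y|.
Proof.
wlog xy : x y / x < y.
  move=> h; have [/h//|yx|->] := ltgtP x y; last by rewrite !subrr normr0.
  by rewrite distrC (distrC x); exact: h.
have [c _ e] := MVT xy (fun z _ => is_derive_sin z)
  (continuous_subspaceT (@continuous_sin R)).
by rewrite distrC e normrM (distrC x) ler_piMl// cos_max.
Qed.

Lemma sinm_lip (L : R) x y : 0 < L -> nrm (sinm L x - sinm L y) <= nrm (x - y).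
Proof.
move=> L0; rewrite -(@ler_pXn2r _ 2)// ?nnegrE ?nrm_ge0// !nrm_sqr !dot_pair.
apply: ler_sum => -[i j] _; rewrite -!expr2 /= -ler_sqrt ?sqr_ge0// !sqrtr_sqr.
rewrite !mxE -mulrBr normrM gtr0_norm// mulrC -ler_pdivlMr//.
apply: (le_trans (sin_lip _ _)).
by rewrite -mulrBl normrM (gtr0_norm (_ : 0 < L^-1))// invr_gt0.
Qed.

End trig.

Section approximation.
Context {R : realType} {m n : nat}.
Local Notation MX := 'M[R]_(m, n).

Lemma cos_lip (x y : R) : `|cos x - cos y| <= `|x - y|.
Proof.
rewrite -!sinDpihalf; apply: (le_trans (sin_lip _ _)).
by rewrite opprD addrACA subrr addr0.
Qed.

Lemma sin_id_sqr (y : R) : `|sin y - y| <= y ^+ 2.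
Proof.
have [->|y0] := eqVneq y 0; first by rewrite sin0 subrr normr0 expr0n.
have dh z : is_derive z (1 : R) (fun z => sin z - z) (cos z - 1) by der; ring.
have ch a b : {within `[a, b], continuous (fun z : R => sin z - z)}.
  by apply: derivable_within_continuous => z _; have [] := dh z.
have cb c : `|c| <= `|y| -> `|cos c - 1| <= `|y|.
  move=> cy; have := cos_lip c 0; rewrite cos0 subr0 => h.
  exact: le_trans h cy.
rewrite -real_normK ?num_real// expr2.
have [yp|yn] := ltP 0 y.
  have [c /[!in_itv]/= /andP[c0 cy] e] := MVT yp (fun z _ => dh z) (ch _ _).
  move: e; rewrite sin0 !subr0 => ->; rewrite normrM ler_wpM2r// cb//.
  by rewrite !gtr0_norm// ltW.
have yn' : y < 0 by rewrite lt_neqAle y0.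
have [c /[!in_itv]/= /andP[yc c0] e] := MVT yn' (fun z _ => dh z) (ch _ _).
move: e; rewrite sin0 subrr !sub0r => /eqP; rewrite eqr_oppLR => /eqP ->.
rewrite normrN normrM normrN ler_wpM2r// cb//.
by rewrite !ltr0_norm// lerN2 ltW.
Qed.

(** The error is quadratic in [x], hence integrable as soon as second moments exist, and it vanishes
    as [L] grows. *)
Lemma sinm_near (L : R) (x : MX) : 0 < L ->
  nrm (sinm L x - x) <= dot x x / L.
Proof.
move=> L0; apply: (le_trans (nrm_le_sum _)).
rewrite /dot mulr_suml; apply: ler_sum => i _.
rewrite mulr_suml; apply: ler_sum => j _; rewrite !mxE.
rewrite {2}(_ : x i j = L * (x i j / L)); last by field; rewrite gt_eqF.
rewrite -mulrBr normrM gtr0_norm//.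
apply: (@le_trans _ _ (L * (x i j / L) ^+ 2)).
  by rewrite ler_pM2l// sin_id_sqr.
by rewrite le_eqVlt; apply/orP; left; apply/eqP; field; rewrite gt_eqF.
Qed.

(** Truncation level and precision are tied to the same [k]. The first bound provides domination and
    the second pointwise convergence, so measurability and equality of characteristic functions both
    extend to [f]. *)
Lemma lip_trig_seq (K B : R) (f : MX -> R) : 0 <= K ->
  (forall x y, `|f x - f y| <= K * nrm (x - y)) -> (forall x, `|f x| <= B) ->
  exists s : nat -> seq (R * MX * R),
    (forall k x, `|tp (s k) x| <= B + 1) /\
    (forall k x, `|tp (s k) x - f x| <= (1 + K * dot x x) / k.+1%:R).
Proof.
move=> K0 fK fB.
have /choice[s hs] k : exists s, forall x, `|tp s x - f (sinm k.+1%:R x)| <= k.+1%:R^-1.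
  by apply: (@lip_trig_approx _ _ _ K) => //; rewrite invr_gt0.
exists s; split => k x.
  rewrite -[tp _ _](subrK (f (sinm k.+1%:R x))) addrC (le_trans (ler_normD _ _))//.
  by rewrite lerD// (le_trans (hs k x))// invf_le1// ler1n.
rewrite -[tp _ _](subrK (f (sinm k.+1%:R x))) -addrA (le_trans (ler_normD _ _))//.
rewrite mulrDl mul1r lerD// (le_trans (fK _ _))// -mulrA ler_wpM2l//.
exact: sinm_near.
Qed.

End approximation.

(** * Characteristic functions determine laws *)

Section matrix_rv.
Context {R : realType} {m n : nat}.
Local Notation MX := 'M[R]_(m, n).

Definition mmeas d (T : measurableType d) (Y : T -> MX) :=
  forall i j, measurable_fun setT (fun w => Y w i j).

Section one_space.
Context {d : measure_display} {T : measurableType d} (P : probability T R)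
  (Y : T -> MX).
Hypothesis mY : mmeas Y.

Lemma mmeas_dot a : measurable_fun setT (fun w => dot a (Y w)).
Proof.
by apply: measurable_sum => i; apply: measurable_sum => j; exact: measurable_funM.
Qed.

Lemma mmeas_cos a b : measurable_fun setT (fun w => cos (dot a (Y w) + b)).
Proof.
apply: measurableT_comp; first exact: continuous_measurable_fun (@continuous_cos R).
by apply: measurable_funD => //; exact: mmeas_dot.
Qed.

Lemma mmeas_tp s : measurable_fun setT (fun w => tp s (Y w)).
Proof. by apply: measurable_sum => t; apply: measurable_funM => //; exact: mmeas_cos. Qed.

Lemma itg_cos a b : itg P (fun w => cos (dot a (Y w) + b)).
Proof.
apply: (@itg_bnd _ _ _ P _ 1); first exact: mmeas_cos.
by move=> w; exact: cos_max.
Qed.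

Lemma Ex_tp s : Ex P (fun w => tp s (Y w)) =
  \sum_(t <- s) t.1.1 * Ex P (fun w => cos (dot t.1.2 (Y w) + t.2)).
Proof.
rewrite /tp Ex_sum; last by move=> t; apply: itgZ; exact: itg_cos.
by apply: eq_bigr => t _; rewrite ExZ//; exact: itg_cos.
Qed.

Lemma cvg_inv_bound (u : nat -> R) (l C : R) :
  (forall k, `|u k - l| <= C / k.+1%:R) -> u k @[k --> \oo] --> l.
Proof.
move=> h; apply/cvgrPdist_le => e e0.
have : C * (harmonic k) @[k --> \oo] --> (C * 0 : R).
  by apply: cvgM; [exact: cvg_cst|exact: cvg_harmonic].
rewrite mulr0 => /cvgrPdist_le /(_ _ e0); apply: filterS => k.
rewrite sub0r normrN distrC => hk; apply: (le_trans (h k)).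
exact: le_trans (ler_norm _) hk.
Qed.

Lemma mmeas_lip (K B : R) (f : MX -> R) : 0 <= K ->
  (forall x y, `|f x - f y| <= K * nrm (x - y)) -> (forall x, `|f x| <= B) ->
  measurable_fun setT (fun w => f (Y w)).
Proof.
move=> K0 fK fB; have [s [sB sf]] := lip_trig_seq K0 fK fB.
apply: (@measurable_fun_cvg _ _ _ _ (fun k w => tp (s k) (Y w))).
  by move=> k; exact: mmeas_tp.
by move=> w _; apply: cvg_inv_bound => k; exact: sf.
Qed.

Lemma cvg_Ex_lip (K B : R) (f : MX -> R) (s : nat -> seq (R * MX * R)) :
  0 <= K -> (forall x y, `|f x - f y| <= K * nrm (x - y)) ->
  (forall x, `|f x| <= B) ->
  (forall k x, `|tp (s k) x| <= B + 1) ->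
  (forall k x, `|tp (s k) x - f x| <= (1 + K * dot x x) / k.+1%:R) ->
  Ex P (fun w => tp (s k) (Y w)) @[k --> \oo] --> Ex P (fun w => f (Y w)).
Proof.
move=> K0 fK fB sB sf.
apply: (@Ex_dominated _ _ _ P _ _ (fun=> B + 1)).
- by move=> k; exact: mmeas_tp.
- exact: (mmeas_lip K0 fK fB).
- exact: itg_cst.
- by move=> k w; exact: sB.
- by move=> w; apply: cvg_inv_bound => k; exact: sf.
Qed.

End one_space.

Section uniqueness.
Context {d d' : measure_display} {T : measurableType d} {T' : measurableType d'}
  (P : probability T R) (P' : probability T' R) (Y : T -> MX) (Y' : T' -> MX).
Hypotheses (mY : mmeas Y) (mY' : mmeas Y').
Hypothesis cf : forall a b, Ex P (fun w => cos (dot a (Y w) + b)) =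
  Ex P' (fun w => cos (dot a (Y' w) + b)).

Lemma cf_lip (K B : R) (f : MX -> R) : 0 <= K ->
  (forall x y, `|f x - f y| <= K * nrm (x - y)) -> (forall x, `|f x| <= B) ->
  Ex P (fun w => f (Y w)) = Ex P' (fun w => f (Y' w)).
Proof.
move=> K0 fK fB; have [s [sB sf]] := lip_trig_seq K0 fK fB.
have h := cvg_Ex_lip (P := P) mY K0 fK fB sB sf.
have h' := cvg_Ex_lip (P := P') mY' K0 fK fB sB sf.
rewrite (_ : (fun k => Ex P _) = (fun k => Ex P' (fun w => tp (s k) (Y' w)))) in h.
  exact: (cvg_unique _ h h').
by apply/funext => k; rewrite !Ex_tp//; apply: eq_bigr => t _; rewrite cf.
Qed.

End uniqueness.

(* The distance to a closed set, truncated: these Lipschitz functions increase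
   to the indicator of the complement. *)
Lemma open_lip_approx (U : set MX) : open U ->
  exists f : nat -> MX -> R, forall k,
    [/\ forall x y, `|f k x - f k y| <= k%:R * nrm (x - y),
        forall x, `|f k x| <= 1 &
        forall x, f ^~ x @ \oo --> (\1_U x : R)].
Proof.
(* The infimum defining the distance needs a point outside [U]. *)
move=> oU; have [UT|/eqP UT] := pselect (U = setT).
  exists (fun _ _ => 1) => k; split => [x y|x|x].
  - by rewrite subrr normr0 mulr_ge0// nrm_ge0.
  - by rewrite normr1.
  - by rewrite indicE UT in_setT; exact: cvg_cst.
have [z0 Uz0] : exists z, ~ U z.
  by apply/existsNP => h; move/eqP: UT; apply; apply/seteqP; split.
pose D (x : MX) := [set r : R | exists2 y, ~ U y & r = nrm (x - y)].
have Dn x : D x !=set0 by exists (nrm (x - z0)), z0.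
have Dlb x : lbound (D x) 0 by move=> r [y _ ->]; exact: nrm_ge0.
have Dhi x : has_inf (D x) by split => //; exists 0.
pose dist x := inf (D x).
have dist0 x : 0 <= dist x by apply: lb_le_inf.
have distlip x y : dist x <= dist y + nrm (x - y).
  rewrite -lerBlDr; apply: lb_le_inf => // r [z Uz ->].
  rewrite lerBlDr; apply: (@le_trans _ _ (nrm (x - z))).
    by apply: ge_inf; [exists 0|exists z].
  by rewrite -[x - z](subrKA y) addrC; exact: nrmD.
have distU x : ~ U x -> dist x = 0.
  move=> Ux; apply/eqP; rewrite eq_le dist0 andbT.
  apply: ge_inf; first by exists 0.
  by exists x => //; rewrite subrr /nrm dot0l sqrtr0.
have distpos x : U x -> 0 < dist x.
  move=> Ux; have : nbhs x U by exact: open_nbhs_nbhs.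
  move=> /nbhs_ballP[e /= e0 eU]; apply: (lt_le_trans e0).
  apply: lb_le_inf => // r [y Uy ->]; rewrite leNgt; apply/negP => xye.
  apply: Uy; apply: eU; split => // i j; rewrite /ball /=.
  by apply: le_lt_trans xye; rewrite (le_trans _ (nrm_entry _ i j))// !mxE.
exists (fun k x => Num.min 1 (k%:R * dist x)) => k; split => [x y|x|x].
- have key a b : a <= b + k%:R * nrm (x - y) -> 
    Num.min 1 a <= Num.min 1 b + k%:R * nrm (x - y).
    move=> ab; have t0 : 0 <= k%:R * nrm (x - y) by rewrite mulr_ge0 ?nrm_ge0.
    by rewrite ge_min !minElt; case: ltP => ?; case: ltP => ?; lra.
  rewrite ler_distl lerBlDr; apply/andP; split; apply: key.
    rewrite -mulrDr ler_wpM2l// -nrmN opprB; exact: distlip.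
  by rewrite -mulrDr ler_wpM2l// distlip.
- rewrite ger0_norm ?ge_min ?lexx// le_min ler01 /=.
  by rewrite mulr_ge0.
- rewrite indicE; case: (boolP (x \in U)) => [/set_mem Ux|/negP Ux].
    apply: (@cvg_near_cst _ _ _ _).
    near=> l; apply/eqP; rewrite min_l// -ler_pdivrMr ?distpos// mul1r.
    near: l; exists (Num.truncn (dist x)^-1).+1 => // l /= hl.
    by rewrite ltW// (lt_le_trans (truncnS_gt _))// ler_nat.
  rewrite distU; last by move=> h; apply: Ux; exact: mem_set.
  under eq_fun do rewrite mulr0 (min_r ler01).
  exact: cvg_cst.
Unshelve. all: end_near. Qed.

Notation borel_mx := (g_sigma_algebraType (@open MX)).

Lemma measurable_borel_coord i j :
  measurable_fun setT (fun x : borel_mx => (x : MX) i j).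
Proof.
suff : measurable_fun setT
    ((fun x => (x : MX) i j) : borel_mx -> measurableTypeR R) by [].
apply: (@measurability _ _ borel_mx (measurableTypeR R) setT _
  (@RGenOpens.G R) (RGenOpens.measurableE R)).
move=> _ [_ [a [b ->]] <-]; rewrite setTI.
apply: sub_sigma_algebra; apply: open_comp => [x _|].
  exact: coord_continuous.
exact: interval_open.
Qed.

Lemma mmeas_open d (T : measurableType d) (Y : T -> MX) (U : set MX) :
  mmeas Y -> open U -> measurable (Y @^-1` U).
Proof.
move=> mY oU; have [f hf] := open_lip_approx oU.
have m1 : measurable_fun setT (fun w => \1_U (Y w) : R).
  apply: (@measurable_fun_cvg _ _ _ _ (fun k w => f k (Y w))).
    move=> k; have [fl f1 _] := hf k.
    exact: (mmeas_lip mY _ fl f1).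
  by move=> w _; have [_ _] := hf 0; apply.
have := m1 measurableT _ (measurable_set1 1); rewrite setTI.
congr measurable; apply/seteqP; split => w /=; rewrite indicE.
  by case: (boolP (Y w \in U)) => [/set_mem//|_ /eqP]; rewrite eq_sym oner_eq0.
by move=> Uw; rewrite mem_set.
Qed.

Lemma mmeas_borel d (T : measurableType d) (Y : T -> MX) :
  mmeas Y -> measurable_fun setT (Y : T -> borel_mx).
Proof.
move=> mY; apply: (@measurability _ _ T borel_mx setT Y (@open MX)) => //.
by move=> _ [U oU <-]; rewrite setTI; exact: mmeas_open.
Qed.

Section law.
Context {d d' : measure_display} {T : measurableType d} {T' : measurableType d'}
  (P : probability T R) (P' : probability T' R) (Y : T -> MX) (Y' : T' -> MX).
Hypotheses (mY : mmeas Y) (mY' : mmeas Y').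
Hypothesis cf : forall a b, Ex P (fun w => cos (dot a (Y w) + b)) =
  Ex P' (fun w => cos (dot a (Y' w) + b)).

Lemma cf_open (U : set MX) : open U -> P (Y @^-1` U) = P' (Y' @^-1` U).
Proof.
move=> oU; have [f hf] := open_lip_approx oU.
have mU := mmeas_open mY oU; have mU' := mmeas_open mY' oU.
have cvgE d0 (T0 : measurableType d0) (P0 : probability T0 R) (Y0 : T0 -> MX) :
    mmeas Y0 -> Ex P0 (fun w => f k (Y0 w)) @[k --> \oo] -->
      Ex P0 (\1_(Y0 @^-1` U) : T0 -> R).
  move=> mY0; apply: (@Ex_dominated _ _ _ P0 _ _ (fun=> 1)).
  - move=> k; have [fl f1 _] := hf k; exact: (mmeas_lip mY0 _ fl f1).
  - exact/measurable_indic/mmeas_open.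
  - exact: itg_cst.
  - by move=> k w; have [_ f1 _] := hf k; exact: f1.
  - by move=> w; have [_ _] := hf 0; apply.
have EP d0 (T0 : measurableType d0) (P0 : probability T0 R) (A : set T0) :
    measurable A -> (Ex P0 (\1_A : T0 -> R))%:E = P0 A.
  move=> mA; rewrite EFin_Ex; first by rewrite integral_indic// setIT.
  exact: integrable_indic.
rewrite -EP// -[RHS]EP//; congr EFin.
have h := cvgE _ _ P _ mY; have h' := cvgE _ _ P' _ mY'.
rewrite (_ : (fun k => Ex P _) = (fun k => Ex P' (fun w => f k (Y' w)))) in h.
  exact: (cvg_unique _ h h').
apply/funext => k; have [fl f1 _] := hf k.
exact: (cf_lip mY mY' cf _ fl f1).
Qed.

(** Open sets are stable under intersection and generate the Borel sets, so agreement on them is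
    enough. *)
Lemma cf_law (B : set MX) : <<s [set A : set MX | open A] >> B ->
  P (Y @^-1` B) = P' (Y' @^-1` B).
Proof.
move=> hB.
have mB := mmeas_borel mY; have mB' := mmeas_borel mY'.
pose m1 := measure_function_pushforward__canonical__measure_function_Measure P mB.
pose m2 := measure_function_pushforward__canonical__measure_function_Measure P' mB'.
apply: (@g_sigma_algebra_measure_unique _ R borel_mx (@open MX) _ (fun=> setT) _ _ m1 m2) => //.
- by move=> U oU; exact: sub_sigma_algebra.
- by move=> _; exact: openT.
- by apply/seteqP; split => // x _; exists 0%N.
- by move=> U V; exact: openI.
- by move=> U oU; exact: cf_open.
- move=> _; rewrite -[X in (X < _)%E]/(P setT).
  by rewrite probability_setT ltry.
Qed.

(** Equality of laws for unbounded integrable functions: the rotation argument applies it to one of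
    quadratic growth. *)
Lemma cf_Ex (F : MX -> R) : measurable_fun setT (F : borel_mx -> R) ->
  itg P (fun w => F (Y w)) -> itg P' (fun w => F (Y' w)) ->
  Ex P (fun w => F (Y w)) = Ex P' (fun w => F (Y' w)).
Proof.
move=> mF i1 i2.
have mB := mmeas_borel mY; have mB' := mmeas_borel mY'.
have mEF : measurable_fun setT (EFin \o F : borel_mx -> \bar R).
  exact/measurable_EFinP.
rewrite /Ex /Rintegral; congr fine.
transitivity (\int[pushforward P (Y : T -> borel_mx)]_x (F x)%:E)%E.
  by rewrite (integral_pushforward mB mEF i1 measurableT).
transitivity (\int[pushforward P' (Y' : T' -> borel_mx)]_x (F x)%:E)%E; last first.
  by rewrite (integral_pushforward mB' mEF i2 measurableT).
apply: eq_measure_integral => A mA _; exact: cf_law.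
Qed.

End law.

End matrix_rv.

(** * Gaussian vectors *)

Section product.
Context {R : realType} {d d' : measure_display} {T : measurableType d}
  {T' : measurableType d'} (P : probability T R) (P' : probability T' R).

Definition pprod : probability (T * T')%type R := (P \x P')%E.

Lemma itg_prodP (f : T * T' -> R) (F : T -> R) : measurable_fun setT f ->
  (forall w, itg P' (fun w' => f (w, w'))) -> itg P F ->
  (forall w, Ex P' (fun w' => `|f (w, w')|) <= F w) -> itg pprod f.
Proof.
move=> mf i1 iF hF.
have mEf : measurable_fun setT (EFin \o f) by exact/measurable_EFinP.
apply/(integrable12ltyP _ _ mEf) => /=.
apply: le_lt_trans (integrable_lty measurableT iF).
apply: ge0_le_integral => //=.
- by move=> w _; apply: integral_ge0.
- have mf' : measurable_fun setT (fun z => `|f z|%:E).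
    by apply/measurable_EFinP; exact: measurableT_comp.
  have f0 z : (0 <= `|f z|%:E)%E by rewrite lee_fin.
  exact: (@measurable_fun_fubini_tonelli_F _ _ T T' R P' _ mf' f0).
- exact: measurable_int iF.
- move=> w _; apply: (@le_trans _ _ (Ex P' (fun w' => `|f (w, w')|))%:E).
    by rewrite EFin_Ex//; exact: itg_norm.
  by rewrite lee_fin.
Qed.

Lemma itg_fst (f : T -> R) : itg P f -> itg pprod (fun z => f z.1).
Proof.
move=> hf; have mf := itg_meas hf.
apply: (@itg_prodP _ (fun w => `|f w|)).
- exact: (measurableT_comp mf).
- by move=> w; have := itg_cst P' (f w).
- exact: itg_norm.
- by move=> w; rewrite -[leLHS]/(Ex P' (fun=> `|f w|)) Ex_cst.
Qed.

Lemma itg_snd (f : T' -> R) : itg P' f -> itg pprod (fun z => f z.2).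
Proof.
move=> hf; have mf := itg_meas hf.
apply: (@itg_prodP _ (fun=> Ex P' (fun w' => `|f w'|))) => //.
- exact: (measurableT_comp mf).
- exact: itg_cst.
Qed.

Lemma Ex_prod (f : T * T' -> R) : itg pprod f ->
  (forall w, itg P' (fun w' => f (w, w'))) ->
  Ex pprod f = Ex P (fun w => Ex P' (fun w' => f (w, w'))).
Proof.
move=> hf hi; rewrite {1 2}/Ex /Rintegral.
rewrite -(integral12_prod_meas1 hf); congr fine.
by apply: eq_integral => w _; rewrite EFin_Ex.
Qed.

End product.

Section gaussian_vectors.
Context {R : realType} {m n : nat}.
Local Notation MX := 'M[R]_(m, n).

(* The covariance is carried by its quadratic form: [q a] is the variance of
   [<a, Y>]. *)
Definition gvec d (T : measurableType d) (P : probability T R) (Y : T -> MX)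
    (q : MX -> R) :=
  mmeas Y /\ forall a, 0 <= q a /\ has_gauss_law P (fun w => dot a (Y w)) 0 (q a).

Section gaussian_vector.
Context {d : measure_display} {T : measurableType d} {P : probability T R}
  {Y : T -> MX} {q : MX -> R} (gY : gvec P Y q).

Let mY : mmeas Y := gY.1.

Definition cov a b := Ex P (fun w => dot a (Y w) * dot b (Y w)).

Lemma gvec_itg_pow k a : itg P (fun w => dot a (Y w) ^+ k).
Proof. by have [q0 ga] := gY.2 a; exact: gauss_itg_pow ga. Qed.

Lemma gvec_itg a : itg P (fun w => dot a (Y w)).
Proof. by have := gvec_itg_pow 1 a. Qed.

Lemma gvec_sqr a : Ex P (fun w => dot a (Y w) ^+ 2) = q a.
Proof.
by have [q0 ga] := gY.2 a; have [_ -> _] := gauss_moments q0 ga; rewrite expr0n add0r.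
Qed.

Lemma gvec_pow4 a : Ex P (fun w => dot a (Y w) ^+ 4) = 3 * q a ^+ 2.
Proof. by have [q0 ga] := gY.2 a; have [_ _ ->] := gauss_moments q0 ga. Qed.

Lemma gvec_cf a b :
  Ex P (fun w => cos (dot a (Y w) + b)) = expR (- (q a / 2)) * cos b.
Proof.
have [q0 ga] := gY.2 a; have := gauss_cos 1 b q0 ga.
by under eq_Ex do rewrite mul1r; rewrite expr1n mulr1.
Qed.

Lemma gvec_itg_mul a b : itg P (fun w => dot a (Y w) * dot b (Y w)).
Proof.
apply: (@itg_dom _ _ _ P _ (fun w => dot a (Y w) ^+ 2 + dot b (Y w) ^+ 2)).
- by apply: measurable_funM; exact: mmeas_dot.
- by apply: itgD; exact: gvec_itg_pow.
- by move=> w; rewrite ler_norml; nra.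
Qed.

Lemma cov_diag a : cov a a = q a.
Proof. by rewrite -gvec_sqr; apply: eq_Ex => w; rewrite expr2. Qed.

Lemma covC a b : cov a b = cov b a.
Proof. by apply: eq_Ex => w; rewrite mulrC. Qed.

Lemma covDl a b c : cov (a + b) c = cov a c + cov b c.
Proof.
rewrite /cov -ExD; [|exact: gvec_itg_mul..].
by apply: eq_Ex => w; rewrite dotDl mulrDl.
Qed.

Lemma covZl k a b : cov (k *: a) b = k * cov a b.
Proof.
rewrite /cov -ExZ; last exact: gvec_itg_mul.
by apply: eq_Ex => w; rewrite dotZl mulrA.
Qed.

Lemma covDr a b c : cov c (a + b) = cov c a + cov c b.
Proof. by rewrite covC covDl !(covC _ c). Qed.

Lemma covZr k a b : cov b (k *: a) = k * cov b a.
Proof. by rewrite covC covZl covC. Qed.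

Lemma gvec_q_lin a b s t : q (s *: a + t *: b) =
  s ^+ 2 * q a + 2 * s * t * cov a b + t ^+ 2 * q b.
Proof.
rewrite -!cov_diag covDl !covDr !covZl !covZr (covC b a); ring.
Qed.

(* Gaussian integration by parts, by differentiating the characteristic
   function. *)
Lemma gvec_ibp y a b :
  Ex P (fun w => dot y (Y w) * sin (dot a (Y w) + b)) =
  cov y a * expR (- (q a / 2)) * cos b.
Proof.
have mlin t : measurable_fun setT (fun w => t * dot y (Y w) + dot a (Y w) + b).
  apply: measurable_funD => //; apply: measurable_funD; last exact: mmeas_dot.
  by apply: measurable_funM => //; exact: mmeas_dot.
pose h t := expR (- ((q a + 2 * t * cov y a + t ^+ 2 * q y) / 2)) * cos b.
have hE t : Ex P (fun w => cos (t * dot y (Y w) + dot a (Y w) + b)) = h t.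
  under eq_Ex do rewrite -dotZl -dotDl.
  rewrite gvec_cf /h -[a in q (_ + a)]scale1r gvec_q_lin.
  by rewrite (_ : t ^+ 2 * q y + 2 * t * 1 * cov y a + 1 ^+ 2 * q a =
    q a + 2 * t * cov y a + t ^+ 2 * q y)//; ring.
have dh : is_derive 0 (1 : R) h (- (cov y a * expR (- (q a / 2)) * cos b)).
  by rewrite /h; der; rewrite !(mulr0, mul0r, expr0n, addr0)/=; field.
have dE : is_derive 0 (1 : R)
    (fun t => Ex P (fun w => cos (t * dot y (Y w) + dot a (Y w) + b)))
    (Ex P (fun w => - (dot y (Y w) * sin (0 * dot y (Y w) + dot a (Y w) + b)))).
  apply: (@Ex_is_derive _ _ _ P
    (fun t w => cos (t * dot y (Y w) + dot a (Y w) + b))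
    (fun t w => - (dot y (Y w) * sin (t * dot y (Y w) + dot a (Y w) + b)))
    0 (fun w => `|dot y (Y w)|)).
  - move=> t _; apply: (@itg_bnd _ _ _ P _ 1) => [|w]; last exact: cos_max.
    by apply: measurableT_comp (mlin t); exact: continuous_measurable_fun (@continuous_cos R).
  - exact/itg_norm/gvec_itg.
  - by move=> t w; der; ring.
  - by move=> t w _; rewrite normrN normrM ler_piMr// sin_max.
rewrite (_ : (fun t => Ex P _) = h) in dE; last exact/funext.
have := dr_unique dh dE.
rewrite ExN.
  by move=> /oppr_inj ->; apply: eq_Ex => w; rewrite mul0r add0r.
apply: (@itg_dom _ _ _ P _ (fun w => `|dot y (Y w)|)).
- apply: measurable_funM; first exact: mmeas_dot.
  apply: measurableT_comp (mlin 0).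
  exact: continuous_measurable_fun (@continuous_sin R).
- exact/itg_norm/gvec_itg.
- by move=> w; rewrite normrM ler_piMr// sin_max.
Qed.

Lemma gvec_itg_mul4 a b c e :
  itg P (fun w => dot a (Y w) * dot b (Y w) * (dot c (Y w) * dot e (Y w))).
Proof.
apply: (@itg_dom _ _ _ P _ (fun w => dot a (Y w) ^+ 4 + dot b (Y w) ^+ 4
   + (dot c (Y w) ^+ 4 + dot e (Y w) ^+ 4))).
- by apply: measurable_funM; apply: measurable_funM; exact: mmeas_dot.
- by apply: itgD; apply: itgD; exact: gvec_itg_pow.
- move=> w; move: (dot a _) (dot b _) (dot c _) (dot e _) => A B C E.
  have key (x y : R) : x * y <= x ^+ 2 + y ^+ 2 by nra.
  have key' (x y : R) : - (x * y) <= x ^+ 2 + y ^+ 2 by nra.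
  have k2 : (A * B) ^+ 2 + (C * E) ^+ 2 <= A ^+ 4 + B ^+ 4 + (C ^+ 4 + E ^+ 4).
    have := key (A ^+ 2) (B ^+ 2); have := key (C ^+ 2) (E ^+ 2).
    by rewrite -!exprM -!exprMn; lra.
  by rewrite ler_norml; have := key (A * B) (C * E); have := key' (A * B) (C * E); lra.
Qed.

(* Isserlis' formula, from the fourth moments of the eight combinations
   [a +- b +- c +- e] by polarization. *)
Lemma gvec_isserlis a b c e :
  Ex P (fun w => dot a (Y w) * dot b (Y w) * (dot c (Y w) * dot e (Y w))) =
  cov a b * cov c e + cov a c * cov b e + cov a e * cov b c.
Proof.
pose L (s t u : R) := a + (s *: b + (t *: c + u *: e)).
have E4 s t u : Ex P (fun w => dot (L s t u) (Y w) ^+ 4) = 3 * q (L s t u) ^+ 2.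
  exact: gvec_pow4.
have qL s t u : q (L s t u) = q a + s ^+ 2 * q b + t ^+ 2 * q c + u ^+ 2 * q e
   + 2 * s * cov a b + 2 * t * cov a c + 2 * u * cov a e
   + 2 * s * t * cov b c + 2 * s * u * cov b e + 2 * t * u * cov c e.
  rewrite -!cov_diag /L !(covDl, covDr, covZl, covZr).
  by rewrite (covC b a) (covC c a) (covC e a) (covC c b) (covC e b) (covC e c); ring.
have i4 s t u : itg P (fun w => dot (L s t u) (Y w) ^+ 4) by exact: gvec_itg_pow.
pose V : seq (R * R * R) := [:: (1, 1, 1); (1, 1, -1); (1, -1, 1); (1, -1, -1);
  (-1, 1, 1); (-1, 1, -1); (-1, -1, 1); (-1, -1, -1)].
(* [192 = 8 * 4!]: there are eight sign choices, and [a b c e] has coefficient [4!] in each fourth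
   power. *)
have -> : (fun w => dot a (Y w) * dot b (Y w) * (dot c (Y w) * dot e (Y w))) =
  (fun w => \sum_(v <- V) 192^-1 * (v.1.1 * v.1.2 * v.2) *
     dot (L v.1.1 v.1.2 v.2) (Y w) ^+ 4).
  apply/funext => w; rewrite /V !big_cons big_nil /= /L !(dotDl, dotZl).
  by move: (dot a _) (dot b _) (dot c _) (dot e _) => A B C D; field.
rewrite Ex_sum; last by move=> v; exact: itgZ.
under eq_bigr do rewrite ExZ// E4 qL.
by rewrite /V !big_cons big_nil /=; field.
Qed.

End gaussian_vector.

Lemma gvec_itg_dot2 d (T : measurableType d) (P : probability T R) (Y : T -> MX)
    (q : MX -> R) : gvec P Y q -> itg P (fun w => dot (Y w) (Y w) ^+ 2).
Proof.
move=> gY; have mY := gY.1.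
have entE w i j : Y w i j = dot (delta_mx i j) (Y w) by rewrite dot_delta.
apply: (@itg_dom _ _ _ P _ (fun w => (\sum_(p : 'I_m * 'I_n) 1 ^+ 2) *
   (\sum_(p : 'I_m * 'I_n) dot (delta_mx p.1 p.2) (Y w) ^+ 4))).
- apply: measurable_funX; apply: measurable_sum => i.
  by apply: measurable_sum => j; exact: measurable_funM.
- by apply: itgZ; apply: itg_sum => p; exact: (gvec_itg_pow gY).
- move=> w; rewrite ger0_norm ?sqr_ge0//.
  rewrite [X in X ^+ 2](_ : _ = \sum_(p : 'I_m * 'I_n) 1 * Y w p.1 p.2 ^+ 2).
    apply: (le_trans (cauchy_sum _ _)); rewrite ler_wpM2l//.
      by apply: sumr_ge0 => p _; exact: sqr_ge0.
    by apply: ler_sum => p _; rewrite -exprM entE.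
  by rewrite dot_pair; apply: eq_bigr => p _; rewrite mul1r expr2.
Qed.

Lemma gvec_itg_dot1 d (T : measurableType d) (P : probability T R) (Y : T -> MX)
    (q : MX -> R) : gvec P Y q -> itg P (fun w => dot (Y w) (Y w)).
Proof.
move=> gY; have mY := gY.1.
apply: (@itg_dom _ _ _ P _ (fun w => 1 + dot (Y w) (Y w) ^+ 2)).
- by apply: measurable_sum => i; apply: measurable_sum => j; exact: measurable_funM.
- by apply: itgD; [exact: itg_cst|exact: gvec_itg_dot2 gY].
- by move=> w; rewrite ler_norml; nra.
Qed.

Lemma mmeas_dot2 d (T : measurableType d) (Y Z : T -> MX) : mmeas Y -> mmeas Z ->
  measurable_fun setT (fun w => dot (Y w) (Z w)).
Proof.
by move=> mY mZ; apply: measurable_sum => i; apply: measurable_sum => j; exact: measurable_funM.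
Qed.

End gaussian_vectors.

Lemma mmeas_mull (R : realType) m n p (a : 'M[R]_(m, n)) d (T : measurableType d)
    (Y : T -> 'M[R]_(n, p)) : mmeas Y -> mmeas (fun w => a *m Y w).
Proof.
move=> mY i j; under [X in measurable_fun _ X]eq_fun do rewrite mxE.
by apply: measurable_sum => k; exact: measurable_funM.
Qed.

(** * Rotation invariance of two independent copies *)

Section rotation.
Context {R : realType} {m n : nat}.
Local Notation MX := 'M[R]_(m, n).
Context {d : measure_display} {T : measurableType d} {P : probability T R}
  {Y : T -> MX} {q : MX -> R} (gY : gvec P Y q).

Let mY : mmeas Y := gY.1.

(** The rotated pair is stacked into one matrix, so that uniqueness of laws applies to it as to a
    single random matrix. *)
Definition rot (th : R) (z : T * T) : 'M[R]_(m + m, n) :=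
  col_mx (cos th *: Y z.1 + sin th *: Y z.2) (- sin th *: Y z.1 + cos th *: Y z.2).

Lemma mmeas_fst : mmeas (fun z : T * T => Y z.1).
Proof. by move=> i j; exact: (measurableT_comp (mY i j)). Qed.

Lemma mmeas_snd : mmeas (fun z : T * T => Y z.2).
Proof. by move=> i j; exact: (measurableT_comp (mY i j)). Qed.

Lemma mmeas_rot th : mmeas (rot th).
Proof.
move=> i j; rewrite /rot -[i]fintype.splitK; case: (fintype.split i) => k /=.
  under [X in measurable_fun _ X]eq_fun do rewrite col_mxEu !mxE.
  by apply: measurable_funD; apply: measurable_funM => //;
    [exact: mmeas_fst|exact: mmeas_snd].
under [X in measurable_fun _ X]eq_fun do rewrite col_mxEd !mxE.
by apply: measurable_funD; apply: measurable_funM => //;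
  [exact: mmeas_fst|exact: mmeas_snd].
Qed.

Lemma dot_col_mx (a : 'M[R]_(m + m, n)) (x y : MX) :
  dot a (col_mx x y) = dot (usubmx a) x + dot (dsubmx a) y.
Proof.
rewrite /dot big_split_ord /=; congr (_ + _); apply: eq_bigr => i _;
  apply: eq_bigr => j _.
  by rewrite col_mxEu mxE.
by rewrite col_mxEd mxE.
Qed.

(** By Fubini the variance in the exponent is [q u + q v]; the two cross covariances cancel and
    [cos^2 + sin^2 = 1] removes the angle. *)
Lemma rot_cf th a b : Ex (pprod P P) (fun z => cos (dot a (rot th z) + b)) =
  expR (- ((q (usubmx a) + q (dsubmx a)) / 2)) * cos b.
Proof.
pose u := cos th *: usubmx a + (- sin th) *: dsubmx a.
pose v := sin th *: usubmx a + cos th *: dsubmx a.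
have dE z : dot a (rot th z) = dot u (Y z.1) + dot v (Y z.2).
  by rewrite /rot dot_col_mx !(dotDr, dotZr) !(dotDl, dotZl); ring.
rewrite (@Ex_prod _ _ _ _ _ P P); last 2 first.
- by apply: itg_cos; exact: mmeas_rot.
- move=> w; apply: (@itg_bnd _ _ _ P _ 1) => [|w']; last exact: cos_max.
  under [X in measurable_fun _ X]eq_fun do rewrite dE addrAC addrC /=.
  exact: mmeas_cos.
transitivity (Ex P (fun w => expR (- (q v / 2)) * cos (dot u (Y w) + b))).
  apply: eq_Ex => w.
  under eq_Ex do rewrite dE /= addrAC addrC.
  by rewrite (gvec_cf gY).
rewrite ExZ; last exact: itg_cos.
rewrite (gvec_cf gY) mulrA -expRD; congr (expR _ * _).
have qu : q u = cos th ^+ 2 * q (usubmx a) + 2 * cos th * (- sin th) *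
   cov (P := P) (Y := Y) (usubmx a) (dsubmx a) + (- sin th) ^+ 2 * q (dsubmx a).
  exact: (gvec_q_lin gY).
have qv : q v = sin th ^+ 2 * q (usubmx a) + 2 * sin th * cos th *
   cov (P := P) (Y := Y) (usubmx a) (dsubmx a) + cos th ^+ 2 * q (dsubmx a).
  exact: (gvec_q_lin gY).
rewrite qu qv; have := cos2Dsin2 th => cs.
have -> : cos th ^+ 2 = 1 - sin th ^+ 2 by rewrite -cs addrK.
by field.
Qed.

Lemma rot_Ex th (F : 'M[R]_(m + m, n) -> R) :
  measurable_fun setT (F : g_sigma_algebraType (@open 'M[R]_(m + m, n)) -> R) ->
  (forall s, itg (pprod P P) (fun z => F (rot s z))) ->
  Ex (pprod P P) (fun z => F (rot th z)) = Ex (pprod P P) (fun z => F (rot 0 z)).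
Proof.
move=> mF iF.
have cf a b : Ex (pprod P P) (fun z => cos (dot a (rot th z) + b)) =
    Ex (pprod P P) (fun z => cos (dot a (rot 0 z) + b)) by rewrite !rot_cf.
exact: (@cf_Ex R (m + m) n _ _ _ _ (pprod P P) (pprod P P) (rot th) (rot 0)
  (mmeas_rot th) (mmeas_rot 0) cf F mF (iF th) (iF 0)).
Qed.

End rotation.

Section quadratic_forms.
Context {R : realType} {m n : nat}.
Local Notation MX := 'M[R]_(m, n).
Context {d : measure_display} {T : measurableType d} {P : probability T R}
  {Y : T -> MX} {q : MX -> R} (gY : gvec P Y q).
Variable a : 'M[R]_m.
Hypothesis asym : a^T = a.

Let mY : mmeas Y := gY.1.

Definition qform (x : MX) : R := dot x (a *m x).

Lemma dot_sym_mul (x y : MX) : dot x (a *m y) = dot y (a *m x).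
Proof. by rewrite dotC dot_mulmxl asym. Qed.

Lemma dot_mul_le (x y : MX) : `|dot x (a *m y)| <= nrm a * (dot x x + dot y y).
Proof.
apply: (le_trans (dot_le_nrm _ _)).
apply: (@le_trans _ _ (nrm x * (nrm a * nrm y))).
  by rewrite ler_wpM2l ?nrm_ge0// nrm_mulmx.
rewrite mulrCA ler_wpM2l ?nrm_ge0// -!nrm_sqr; nra.
Qed.

Lemma gvec_q_le y : q y <= dot y y * Ex P (fun w => dot (Y w) (Y w)).
Proof.
have i1 := gvec_itg_dot1 gY.
rewrite -(gvec_sqr gY) -ExZ//; apply: Ex_le.
- exact: (gvec_itg_pow gY 2).
- exact: itgZ.
- by move=> w; exact: dot_cauchy.
Qed.

(** The bilinear and quadratic forms of the rotated pair, expanded so that the angle enters through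
    scalar coefficients only; the derivative of [quad_rot] in the angle is [2 bil_rot]. *)
Definition bil_rot th z := (cos th * (- sin th)) * qform (Y z.1)
  + (cos th ^+ 2 - sin th ^+ 2) * dot (Y z.2) (a *m Y z.1)
  + (cos th * sin th) * qform (Y z.2).
Definition quad_rot th z := cos th ^+ 2 * qform (Y z.1)
  + 2 * (cos th * sin th) * dot (Y z.2) (a *m Y z.1) + sin th ^+ 2 * qform (Y z.2).

Lemma bil_rotE th z : dot (dsubmx (rot (Y := Y) th z)) (a *m usubmx (rot (Y := Y) th z)) =
  bil_rot th z.
Proof.
rewrite col_mxKd col_mxKu mulmxDr -!scalemxAr !(dotDl, dotDr, dotZl, dotZr).
by rewrite (dot_sym_mul (Y z.1) (Y z.2)) /bil_rot /qform; ring.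
Qed.

Lemma quad_rotE th z : qform (usubmx (rot (Y := Y) th z)) = quad_rot th z.
Proof.
rewrite /qform col_mxKu mulmxDr -!scalemxAr !(dotDl, dotDr, dotZl, dotZr).
by rewrite (dot_sym_mul (Y z.1) (Y z.2)) /quad_rot /qform; ring.
Qed.

Let S z := dot (Y z.1) (Y z.1) + dot (Y z.2) (Y z.2).

Lemma mmeas_qform (Z : T -> MX) : mmeas Z -> measurable_fun setT (fun w => qform (Z w)).
Proof. by move=> mZ; apply: mmeas_dot2 => //; exact: mmeas_mull. Qed.

Let mqf : measurable_fun setT (fun w => qform (Y w)) := mmeas_qform mY.

Let mB : measurable_fun setT (fun z => dot (Y z.2) (a *m Y z.1)).
Proof.
by apply: mmeas_dot2; [exact: mmeas_snd gY|apply: mmeas_mull; exact: mmeas_fst gY].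
Qed.

Let mA1 : measurable_fun setT (fun z : T * T => qform (Y z.1)).
Proof. exact: (measurableT_comp mqf). Qed.

Let mA2 : measurable_fun setT (fun z : T * T => qform (Y z.2)).
Proof. exact: (measurableT_comp mqf). Qed.

Let S0 z : 0 <= S z. Proof. by rewrite addr_ge0// dot_ge0. Qed.

Lemma trig_bounds (th : R) : [/\ `|cos th| <= 1, `|sin th| <= 1,
  cos th ^+ 2 <= 1, sin th ^+ 2 <= 1 & `|cos th * sin th| <= 1].
Proof.
have c := cos_max th; have s := sin_max th.
have c2 : cos th ^+ 2 <= 1 by rewrite -(real_normK (num_real _)) exprn_ile1.
have s2 : sin th ^+ 2 <= 1 by rewrite -(real_normK (num_real _)) exprn_ile1.
by split => //; rewrite normrM mulr_ile1.
Qed.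

Let basic z : [/\ `|qform (Y z.1)| <= 2 * (nrm a * S z), `|qform (Y z.2)| <= 2 * (nrm a * S z)
  & `|dot (Y z.2) (a *m Y z.1)| <= 2 * (nrm a * S z)].
Proof.
have d1 := dot_ge0 (Y z.1); have d2 := dot_ge0 (Y z.2); have a0 := nrm_ge0 a.
by split; (apply: (le_trans (dot_mul_le _ _))); rewrite mulrCA ler_wpM2l// /S; lra.
Qed.

Let bil_le th z : `|bil_rot th z| <= 8 * (nrm a * S z).
Proof.
have [b1 b2 b3] := basic z; have [_ _ c2 s2 cs] := trig_bounds th.
have k0 := le_trans (normr_ge0 _) b1.
have h1 : `|cos th * - sin th * qform (Y z.1)| <= 2 * (nrm a * S z).
  by rewrite mulrN mulNr normrN normrM -[leRHS]mul1r ler_pM.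
have h2 : `|(cos th ^+ 2 - sin th ^+ 2) * dot (Y z.2) (a *m Y z.1)| <= 2 * (nrm a * S z).
  rewrite normrM -[leRHS]mul1r ler_pM// ler_norml.
  by have := sqr_ge0 (cos th); have := sqr_ge0 (sin th); lra.
have h3 : `|cos th * sin th * qform (Y z.2)| <= 2 * (nrm a * S z).
  by rewrite normrM -[leRHS]mul1r ler_pM.
rewrite /bil_rot (le_trans (ler_normD _ _))//.
by have := ler_normD (cos th * - sin th * qform (Y z.1))
  ((cos th ^+ 2 - sin th ^+ 2) * dot (Y z.2) (a *m Y z.1)); lra.
Qed.

Definition dbil_rot th z := (sin th ^+ 2 - cos th ^+ 2) * qform (Y z.1)
  - 4 * (cos th * sin th) * dot (Y z.2) (a *m Y z.1)
  + (cos th ^+ 2 - sin th ^+ 2) * qform (Y z.2).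

Let dbil_le th z : `|dbil_rot th z| <= 12 * (nrm a * S z).
Proof.
have [b1 b2 b3] := basic z; have [_ _ c2 s2 cs] := trig_bounds th.
have k0 := le_trans (normr_ge0 _) b1.
have cm : `|cos th ^+ 2 - sin th ^+ 2| <= 1.
  by rewrite ler_norml; have := sqr_ge0 (cos th); have := sqr_ge0 (sin th); lra.
have h1 : `|(sin th ^+ 2 - cos th ^+ 2) * qform (Y z.1)| <= 2 * (nrm a * S z).
  by rewrite -opprB mulNr normrN normrM -[leRHS]mul1r ler_pM.
have h2 : `|4 * (cos th * sin th) * dot (Y z.2) (a *m Y z.1)| <= 4 * (2 * (nrm a * S z)).
  by rewrite -mulrA normrM ger0_norm// ler_wpM2l// normrM -[leRHS]mul1r ler_pM.
have h3 : `|(cos th ^+ 2 - sin th ^+ 2) * qform (Y z.2)| <= 2 * (nrm a * S z).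
  by rewrite normrM -[leRHS]mul1r ler_pM.
rewrite /dbil_rot (le_trans (ler_normD _ _))//.
by have := ler_normB ((sin th ^+ 2 - cos th ^+ 2) * qform (Y z.1))
  (4 * (cos th * sin th) * dot (Y z.2) (a *m Y z.1)); lra.
Qed.

Let itgS : itg (pprod P P) S.
Proof.
have i1 := gvec_itg_dot1 gY.
by apply: itgD; [exact: (itg_fst P i1)|exact: (itg_snd P i1)].
Qed.

Let itgS2 : itg (pprod P P) (fun z => S z ^+ 2).
Proof.
have i2 := gvec_itg_dot2 gY.
apply: (@itg_dom _ _ _ (pprod P P) _
  (fun z => 2 * (dot (Y z.1) (Y z.1) ^+ 2 + dot (Y z.2) (Y z.2) ^+ 2))).
- by apply: measurable_funX; exact: itg_meas itgS.
- by apply: itgZ; apply: itgD; [exact: (itg_fst P i2)|exact: (itg_snd P i2)].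
- move=> z; rewrite (ger0_norm (sqr_ge0 _)) /S.
  by move: (dot _ _) (dot _ _) => u v; have := sqr_ge0 (u - v); lra.
Qed.

(* The pair (Y, Y') of independent copies is invariant under rotation, so
   [E <Y'_th, a Y_th> sin (t Q (Y_th) + b)] does not depend on the angle [th];
   its derivative at [0] is a Stein identity for the quadratic form [Q]. *)
Lemma gvec_quad_stein (t b : R) : (forall Z : T -> MX, mmeas Z ->
    measurable_fun setT (fun w => q (Z w))) ->
  Ex P (fun w => (qform (Y w) - Ex P (fun w => qform (Y w))) * sin (t * qform (Y w) + b)) =
  2 * t * Ex P (fun w => q (a *m Y w) * cos (t * qform (Y w) + b)).
Proof.
move=> mq; pose PP := pprod P P.
pose h th z := bil_rot th z * sin (t * quad_rot th z + b).
pose dh th z := dbil_rot th z * sin (t * quad_rot th z + b) +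
  2 * t * (bil_rot th z ^+ 2 * cos (t * quad_rot th z + b)).
pose F (z : 'M[R]_(m + m, n)) :=
  dot (dsubmx z) (a *m usubmx z) * sin (t * qform (usubmx z) + b).
have hF th z : F (rot (Y := Y) th z) = h th z by rewrite /F bil_rotE quad_rotE.
have mbil th : measurable_fun setT (bil_rot th).
  by apply: measurable_funD; [apply: measurable_funD|]; exact: measurable_funM.
have mquad th : measurable_fun setT (fun z => t * quad_rot th z + b).
  apply: measurable_funD => //; apply: measurable_funM => //.
  by apply: measurable_funD; [apply: measurable_funD|]; exact: measurable_funM.
have msin th : measurable_fun setT (fun z => sin (t * quad_rot th z + b)).
  by apply: measurableT_comp (mquad th); exact: continuous_measurable_fun (@continuous_sin R).
have ih th : itg PP (h th).
  apply: (@itg_dom _ _ _ PP _ (fun z => 8 * (nrm a * S z))).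
  - exact: measurable_funM.
  - by do 2 apply: itgZ.
  - by move=> z; rewrite normrM (le_trans _ (bil_le th z))// ler_piMr// sin_max.
have mF : measurable_fun setT (F : g_sigma_algebraType (@open 'M[R]_(m + m, n)) -> R).
  have mu : mmeas (fun z : g_sigma_algebraType (@open 'M[R]_(m + m, n)) =>
      usubmx (z : 'M[R]_(m + m, n))).
    move=> i j; under [X in measurable_fun _ X]eq_fun do rewrite mxE.
    exact: measurable_borel_coord.
  have md : mmeas (fun z : g_sigma_algebraType (@open 'M[R]_(m + m, n)) =>
      dsubmx (z : 'M[R]_(m + m, n))).
    move=> i j; under [X in measurable_fun _ X]eq_fun do rewrite mxE.
    exact: measurable_borel_coord.
  apply: measurable_funM.
    by apply: mmeas_dot2 => //; exact: mmeas_mull.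
  apply: measurableT_comp; first exact: continuous_measurable_fun (@continuous_sin R).
  apply: measurable_funD => //; apply: measurable_funM => //.
  by apply: mmeas_dot2 => //; exact: mmeas_mull.
have hcst th : Ex PP (h th) = Ex PP (h 0).
  have hE s : (fun z => F (rot (Y := Y) s z)) = h s.
    by apply/funext => z; rewrite hF.
  have := rot_Ex gY th mF; rewrite (hE th) (hE 0); apply=> s.
  by rewrite (hE s).
have d0 : is_derive 0 (1 : R) (fun th => Ex PP (h th)) 0.
  rewrite (_ : (fun th => _) = fun=> Ex PP (h 0)); last by apply/funext.
  exact: dr_cst.
pose G z := 12 * (nrm a * S z) + 2 * `|t| * (64 * nrm a ^+ 2 * S z ^+ 2).
have iG : itg PP G by apply: itgD; do 2 apply: itgZ; [exact: itgS|exact: itgS2].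
have dhG th z : `|dh th z| <= G z.
  rewrite (le_trans (ler_normD _ _))// lerD//.
    by rewrite normrM (le_trans _ (dbil_le th z))// ler_piMr// sin_max.
  rewrite normrM (normrM 2) ger0_norm// ler_wpM2l ?mulr_ge0//.
  rewrite normrM (@le_trans _ _ (`|bil_rot th z ^+ 2|))//.
    by rewrite ler_piMr// cos_max.
  rewrite normrX (_ : 64 * nrm a ^+ 2 * S z ^+ 2 = (8 * (nrm a * S z)) ^+ 2); last by ring.
  by rewrite lerXn2r ?nnegrE// !mulr_ge0 ?nrm_ge0.
have d1 : is_derive 0 (1 : R) (fun th => Ex PP (h th)) (Ex PP (dh 0)).
  apply: (@Ex_is_derive _ _ _ PP h dh 0 G) => //.
  move=> th z; rewrite /h /dh /bil_rot /quad_rot /dbil_rot.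
  have := cos2Dsin2 th; set A := qform _; set B := dot _ _; set C := qform _ => cs.
  by der; ring.
have E0 := dr_unique d1 d0.
have idh : itg PP (dh 0).
  apply: itg_dom iG (dhG 0); apply: measurable_funD.
    apply: measurable_funM => //; apply: measurable_funD.
      by apply: measurable_funB; exact: measurable_funM.
    exact: measurable_funM.
  apply: measurable_funM => //; apply: measurable_funM.
    exact: measurable_funX.
  by apply: measurableT_comp (mquad 0); exact: continuous_measurable_fun (@continuous_cos R).
have dh0 z : dh 0 z = (qform (Y z.2) - qform (Y z.1)) * sin (t * qform (Y z.1) + b)
    + 2 * t * (dot (a *m Y z.1) (Y z.2) ^+ 2 * cos (t * qform (Y z.1) + b)).
  rewrite /dh /dbil_rot /bil_rot /quad_rot cos0 sin0 expr1n expr0n /=.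
  rewrite !(mulr0, mul0r, mulr1, mul1r, addr0, subr0, oppr0, sub0r, add0r, oppr0).
  by rewrite dotC; congr (_ * _ + _); ring.
have iqf : itg P (fun w => qform (Y w)).
  apply: (@itg_dom _ _ _ P _ (fun w => 2 * (nrm a * dot (Y w) (Y w)))) => //.
    by do 2 apply: itgZ; exact: gvec_itg_dot1 gY.
  by move=> w; apply: (le_trans (dot_mul_le _ _)); rewrite mulrDr; lra.
pose EQ := Ex P (fun w => qform (Y w)).
(* Integrating out the second copy replaces its quadratic form by the mean [EQ] and [<a Y, Y'>^2] by
   the variance [q (a Y)]. *)
have inner w : itg P (fun w' => dh 0 (w, w')) /\ Ex P (fun w' => dh 0 (w, w')) =
    (EQ - qform (Y w)) * sin (t * qform (Y w) + b) +
    2 * t * (q (a *m Y w) * cos (t * qform (Y w) + b)).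
  set u := sin _; set v := cos _.
  have i1 : itg P (fun w' => (qform (Y w') - qform (Y w)) * u).
    under [X in itg _ X]eq_fun do rewrite mulrC.
    by apply: itgZ; apply: itgB => //; exact: itg_cst.
  have i2 : itg P (fun w' => dot (a *m Y w) (Y w') ^+ 2) by exact: (gvec_itg_pow gY 2).
  have i3 : itg P (fun w' => 2 * t * (dot (a *m Y w) (Y w') ^+ 2 * v)).
    apply: itgZ; under [X in itg _ X]eq_fun do rewrite mulrC.
    exact: itgZ.
  have e : (fun w' => dh 0 (w, w')) = (fun w' => (qform (Y w') - qform (Y w)) * u
     + 2 * t * (dot (a *m Y w) (Y w') ^+ 2 * v)) by apply/funext => w'; rewrite dh0.
  rewrite e; split; first exact: itgD.
  rewrite ExD//; congr (_ + _).
    rewrite ExZr; last by apply: itgB => //; exact: itg_cst.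
    by rewrite ExB//; [rewrite Ex_cst|exact: itg_cst].
  rewrite ExZ; last by under [X in itg _ X]eq_fun do rewrite mulrC; exact: itgZ.
  by rewrite ExZr// (gvec_sqr gY).
rewrite Ex_prod// in E0; last by move=> w; exact: (inner w).1.
rewrite (eq_Ex _ (fun w => (inner w).2)) in E0.
have msin1 : measurable_fun setT (fun w => t * qform (Y w) + b).
  by apply: measurable_funD => //; exact: measurable_funM.
have iA : itg P (fun w => (EQ - qform (Y w)) * sin (t * qform (Y w) + b)).
  have iD : itg P (fun w => `|EQ - qform (Y w)|).
    by apply: itg_norm; apply: itgB => //; exact: itg_cst.
  apply: itg_dom iD _ => [|w].
    apply: measurable_funM; first exact: measurable_funB.
    by apply: measurableT_comp msin1; exact: continuous_measurable_fun (@continuous_sin R).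
  by rewrite normrM ler_piMr// sin_max.
have iB : itg P (fun w => q (a *m Y w) * cos (t * qform (Y w) + b)).
  apply: (@itg_dom _ _ _ P _ (fun w => Ex P (fun w => dot (Y w) (Y w)) *
     (nrm a ^+ 2 * dot (Y w) (Y w)))).
  - apply: measurable_funM; first by apply: mq; exact: mmeas_mull.
    by apply: measurableT_comp msin1; exact: continuous_measurable_fun (@continuous_cos R).
  - by do 2 apply: itgZ; exact: gvec_itg_dot1 gY.
  - move=> w; have [q0 _] := gY.2 (a *m Y w).
    rewrite normrM (ger0_norm q0) (@le_trans _ _ (q (a *m Y w)))//.
      by rewrite ler_piMr// cos_max.
    rewrite (le_trans (gvec_q_le _))// mulrC ler_wpM2l//.
      by apply: Ex_ge0 => w'; exact: dot_ge0.
    rewrite -!nrm_sqr -exprMn lerXn2r ?nnegrE ?mulr_ge0 ?nrm_ge0//.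
    exact: nrm_mulmx.
rewrite ExD// in E0; last exact: itgZ.
rewrite (ExZ _ iB) in E0.
have e : Ex P (fun w => (qform (Y w) - EQ) * sin (t * qform (Y w) + b)) =
    - Ex P (fun w => (EQ - qform (Y w)) * sin (t * qform (Y w) + b)).
  by rewrite -ExN//; apply: eq_Ex => w; rewrite -mulNr opprB.
by rewrite -/EQ e; apply/eqP; rewrite eqr_oppLR -addr_eq0 E0.
Qed.

End quadratic_forms.

(** * Stein's method for Gaussian matrices *)

Section symmetric.
Context {R : realType} {n : nat}.
Local Notation MX := 'M[R]_n.

Definition symx (a : MX) : MX := 2^-1 *: (a + a^T).

Lemma symx_sym a : (symx a)^T = symx a.
Proof. by rewrite /symx linearZ /= linearD /= trmxK addrC. Qed.

Lemma dot_trl (a x : MX) : x^T = x -> dot a^T x = dot a x.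
Proof. by move=> xs; rewrite -{1}xs dot_tr. Qed.

Lemma dot_symx (a x : MX) : x^T = x -> dot (symx a) x = dot a x.
Proof. by move=> xs; rewrite dotZl dotDl dot_trl//; field. Qed.

Lemma nrm_tr (a : MX) : nrm a^T = nrm a.
Proof. by rewrite /nrm dot_tr. Qed.

Lemma nrm_symx (a : MX) : nrm (symx a) <= nrm a.
Proof.
rewrite /symx nrmZ (@le_trans _ _ (2^-1 * (nrm a + nrm a^T)))//.
  by rewrite ger0_norm ?invr_ge0// ler_wpM2l ?invr_ge0// nrmD.
by rewrite nrm_tr le_eqVlt; apply/orP; left; apply/eqP; field.
Qed.

Lemma dot_le_sqr (a b : MX) : dot b b = dot a a -> dot a b <= dot a a.
Proof.
move=> e; have := dot_ge0 (a - b); rewrite dotBl !dotBr (dotC b a) e; lra.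
Qed.

End symmetric.

Section stein_method.
Context {R : realType} {n : nat}.
Local Notation MX := 'M[R]_n.
Context {d d' : measure_display} {T : measurableType d} {T' : measurableType d'}
  {P : probability T R} {P' : probability T' R}.
Context {W M : T -> MX} {G : T' -> MX} {qG : MX -> R} {sg2 : R}.
Hypothesis sg0 : 0 < sg2.
Hypotheses (mW : mmeas W) (sW : forall w, (W w)^T = W w)
  (iW : itg P (fun w => dot (W w) (W w))).
Let D w := M w - sg2%:M.
Hypotheses (mM : mmeas M) (sM : forall w, (M w)^T = M w)
  (iD : itg P (fun w => dot (D w) (D w))).
Hypothesis stein : forall a : MX, a^T = a -> forall t b,
  Ex P (fun w => dot a (W w) * sin (t * dot a (W w) + b)) =
  2 * t * Ex P (fun w => dot a (a *m M w) * cos (t * dot a (W w) + b)).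
Hypotheses (gG : gvec P' G qG) (sG : forall w, (G w)^T = G w)
  (qGE : forall a, qG a = sg2 * (dot a a + dot a a^T)).

Let mG : mmeas G := gG.1.

Lemma covG a b : cov (P := P') (Y := G) a b = sg2 * (dot a b + dot a b^T).
Proof.
have := gvec_q_lin gG a b 1 1; rewrite !scale1r !qGE linearD /= !dotDl !dotDr.
have -> : dot b a^T = dot a b^T by rewrite -dot_tr trmxK dotC.
by rewrite (dotC b a) !expr1n; lra.
Qed.

Lemma covG_sym y a : a^T = a -> cov (P := P') (Y := G) y a = 2 * sg2 * dot y a.
Proof. by move=> sa; rewrite covG sa; ring. Qed.

Lemma qG_sym a : a^T = a -> qG a = 2 * sg2 * dot a a.
Proof. by move=> sa; rewrite qGE sa; ring. Qed.

Lemma qG_le a : qG a <= 2 * sg2 * dot a a.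
Proof.
rewrite qGE (_ : 2 * sg2 * dot a a = sg2 * (2 * dot a a)); last by ring.
rewrite ler_pM2l// (_ : 2 * dot a a = dot a a + dot a a); last by ring.
by rewrite lerD2l dot_le_sqr// dot_tr.
Qed.

(** Entry [(i, j)] of [G B] is [<y i j, G>], where [y i j] has the norm of column [j] of [B]; each
    column is met once for each of the [n] rows. *)
Lemma ExGB (B : MX) : itg P' (fun w => dot (G w *m B) (G w *m B)) /\
  Ex P' (fun w => dot (G w *m B) (G w *m B)) <= 2 * n%:R * sg2 * dot B B.
Proof.
pose y i j : MX := delta_mx i j *m B^T.
have yE (w : T') (i j : 'I_n) : (G w *m B) i j = dot (y i j) (G w).
  by rewrite /y dot_mulmxr trmxK dot_delta.
have i2 i j : itg P' (fun w => dot (y i j) (G w) ^+ 2) by exact: (gvec_itg_pow gG 2).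
have e : (fun w => dot (G w *m B) (G w *m B)) =
    (fun w => \sum_(p : 'I_n * 'I_n) dot (y p.1 p.2) (G w) ^+ 2).
  by apply/funext => w; rewrite dot_pair; apply: eq_bigr => p _; rewrite -yE expr2.
rewrite e; split; first by apply: itg_sum.
rewrite Ex_sum//; under eq_bigr do rewrite (gvec_sqr gG).
apply: (@le_trans _ _ (\sum_(p : 'I_n * 'I_n) 2 * sg2 * dot (y p.1 p.2) (y p.1 p.2))).
  by apply: ler_sum => p _; exact: qG_le.
rewrite -mulr_sumr (_ : 2 * n%:R * sg2 * dot B B = 2 * sg2 * (n%:R * dot B B)); last by ring.
rewrite ler_wpM2l ?mulr_ge0 ?(ltW sg0)//.
rewrite -(pair_bigA _ (fun i j => dot (y i j) (y i j))) /=.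
rewrite (_ : n%:R * dot B B = \sum_(i < n) dot B B); last first.
  by rewrite sumr_const card_ord mulr_natl.
apply: ler_sum => i _; rewrite -(dot_tr B) /dot; apply: ler_sum => j _.
rewrite (bigD1 i)//= [X in _ + X]big1 ?addr0.
  apply: ler_sum => k _; rewrite /y !mxE (bigD1 j)//= !mxE !eqxx mul1r big1 ?addr0//.
  by move=> l lj; rewrite !mxE (negbTE lj) andbF mul0r.
move=> k ki; rewrite big1// => l _; rewrite /y !mxE big1 ?mul0r// => u _.
by rewrite !mxE (negbTE ki) mul0r.
Qed.

Lemma ExG_nrm (B : MX) : itg P' (fun w => nrm (G w *m B)) /\
  Ex P' (fun w => nrm (G w *m B)) <= Num.sqrt (2 * n%:R * sg2) * nrm B.
Proof.
have [i2 h2] := ExGB B.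
have mGB : mmeas (fun w => G w *m B).
  move=> i j; under [X in measurable_fun _ X]eq_fun do rewrite mxE.
  by apply: measurable_sum => k; exact: measurable_funM.
have mn : measurable_fun setT (fun w => nrm (G w *m B)).
  apply: measurableT_comp; first exact: continuous_measurable_fun (@sqrt_continuous R).
  exact: mmeas_dot2.
have e : (fun w => nrm (G w *m B) ^+ 2) = (fun w => dot (G w *m B) (G w *m B)).
  by apply/funext => w; rewrite nrm_sqr.
have := @Ex_abs_sqrt _ _ _ P' (fun w => nrm (G w *m B)); rewrite e => /(_ i2 mn).
have -> : (fun w => `|nrm (G w *m B)|) = (fun w => nrm (G w *m B)).
  by apply/funext => w; rewrite ger0_norm ?nrm_ge0.
move=> h; split.
  apply: (@itg_dom _ _ _ P' _ (fun w => 1 + dot (G w *m B) (G w *m B))) => //.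
    by apply: itgD => //; exact: itg_cst.
  by move=> w; rewrite ger0_norm ?nrm_ge0// -nrm_sqr; nra.
apply: (le_trans h); rewrite /nrm -sqrtrM ?mulr_ge0 ?(ltW sg0)//.
exact: ler_wsqrtr.
Qed.

Lemma nrmD_Ex : itg P (fun w => nrm (D w)) /\
  Ex P (fun w => nrm (D w)) <= Num.sqrt (Ex P (fun w => dot (D w) (D w))).
Proof.
have mD : mmeas D.
  move=> i j; rewrite /D; under [X in measurable_fun _ X]eq_fun do rewrite !mxE.
  exact: measurable_funB.
have mn : measurable_fun setT (fun w => nrm (D w)).
  apply: measurableT_comp; first exact: continuous_measurable_fun (@sqrt_continuous R).
  exact: mmeas_dot2.
have e : (fun w => nrm (D w) ^+ 2) = (fun w => dot (D w) (D w)).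
  by apply/funext => w; rewrite nrm_sqr.
have := @Ex_abs_sqrt _ _ _ P (fun w => nrm (D w)); rewrite e => /(_ iD mn).
have -> : (fun w => `|nrm (D w)|) = (fun w => nrm (D w)).
  by apply/funext => w; rewrite ger0_norm ?nrm_ge0.
move=> h; split => //.
apply: (@itg_dom _ _ _ P _ (fun w => 1 + dot (D w) (D w))) => //.
  by apply: itgD => //; exact: itg_cst.
by move=> w; rewrite ger0_norm ?nrm_ge0// -nrm_sqr; nra.
Qed.

Lemma itg_dotW a : itg P (fun w => dot a (W w)).
Proof.
apply: (@itg_dom _ _ _ P _ (fun w => dot a a + dot (W w) (W w))).
- exact: mmeas_dot.
- by apply: itgD => //; exact: itg_cst.
- move=> w; apply: (le_trans (dot_le_nrm _ _)); rewrite -!nrm_sqr; nra.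
Qed.

Let DT w : (D w)^T = D w.
Proof. by rewrite /D linearB /= sM tr_scalar_mx. Qed.

Let mD : mmeas D.
Proof.
move=> i j; rewrite /D; under [X in measurable_fun _ X]eq_fun do rewrite !mxE.
exact: measurable_funB.
Qed.

Lemma itg_aD (a : MX) : itg P (fun w => dot (a *m D w) a).
Proof.
have [iN _] := nrmD_Ex.
apply: (@itg_dom _ _ _ P _ (fun w => nrm a ^+ 2 * nrm (D w))).
- by apply: mmeas_dot2; [exact: mmeas_mull|move=> i j].
- exact: itgZ.
- move=> w; rewrite (le_trans (dot_le_nrm _ _))// expr2 -mulrA mulrC.
  by rewrite ler_wpM2l ?nrm_ge0// nrm_mulmx.
Qed.

Lemma dot_aM (a : MX) w : dot a (a *m M w) = dot (a *m D w) a + sg2 * dot a a.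
Proof.
rewrite (_ : M w = D w + sg2%:M); last by rewrite /D subrK.
by rewrite mulmxDr mul_mx_scalar dotDr dotZr dotC.
Qed.

(** Symmetrising the frequencies does not change the values of [tp] on symmetric matrices, and the
    hypothesis [stein] covers symmetric [a] only. *)
Definition tps (s : seq (R * MX * R)) (x : MX) : R :=
  \sum_(t <- s) t.1.1 * cos (dot (symx t.1.2) x + t.2).

(* The derivative of [tps s] at [x] in the direction [v], up to the sign. *)
Definition dtps (s : seq (R * MX * R)) (x v : MX) : R :=
  \sum_(t <- s) t.1.1 * (dot (symx t.1.2) v * sin (dot (symx t.1.2) x + t.2)).

Let sq := Num.sqrt (2 * n%:R * sg2).
Let V := Num.sqrt (Ex P (fun w => dot (D w) (D w))).

Lemma itgM_bnd (f g : T -> R) : itg P f -> measurable_fun setT g ->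
  (forall w, `|g w| <= 1) -> itg P (fun w => f w * g w).
Proof.
move=> hf mg g1; apply: itg_dom (itg_norm hf) _ => [|w].
  by apply: measurable_funM => //; exact: itg_meas hf.
by rewrite normrM ler_piMr.
Qed.

Lemma mcos (a : MX) s b : measurable_fun setT (fun w => cos (s * dot a (W w) + b)).
Proof. by under [X in measurable_fun _ X]eq_fun do rewrite -dotZl; exact: mmeas_cos. Qed.

(* Along [u(th) = E p(cos th W + sin th G)], with [G] independent of [W], the two
   Stein identities cancel up to the error [M - sg2 I] of the Stein matrix. *)
Lemma interpolation (s : seq (R * MX * R)) (kappa : R) : 0 <= kappa ->
  (forall x v : MX, x^T = x -> v^T = v -> `|dtps s x v| <= kappa * nrm v) ->
  `|Ex P (fun w => tps s (W w)) - Ex P' (fun w => tps s (G w))| <=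
    kappa * (sq / sg2 * V).
Proof.
move=> k0 hk; have sgn0 : sg2 != 0 by rewrite gt_eqF.
pose c (t : R * MX * R) := t.1.1; pose a (t : R * MX * R) := symx t.1.2.
pose b (t : R * MX * R) := t.2.
have sa t : (a t)^T = a t by exact: symx_sym.
pose psi t r := Ex P (fun w => cos (r * dot (a t) (W w) + b t)).
(* The expectation over [G] is carried out beforehand: [e] is its characteristic function, so [u] is
   defined without a product space. *)
pose e t th := expR (- (sin th ^+ 2 * qG (a t) / 2)).
pose u th := \sum_(t <- s) c t * (e t th * psi t (cos th)).
pose Gam t r := Ex P (fun w => dot (a t *m D w) (a t) * cos (r * dot (a t) (W w) + b t)).
have icos t r : itg P (fun w => cos (r * dot (a t) (W w) + b t)).
  by apply: (@itg_bnd _ _ _ P _ 1); [exact: mcos|move=> w; exact: cos_max].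
have iGam t r : itg P (fun w => dot (a t *m D w) (a t) * cos (r * dot (a t) (W w) + b t)).
  by apply: itgM_bnd; [exact: itg_aD|exact: mcos|move=> w; exact: cos_max].
have dpsi t r : is_derive r (1 : R) (psi t)
    (- (2 * r * (Gam t r + sg2 * dot (a t) (a t) * psi t r))).
  have -> : Gam t r + sg2 * dot (a t) (a t) * psi t r =
      Ex P (fun w => dot (a t) (a t *m M w) * cos (r * dot (a t) (W w) + b t)).
    rewrite -ExZ// -ExD//; last exact: itgZ.
    by apply: eq_Ex => w; rewrite dot_aM; ring.
  rewrite -stein// -ExN; last first.
    apply: itgM_bnd; [exact: itg_dotW| |by move=> w; exact: sin_max].
    under [X in measurable_fun _ X]eq_fun do rewrite -cosBpihalf -addrA.
    exact: mcos.
  apply: (@Ex_is_derive _ _ _ P (fun r w => cos (r * dot (a t) (W w) + b t))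
    (fun r w => - (dot (a t) (W w) * sin (r * dot (a t) (W w) + b t))) r
    (fun w => `|dot (a t) (W w)|)).
  - by move=> r' _.
  - exact/itg_norm/itg_dotW.
  - by move=> r' w; der; ring.
  - by move=> r' w _; rewrite normrN normrM ler_piMr// sin_max.
pose I th w := \sum_(t <- s) c t * ((sin th * (2 * sg2 * dot (a t *m D w) (a t)) * e t th) *
   cos (cos th * dot (a t) (W w) + b t)).
have EI th : Ex P (I th) =
    \sum_(t <- s) c t * (sin th * (2 * sg2) * e t th * Gam t (cos th)).
  rewrite /I Ex_sum.
    apply: eq_bigr => t _; rewrite /Gam -!ExZ//; last exact: itgZ.
    by apply: eq_Ex => w; ring.
  move=> t; apply: itgZ.
  have := itgZ (sin th * (2 * sg2) * e t th) (iGam t (cos th)).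
  by congr (itg _ _); apply/funext => w; ring.
have iI th : itg P (I th).
  apply: itg_sum => t; apply: itgZ.
  have := itgZ (sin th * (2 * sg2) * e t th) (iGam t (cos th)).
  by congr (itg _ _); apply/funext => w; ring.
(* The [sg2 <a, a>] part of [dpsi] cancels the derivative of the Gaussian factor [e]; only terms in
   [D] survive. *)
have du th : is_derive th (1 : R) u (cos th / sg2 * Ex P (I th)).
  rewrite EI mulr_sumr; apply: dr_sum => t.
  have hp : is_derive th (1 : R) (fun th => psi t (cos th))
     (- (2 * cos th * (Gam t (cos th) + sg2 * dot (a t) (a t) * psi t (cos th))) * - sin th).
    exact: (dr_comp (dpsi t (cos th)) (is_derive_cos th)).
  rewrite /e; der; rewrite qG_sym//; field; exact: sgn0.
have mterm t th w : measurable_fun setT (fun w' =>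
    dot (a t) (symx (G w' *m D w)) *
    sin (dot (a t) (cos th *: W w + sin th *: G w') + b t)).
  apply: measurable_funM.
    apply: mmeas_dot => i j; rewrite /symx.
    under [X in measurable_fun _ X]eq_fun do rewrite !mxE.
    apply: measurable_funM => //; apply: measurable_funD => //;
      by apply: measurable_sum => k; exact: measurable_funM.
  apply: measurableT_comp; first exact: continuous_measurable_fun (@continuous_sin R).
  apply: measurable_funD => //; apply: mmeas_dot => i j.
  under [X in measurable_fun _ X]eq_fun do rewrite !mxE.
  by apply: measurable_funD => //; exact: measurable_funM.
have dotGD t w w' : dot (a t) (symx (G w' *m D w)) = dot (a t *m D w) (G w').
  by rewrite dot_mulmxr DT dotC dot_symx// dotC.
have iterm t th w : itg P' (fun w' => dot (a t) (symx (G w' *m D w)) *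
    sin (dot (a t) (cos th *: W w + sin th *: G w') + b t)).
  apply: (@itg_dom _ _ _ P' _ (fun w' => `|dot (a t *m D w) (G w')|)).
  - exact: mterm.
  - by apply: itg_norm; exact: gvec_itg gG _.
  - by move=> w'; rewrite dotGD normrM ler_piMr// sin_max.
(* Gaussian integration by parts read backwards: the sum over frequencies becomes the mean of a
   directional derivative, to which the gradient bound [hk] applies as a whole rather than term by
   term. *)
have IE th w : I th w =
    Ex P' (fun w' => dtps s (cos th *: W w + sin th *: G w') (symx (G w' *m D w))).
  rewrite /dtps Ex_sum; last by move=> t; apply: itgZ; exact: iterm.
  apply: eq_bigr => t _; rewrite ExZ; last exact: iterm.
  congr (_ * _); rewrite -/(a t) -/(b t).
  have := gvec_ibp gG (a t *m D w) (sin th *: a t) (cos th * dot (a t) (W w) + b t).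
  have sst : (sin th *: a t)^T = sin th *: a t by rewrite linearZ /= sa.
  rewrite (covG_sym _ sst) (qG_sym sst).
  rewrite dotZr dotZl dotZr /e qG_sym// => h.
  transitivity (2 * sg2 * (sin th * dot (a t *m D w) (a t)) *
     expR (- (2 * sg2 * (sin th * (sin th * dot (a t) (a t))) / 2)) *
     cos (cos th * dot (a t) (W w) + b t)).
    congr (_ * _); rewrite expr2.
    rewrite (_ : sin th * sin th * (2 * sg2 * dot (a t) (a t)) / 2 =
       2 * sg2 * (sin th * (sin th * dot (a t) (a t))) / 2); last by ring.
    by ring.
  rewrite -h; apply: eq_Ex => w'; congr (_ * _).
    by rewrite dotGD.
  by rewrite dotDr !dotZr dotZl; congr sin; ring.
have I_le th w : `|I th w| <= kappa * (sq * nrm (D w)).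
  have [iN hN] := ExG_nrm (D w).
  rewrite IE (@le_trans _ _ (Ex P' (fun w' => kappa * nrm (G w' *m D w))))//; last first.
    by rewrite ExZ// ler_wpM2l.
  have hb w' : `|dtps s (cos th *: W w + sin th *: G w') (symx (G w' *m D w))| <=
      kappa * nrm (G w' *m D w).
    apply: (le_trans (hk _ _ _ _)); last by rewrite ler_wpM2l// nrm_symx.
      by rewrite linearD /= !linearZ /= sW sG.
    exact: symx_sym.
  apply: Ex_norm_le => //; last exact: itgZ.
  apply: itg_dom (itgZ kappa iN) hb.
  by apply: measurable_sum => t; apply: measurable_funM => //; exact: mterm.
pose K := kappa * (sq / sg2 * V).
have EI_le th : `|Ex P (I th)| <= sg2 * K.
  have [iN hN] := nrmD_Ex.
  rewrite (@le_trans _ _ (Ex P (fun w => kappa * (sq * nrm (D w)))))//.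
    by apply: Ex_norm_le => //; do 2 apply: itgZ.
  rewrite ExZ ?ExZ//; last exact: itgZ.
  rewrite /K (_ : sg2 * (kappa * (sq / sg2 * V)) = kappa * (sq * V)); last first.
    by field; exact: sgn0.
  by rewrite ler_wpM2l// ler_wpM2l ?sqrtr_ge0.
have u0 : u 0 = Ex P (fun w => tps s (W w)).
  rewrite /tps Ex_sum => [|t].
    apply: eq_bigr => t _; rewrite /e /psi sin0 cos0 expr0n /= !mul0r oppr0 expR0 mul1r.
    rewrite ExZ; last by have := icos t 1; under [X in itg _ X]eq_fun do rewrite mul1r.
    by congr (_ * _); apply: eq_Ex => w; rewrite mul1r.
  by apply: itgZ; have := icos t 1; under [X in itg _ X]eq_fun do rewrite mul1r.
have u1 : u (pi / 2) = Ex P' (fun w => tps s (G w)).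
  rewrite /tps Ex_sum => [|t]; last by apply: itgZ; exact: itg_cos.
  apply: eq_bigr => t _; rewrite ExZ; last exact: itg_cos.
  rewrite (gvec_cf gG) /e /psi sin_pihalf cos_pihalf expr1n mul1r; congr (_ * (_ * _)).
  by under eq_Ex do rewrite mul0r add0r; rewrite Ex_cst.
have pi2 : 0 < pi / 2 :> R by rewrite divr_gt0// pi_gt0.
(* Comparison with [K sin th] integrates the factor [cos th] of the derivative exactly, to 1 over
   [[0, pi / 2]]. *)
have mono (sgn : R) : `|sgn| = 1 -> sgn * (u (pi / 2) - u 0) <= K.
  move=> s1; pose g th := sgn * u th - K * sin th.
  have dg th : is_derive th (1 : R) g (cos th * (sgn * (Ex P (I th) / sg2) - K)).
    by have hu := du th; rewrite /g; der; field; exact: sgn0.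
  have cg : {within `[0, pi / 2], continuous g}.
    by apply: derivable_within_continuous => x _; have [] := dg x.
  have [x /[!in_itv]/= /andP[x0 x1] ex] := MVT pi2 (fun x _ => dg x) cg.
  have cx : 0 <= cos x by apply: cos_ge0_pihalf; lra.
  have : g (pi / 2) - g 0 <= 0.
    rewrite ex; apply: mulr_le0_ge0; last by rewrite subr0 ltW.
    apply: mulr_ge0_le0 => //; rewrite subr_le0.
    apply: (le_trans (ler_norm _)); rewrite normrM s1 mul1r normrM.
    by rewrite (gtr0_norm (_ : 0 < sg2^-1)) ?invr_gt0// ler_pdivrMr// mulrC.
  by rewrite /g sin_pihalf sin0 mulr1 mulr0 mulrBr; lra.
rewrite -u0 -u1 -/K ler_norml; have := mono 1 (normr1 _).
by have := mono (- 1) (normrN1 _); lra.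
Qed.

(* The terms of [x |-> E (tp s (x + eps G))]. *)
Definition smooth (eps : R) (s : seq (R * MX * R)) :=
  [seq (t.1.1 * expR (- (eps ^+ 2 * qG (symx t.1.2) / 2)), t.1.2, t.2) | t <- s].

Let dot_shift eps (a x : MX) w : x^T = x ->
  dot a (x + eps *: G w) = dot (eps *: symx a) (G w) + dot (symx a) x.
Proof. by move=> sx; rewrite dotDr dotZr dotZl !dot_symx// addrC. Qed.

Let qGZ eps (a : MX) : qG (eps *: a) = eps ^+ 2 * qG a.
Proof. by rewrite !qGE linearZ /= !dotZl !dotZr; ring. Qed.

Let mshift eps (x : MX) : mmeas (fun w => x + eps *: G w).
Proof.
move=> i j; under [X in measurable_fun _ X]eq_fun do rewrite !mxE.
by apply: measurable_funD => //; exact: measurable_funM.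
Qed.

Lemma tps_smooth eps s (x : MX) : x^T = x ->
  tps (smooth eps s) x = Ex P' (fun w => tp s (x + eps *: G w)).
Proof.
move=> sx; rewrite (Ex_tp P' (mshift eps x)) /tps big_map; apply: eq_bigr => t _ /=.
under eq_Ex do rewrite dot_shift// -addrA.
by rewrite (gvec_cf gG) qGZ mulrA.
Qed.

(** Integration by parts moves the derivative of the smoothed polynomial onto the weight [<v, G>];
    the values of [tp s] then suffice, without its gradient. *)
Lemma dtps_smooth eps s (x v : MX) : x^T = x -> v^T = v ->
  Ex P' (fun w => dot v (G w) * tp s (x + eps *: G w)) =
  - (2 * sg2 * eps) * dtps (smooth eps s) x v.
Proof.
move=> sx sv.
have it (t : R * MX * R) : itg P' (fun w => dot v (G w) * cos (dot t.1.2 (x + eps *: G w) + t.2)).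
  apply: (@itg_dom _ _ _ P' _ (fun w => `|dot v (G w)|)).
  - by apply: measurable_funM; [exact: mmeas_dot|exact: mmeas_cos].
  - by apply: itg_norm; exact: gvec_itg gG _.
  - by move=> w; rewrite normrM ler_piMr// cos_max.
under eq_Ex do rewrite /tp mulr_sumr.
rewrite Ex_sum => [|t]; last first.
  by have := itgZ t.1.1 (it t); congr (itg _ _); apply/funext => w; ring.
rewrite /dtps big_map mulr_sumr; apply: eq_bigr => t _ /=.
rewrite (_ : (fun w => _) = (fun w => t.1.1 * (dot v (G w) *
    cos (dot t.1.2 (x + eps *: G w) + t.2)))); last by apply/funext => w; ring.
rewrite ExZ//.
under eq_Ex do rewrite dot_shift// -addrA -sinDpihalf -addrA.
have sea : (eps *: symx t.1.2)^T = eps *: symx t.1.2 by rewrite linearZ /= symx_sym.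
rewrite (gvec_ibp gG) (covG_sym _ sea) qGZ dotZr dotC cosDpihalf; ring.
Qed.

(** For symmetric [v], the covariance of [<a, G>] and [<v, G>] is proportional to [<a, v>], so the
    reflection across the hyperplane orthogonal to [v] preserves the law of [G]; it reverses the
    sign of [<v, G>]. *)
Lemma reflection (f : MX -> R) (K B : R) (v : MX) : v^T = v -> 0 < dot v v ->
  0 <= K -> (forall x y, `|f x - f y| <= K * nrm (x - y)) -> (forall x, `|f x| <= B) ->
  Ex P' (fun w => f (G w) * dot v (G w)) =
  - Ex P' (fun w => f (G w - (2 * dot v (G w) / dot v v) *: v) * dot v (G w)).
Proof.
move=> sv v0 K0 fK fB; pose Gr w := G w - (2 * dot v (G w) / dot v v) *: v.
have vn0 : dot v v != 0 by rewrite gt_eqF.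
have mGr : mmeas Gr.
  move=> i j; rewrite /Gr; under [X in measurable_fun _ X]eq_fun do rewrite !mxE.
  apply: measurable_funB => //; apply: measurable_funM => //.
  by apply: measurable_funM => //; apply: measurable_funM => //; exact: mmeas_dot.
have dvGr w : dot v (Gr w) = - dot v (G w) by rewrite /Gr dotBr dotZr; field.
have iG := gvec_itg gG v.
have iF (Z : T' -> MX) : mmeas Z -> (forall w, `|dot v (Z w)| <= `|dot v (G w)|) ->
    itg P' (fun w => f (Z w) * dot v (Z w)).
  move=> mZ hZ; apply: (@itg_dom _ _ _ P' _ (fun w => B * `|dot v (G w)|)).
  - by apply: measurable_funM; [exact: (mmeas_lip mZ K0 fK fB)|exact: mmeas_dot].
  - by apply: itgZ; exact: itg_norm.
  - by move=> w; rewrite normrM ler_pM.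
have cf a b : Ex P' (fun w => cos (dot a (G w) + b)) = Ex P' (fun w => cos (dot a (Gr w) + b)).
  pose k := 2 * dot a v / dot v v.
  transitivity (Ex P' (fun w => cos (dot (1 *: a + (- k) *: v) (G w) + b))).
    rewrite !(gvec_cf gG) (gvec_q_lin gG) (covG_sym _ sv) (qG_sym sv).
    by congr (expR (- (_ / 2)) * _); rewrite /k; field.
  apply: eq_Ex => w; congr (cos (_ + b)).
  by rewrite /Gr dotBr dotDl !dotZl dotZr /k; field.
have mid : mmeas (fun z : g_sigma_algebraType (@open MX) => (z : MX)).
  by move=> i j; exact: measurable_borel_coord.
have mF : measurable_fun setT
    ((fun z => f z * dot v z) : g_sigma_algebraType (@open MX) -> R).
  by apply: measurable_funM; [exact: (mmeas_lip mid K0 fK fB)|exact: (mmeas_dot mid)].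
rewrite (cf_Ex mG mGr cf mF); last 2 first.
- by apply: iF.
- by apply: iF => // w; rewrite dvGr normrN.
rewrite -ExN.
  by apply: eq_Ex => w; rewrite dvGr mulrN.
have iG2 : itg P' (fun w => f (Gr w) * dot v (Gr w)).
  by apply: iF => // w; rewrite dvGr normrN.
have := itgN iG2; congr (itg _ _); apply/funext => w.
by rewrite dvGr mulrN opprK.
Qed.

(** That is [1 / sqrt (2 sg2)]: a uniform error [delta] enters through [delta E |<v, G>|], at most
    [delta sqrt (2 sg2) |v|], divided by [2 sg2 eps]. *)
Let r := Num.sqrt (2 * sg2) / (2 * sg2).

(* Pairing [G] with its reflection across the hyperplane orthogonal to [v] loses
   no constant: the gradient bound tends to the Lipschitz constant 1 of [f] when
   [delta / eps] tends to 0. *)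
Lemma smooth_grad (f : MX -> R) (B eps delta : R) s (x v : MX) :
  0 < eps -> 0 <= delta ->
  (forall x y, `|f x - f y| <= nrm (x - y)) -> (forall x, `|f x| <= B) ->
  (forall x, `|tp s x - f x| <= delta) -> x^T = x -> v^T = v ->
  `|dtps (smooth eps s) x v| <= (1 + delta / eps * r) * nrm v.
Proof.
move=> e0 d0 fL fB pf sx sv.
have [v0|vn0] := eqVneq (dot v v) 0.
  have -> : v = 0.
    apply/matrixP => i j; rewrite mxE; apply/eqP.
    by rewrite -normr_le0 (le_trans (nrm_entry _ _ _))// /nrm v0 sqrtr0.
  have c1 : 0 <= 1 + delta / eps * r.
    rewrite addr_ge0// mulr_ge0//; first by rewrite divr_ge0// ltW.
    by rewrite divr_ge0 ?sqrtr_ge0// mulr_ge0// ltW.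
  rewrite /dtps big1 ?normr0 ?mulr_ge0 ?nrm_ge0// => t _.
  by rewrite dotC dot0l mul0r mulr0.
have vp : 0 < dot v v by rewrite lt_neqAle eq_sym vn0 dot_ge0.
have nv : 0 < nrm v by rewrite /nrm sqrtr_gt0.
have c0 : 0 < 2 * sg2 * eps by rewrite !mulr_gt0.
pose h y := f (x + eps *: y).
have hL y z : `|h y - h z| <= eps * nrm (y - z).
  apply: (le_trans (fL _ _)).
  rewrite opprD addrACA subrr add0r -scalerBr nrmZ gtr0_norm//.
have hB y : `|h y| <= B by exact: fB.
have iv := gvec_itg gG v.
have iv2 : itg P' (fun w => dot v (G w) ^+ 2) by exact: (gvec_itg_pow gG 2).
pose Gr w := G w - (2 * dot v (G w) / dot v v) *: v.
have mGr : mmeas Gr.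
  move=> i j; rewrite /Gr; under [X in measurable_fun _ X]eq_fun do rewrite !mxE.
  apply: measurable_funB => //; apply: measurable_funM => //.
  by apply: measurable_funM => //; apply: measurable_funM => //; exact: mmeas_dot.
have ih (Z : T' -> MX) : mmeas Z -> itg P' (fun w => h (Z w) * dot v (G w)).
  move=> mZ; apply: (@itg_dom _ _ _ P' _ (fun w => B * `|dot v (G w)|)).
  - by apply: measurable_funM; [exact: (mmeas_lip mZ (ltW e0) hL hB)|exact: mmeas_dot].
  - by apply: itgZ; exact: itg_norm.
  - by move=> w; rewrite normrM ler_pM.
(* The expectation is half that of the difference with the reflected matrix; there the Lipschitz
   bound gives [2 eps |<v, G>| / |v|], and [E <v, G>^2 = 2 sg2 |v|^2]. *)
have E1 : `|Ex P' (fun w => h (G w) * dot v (G w))| <= 2 * sg2 * eps * nrm v.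
  have rf := reflection sv vp (ltW e0) hL hB.
  have -> : Ex P' (fun w => h (G w) * dot v (G w)) =
      2^-1 * Ex P' (fun w => h (G w) * dot v (G w) - h (Gr w) * dot v (G w)).
    by rewrite ExB ?ih// -[X in _ - X]opprK -rf; field.
  rewrite normrM ger0_norm ?invr_ge0// mulrC ler_pdivrMr//.
  apply: (@le_trans _ _ (Ex P' (fun w => 2 * eps / nrm v * dot v (G w) ^+ 2))).
    apply: Ex_norm_le; [by apply: itgB; exact: ih|exact: itgZ|] => w.
    rewrite -mulrBl normrM.
    have := hL (G w) (Gr w).
    rewrite /Gr opprB addrCA subrr addr0 nrmZ.
    rewrite normrM (normrM 2) (ger0_norm (_ : 0 <= 2))// (gtr0_norm (_ : 0 < (dot v v)^-1)) ?invr_gt0//.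
    rewrite -[X in _ -> _ <= _ * X](real_normK (num_real _)).
    move=> hh; rewrite expr2 mulrA ler_wpM2r//; apply: (le_trans hh).
    rewrite -nrm_sqr le_eqVlt; apply/orP; left; apply/eqP; field.
    by rewrite gt_eqF.
  rewrite ExZ// (gvec_sqr gG) qG_sym// -nrm_sqr.
  by rewrite le_eqVlt; apply/orP; left; apply/eqP; field; rewrite gt_eqF.
have E2 : Ex P' (fun w => `|dot v (G w)|) <= Num.sqrt (2 * sg2) * nrm v.
  have := Ex_abs_sqrt iv2 (mmeas_dot mG v).
  by rewrite (gvec_sqr gG) qG_sym// sqrtrM// mulr_ge0// ltW.
have ip : itg P' (fun w => dot v (G w) * tp s (x + eps *: G w)).
  have [C hC] := tp_bound s.
  apply: (@itg_dom _ _ _ P' _ (fun w => C * `|dot v (G w)|)).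
  - by apply: measurable_funM; [exact: mmeas_dot|exact: mmeas_tp].
  - by apply: itgZ; exact: itg_norm.
  - by move=> w; rewrite normrM mulrC ler_pM.
have E3 : `|Ex P' (fun w => dot v (G w) * tp s (x + eps *: G w))| <=
    2 * sg2 * eps * nrm v + delta * (Num.sqrt (2 * sg2) * nrm v).
  have ihG := ih G mG.
  rewrite (_ : Ex P' _ = Ex P' (fun w => h (G w) * dot v (G w)) +
      Ex P' (fun w => dot v (G w) * tp s (x + eps *: G w) - h (G w) * dot v (G w))); last first.
    by rewrite ExB// addrC subrK.
  rewrite (le_trans (ler_normD _ _))// lerD//.
  apply: (@le_trans _ _ (Ex P' (fun w => delta * `|dot v (G w)|))).
    apply: Ex_norm_le; [exact: itgB|by apply: itgZ; exact: itg_norm|] => w.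
    by rewrite [_ * tp _ _]mulrC -mulrBl normrM ler_wpM2r// pf.
  by rewrite ExZ ?ler_wpM2l//; exact: itg_norm.
rewrite dtps_smooth// normrM normrN (gtr0_norm c0) in E3.
rewrite -(ler_pM2l c0) (le_trans E3)//.
by rewrite /r le_eqVlt; apply/orP; left; apply/eqP; field; rewrite !gt_eqF.
Qed.

Theorem stein_bound (g : MX -> R) :
  (forall x y, `|g x - g y| <= nrm (x - y)) -> (forall x, `|g x| <= 1) ->
  `|Ex P (fun w => g (W w)) - Ex P' (fun w => g (G w))| <= sq / sg2 * V.
Proof.
move=> gL gB; set K := sq / sg2 * V.
have K0 : 0 <= K by rewrite mulr_ge0 ?divr_ge0 ?sqrtr_ge0// ltW.
have r0 : 0 < r by rewrite divr_gt0 ?sqrtr_gt0 ?mulr_gt0.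
have iGG : itg P' (fun w => dot (G w) (G w)) by exact: gvec_itg_dot1 gG.
pose EW := Ex P (fun w => dot (W w) (W w)).
pose EG := Ex P' (fun w => dot (G w) (G w)).
have EW0 : 0 <= EW by apply: Ex_ge0 => w; exact: dot_ge0.
have EG0 : 0 <= EG by apply: Ex_ge0 => w; exact: dot_ge0.
have [iN _] := ExG_nrm 1%:M; pose NG := Ex P' (fun w => nrm (G w *m 1%:M)).
have NG0 : 0 <= NG by apply: Ex_ge0 => w; exact: nrm_ge0.
have NGE : NG = Ex P' (fun w => nrm (G w)) by apply: eq_Ex => w; rewrite mulmx1.
have iNG : itg P' (fun w => nrm (G w)).
  by move: iN; under eq_fun do rewrite mulmx1.
apply/ler_addgt0Pl => eta eta0.
(* Each parameter costs at most [eta / 4]: [L] the contraction by [sinm] under both laws, [e'] the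
   excess of the gradient constant over 1, [eps] the smoothing. The choice [delta = eps e'] makes
   the ratio [delta / eps] equal to [e']. *)
pose L := 4 * (EW + EG + 1) / eta.
have EE : 0 < EW + EG + 1 by lra.
have L0 : 0 < L by rewrite divr_gt0// mulr_gt0.
pose e' := eta / (4 * (r * K + 1)).
have rK : 0 < r * K + 1 by rewrite ltr_wpDl// mulr_ge0// ltW.
have e'0 : 0 < e' by rewrite divr_gt0// mulr_gt0.
pose eps := eta / (8 * (e' + NG + 1)).
have eN : 0 < e' + NG + 1 by rewrite ltr_wpDl// addr_ge0// ltW.
have eps0 : 0 < eps by rewrite divr_gt0// mulr_gt0.
pose delta := eps * e'.
have delta0 : 0 < delta by rewrite mulr_gt0.
pose f x := g (sinm L x).
have fL (x y : MX) : `|f x - f y| <= nrm (x - y).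
  by apply: (le_trans (gL _ _)); exact: sinm_lip.
have fL1 (x y : MX) : `|f x - f y| <= 1 * nrm (x - y) by rewrite mul1r.
have gL1 (x y : MX) : `|g x - g y| <= 1 * nrm (x - y) by rewrite mul1r.
have fB x : `|f x| <= 1 by exact: gB.
have [s hs] := lip_trig_approx ler01 L0 delta0 gL1.
pose s' := smooth eps s.
have grad (x v : MX) : x^T = x -> v^T = v -> `|dtps s' x v| <= (1 + e' * r) * nrm v.
  move=> sx sv; have := smooth_grad eps0 (ltW delta0) fL fB hs sx sv.
  have -> : delta / eps = e' by rewrite /delta mulrC mulKf// gt_eqF.
  by [].
have er0 : 0 <= 1 + e' * r by rewrite addr_ge0// mulr_ge0// ltW.
have inter := interpolation er0 grad.
have near (x : MX) : x^T = x -> `|tps s' x - f x| <= delta + eps * NG.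
  move=> sx; rewrite tps_smooth//.
  have m1 : measurable_fun setT (fun w => tp s (x + eps *: G w)) by exact: mmeas_tp.
  have i1 : itg P' (fun w => tp s (x + eps *: G w)).
    by have [C hC] := tp_bound s; apply: (@itg_bnd _ _ _ P' _ C) => // w; exact: hC.
  rewrite -(Ex_cst P' (f x)) -ExB//; last exact: itg_cst.
  rewrite (@le_trans _ _ (Ex P' (fun w => delta + eps * nrm (G w))))//; last first.
    by rewrite ExD ?Ex_cst ?ExZ ?NGE//; [exact: itg_cst|exact: itgZ].
  apply: Ex_norm_le.
  - by apply: itgB => //; exact: itg_cst.
  - by apply: itgD; [exact: itg_cst|exact: itgZ].
  - move=> w; rewrite -(subrKA (f (x + eps *: G w))) (le_trans (ler_normD _ _))// lerD//.
    by apply: (le_trans (fL _ _)); rewrite addrAC subrr add0r nrmZ gtr0_norm.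
have itps d1 (T1 : measurableType d1) (P1 : probability T1 R) (Z : T1 -> MX) :
    mmeas Z -> itg P1 (fun w => tps s' (Z w)).
  by move=> mZ; apply: itg_sum => t; apply: itgZ; exact: itg_cos.
have key d1 (T1 : measurableType d1) (P1 : probability T1 R) (Z : T1 -> MX) :
    mmeas Z -> (forall w, (Z w)^T = Z w) -> itg P1 (fun w => dot (Z w) (Z w)) ->
    `|Ex P1 (fun w => g (Z w)) - Ex P1 (fun w => tps s' (Z w))| <=
     Ex P1 (fun w => dot (Z w) (Z w)) / L + (delta + eps * NG).
  move=> mZ sZ iZ.
  have ig : itg P1 (fun w => g (Z w)).
    apply: (@itg_bnd _ _ _ P1 _ 1) => [|w]; [exact: (mmeas_lip mZ ler01 gL1 gB)|exact: gB].
  rewrite -ExB//; last exact: itps.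
  rewrite (@le_trans _ _ (Ex P1 (fun w => L^-1 * dot (Z w) (Z w) + (delta + eps * NG))))//; last first.
    by rewrite ExD ?Ex_cst ?ExZ 1?mulrC//; [exact: itgZ|exact: itg_cst].
  apply: Ex_norm_le.
  - by apply: itgB => //; exact: itps.
  - by apply: itgD; [exact: itgZ|exact: itg_cst].
  - move=> w; rewrite -(subrKA (f (Z w))) (le_trans (ler_normD _ _))// lerD//.
      apply: (le_trans (gL _ _)); rewrite -nrmN opprB mulrC.
      exact: sinm_near.
    by rewrite distrC near.
have kW := key _ _ P W mW sW iW; have kG := key _ _ P' G mG sG iGG.
rewrite -/EW in kW; rewrite -/EG in kG.
have hL : EW / L + EG / L <= eta / 4.
  rewrite -mulrDl /L invf_div mulrA ler_pdivrMr ?mulr_gt0//.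
  by rewrite (_ : eta / 4 * (4 * (EW + EG + 1)) = (EW + EG + 1) * eta); [rewrite ler_pM2r// lerDl|field].
have hde : 2 * (delta + eps * NG) <= eta / 4.
  rewrite /delta -mulrDr mulrCA /eps mulrAC ler_pdivrMr ?mulr_gt0//.
  rewrite (_ : eta / 4 * (8 * (e' + NG + 1)) = eta * (2 * (e' + NG + 1))); last by field.
  by rewrite ler_pM2l// ler_pM2l// lerDl.
have hK : (1 + e' * r) * K <= K + eta / 4.
  rewrite mulrDl mul1r lerD2l /e' -mulrA mulrAC ler_pdivrMr ?mulr_gt0//.
  rewrite (_ : eta / 4 * (4 * (r * K + 1)) = eta * (r * K + 1)); last by field.
  by rewrite ler_pM2l// lerDl.
rewrite -/sq -/V -/K in inter.
move: kW kG inter hL hde hK; rewrite !ler_norml.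
move: (Ex P _) (Ex P _) (Ex P' _) (Ex P' _) => x1 x2 x3 x4.
by move=> /andP[? ?] /andP[? ?] /andP[? ?] ? ? ?; lra.
Qed.

End stein_method.

(** * Wishart matrices *)

Section from_joint.
Context {R : realType} {d : measure_display} {T : measurableType d}
  {P : probability T R}.

Lemma jg_itg (I : Type) (F : I -> T -> R) : jointly_gaussian P F ->
  forall i, itg P (F i).
Proof.
move=> jg i; have [m [v [v0 hg]]] := jg [:: i] (fun=> 1).
have := gauss_itg_pow 1 v0 hg.
by under [X in itg _ X]eq_fun do rewrite big_seq1 mul1r expr1.
Qed.

(** The mean and variance in [jointly_gaussian] are only asserted to exist; the first two moments
    identify them. *)
Lemma jg_gvec m n (I : eqType) (F : I -> T -> R) (ent : 'I_m * 'I_n -> I)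
    (Y : T -> 'M[R]_(m, n)) : injective ent ->
  (forall w p, Y w p.1 p.2 = F (ent p) w) ->
  jointly_gaussian P F -> centered P F ->
  gvec P Y (fun a => Ex P (fun w => dot a (Y w) ^+ 2)).
Proof.
move=> ie YF jg cF; have iF := jg_itg jg.
have mY : mmeas Y.
  move=> i j; under [X in measurable_fun _ X]eq_fun do rewrite (YF _ (i, j)).
  exact: itg_meas (iF _).
split=> // a; split; first by apply: Ex_ge0 => w; exact: sqr_ge0.
(* [jointly_gaussian] takes one coefficient per index of the family, so the entries of [a] are
   carried along the injection [ent]. *)
pose a' p := \sum_q (p == ent q)%:R * a q.1 q.2.
have a'E q : a' (ent q) = a q.1 q.2.
  rewrite /a' (bigD1 q)//= eqxx mul1r big1 ?addr0// => q' /negbTE qq'.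
  by rewrite (inj_eq ie) eq_sym qq' mul0r.
have [m0 [v [v0 hg]]] := jg [seq ent q | q <- index_enum _] a'.
have dE : (fun w => \sum_(i <- [seq ent q | q <- index_enum _]) a' i * F i w) =
    (fun w => dot a (Y w)).
  apply/funext => w; rewrite big_map dot_pair; apply: eq_bigr => q _.
  by rewrite a'E YF.
rewrite dE in hg; have [Em Ev _] := gauss_moments v0 hg.
have m00 : m0 = 0.
  rewrite -Em; under eq_Ex do rewrite dot_pair.
  have iZ (p : 'I_m * 'I_n) : itg P (fun w => a p.1 p.2 * Y w p.1 p.2).
    by apply: itgZ; under [X in itg _ X]eq_fun do rewrite YF; exact: iF.
  rewrite Ex_sum// big1// => p _; rewrite ExZ; last first.
    by under [X in itg _ X]eq_fun do rewrite YF; exact: iF.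
  have := cF (ent p); rewrite expectation_Ex; last exact: iF.
  move=> [E0]; under eq_Ex do rewrite YF.
  by rewrite E0 mulr0.
by move: hg; rewrite Ev m00 expr0n add0r.
Qed.

Lemma gvec_eq m n (Y : T -> 'M[R]_(m, n)) q q' : q =1 q' -> gvec P Y q -> gvec P Y q'.
Proof. by move=> /funext ->. Qed.

Lemma gvec_cov_sum m n (Y : T -> 'M[R]_(m, n)) q (gY : gvec P Y q) a b :
  cov (P := P) (Y := Y) a b = \sum_p \sum_p' a p.1 p.2 * b p'.1 p'.2 *
    Ex P (fun w => Y w p.1 p.2 * Y w p'.1 p'.2).
Proof.
have i2 (p p' : 'I_m * 'I_n) : itg P (fun w => Y w p.1 p.2 * Y w p'.1 p'.2).
  have := gvec_itg_mul gY (delta_mx p.1 p.2) (delta_mx p'.1 p'.2).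
  by under [X in itg _ X]eq_fun do rewrite !dot_delta.
transitivity (Ex P (fun w => \sum_p \sum_p' a p.1 p.2 * b p'.1 p'.2 *
    (Y w p.1 p.2 * Y w p'.1 p'.2))).
  apply: eq_Ex => w; rewrite !dot_pair big_distrlr /=.
  by apply: eq_bigr => p _; apply: eq_bigr => p' _; ring.
rewrite Ex_sum; last by move=> p; apply: itg_sum => p'; exact: itgZ.
apply: eq_bigr => p _; rewrite Ex_sum; last by move=> p'; exact: itgZ.
by apply: eq_bigr => p' _; rewrite ExZ.
Qed.

End from_joint.

Lemma mmeas_mulr (R : realType) m n p (a : 'M[R]_(n, p)) d (T : measurableType d)
    (Y : T -> 'M[R]_(m, n)) : mmeas Y -> mmeas (fun w => Y w *m a).
Proof.
move=> mY i j; under [X in measurable_fun _ X]eq_fun do rewrite mxE.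
by apply: measurable_sum => k; exact: measurable_funM.
Qed.

Section gram_moments.
Context {R : realType} {d0 : measure_display} {T : measurableType d0}
  {P : probability T R} {n d : nat} {x : T -> 'M[R]_(n, d)} {S : 'M[R]_d}.
Hypotheses (sS : S^T = S) (gX : gvec P x (fun y => dot y (y *m S))).

Lemma cov_row y z : cov (P := P) (Y := x) y z = dot y (z *m S).
Proof.
have := gvec_q_lin gX y z 1 1; rewrite !scale1r !mulmxDl !dotDl !dotDr.
have -> : dot z (y *m S) = dot y (z *m S) by rewrite dotC dot_mulmxr sS.
by rewrite !expr1n; lra.
Qed.

Lemma cov_delta i j k l : cov (P := P) (Y := x) (delta_mx i j) (delta_mx k l) =
  (i == k)%:R * S l j.
Proof.
rewrite cov_row dot_delta mxE (bigD1 l)//= big1 ?addr0.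
  by rewrite mxE eqxx andbT.
by move=> l' /negbTE ne; rewrite mxE ne andbF mul0r.
Qed.

(** One form for the Gram matrix ([A = 1]) and, up to the factor [1 / d], for the Stein matrix
    ([A = S]). *)
Definition bil (A : 'M[R]_d) w : 'M[R]_n := x w *m A *m (x w)^T.

Lemma bilE A w i j : bil A w i j = \sum_u \sum_v A u v * (x w i u * x w j v).
Proof.
rewrite /bil mxE exchange_big /=; apply: eq_bigr => v _.
rewrite mxE mxE mulr_suml; apply: eq_bigr => u _; ring.
Qed.

Lemma Ex_data2 i j k l : Ex P (fun w => x w i j * x w k l) = (i == k)%:R * S l j.
Proof. by rewrite -cov_delta; apply: eq_Ex => w; rewrite !dot_delta. Qed.

Lemma itg_data2 i j k l : itg P (fun w => x w i j * x w k l).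
Proof.
have := gvec_itg_mul gX (delta_mx i j) (delta_mx k l).
by under [X in itg _ X]eq_fun do rewrite !dot_delta.
Qed.

Lemma itg_data4 i u j v k u' l v' :
  itg P (fun w => x w i u * x w j v * (x w k u' * x w l v')).
Proof.
have := gvec_itg_mul4 gX (delta_mx i u) (delta_mx j v) (delta_mx k u') (delta_mx l v').
by under [X in itg _ X]eq_fun do rewrite !dot_delta.
Qed.

Lemma itg_bil A i j : itg P (fun w => bil A w i j).
Proof.
under [X in itg _ X]eq_fun do rewrite bilE.
by apply: itg_sum => u; apply: itg_sum => v; apply: itgZ; exact: itg_data2.
Qed.

Lemma bil2E A B w i j k l : bil A w i j * bil B w k l =
  \sum_u \sum_v \sum_u' \sum_v' A u v * B u' v' *
    (x w i u * x w j v * (x w k u' * x w l v')).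
Proof.
rewrite !bilE mulr_suml; apply: eq_bigr => u _.
rewrite mulr_suml; apply: eq_bigr => v _; rewrite mulr_sumr; apply: eq_bigr => u' _.
by rewrite mulr_sumr; apply: eq_bigr => v' _; ring.
Qed.

Lemma itg_bil2 A B i j k l : itg P (fun w => bil A w i j * bil B w k l).
Proof.
under [X in itg _ X]eq_fun do rewrite bil2E.
by do 4 (apply: itg_sum => ?); apply: itgZ; exact: itg_data4.
Qed.

Lemma Ex_bil A i j : Ex P (fun w => bil A w i j) = (i == j)%:R * dot A S.
Proof.
under eq_Ex do rewrite bilE.
rewrite Ex_sum; last by move=> u; apply: itg_sum => v; apply: itgZ; exact: itg_data2.
rewrite /dot mulr_sumr; apply: eq_bigr => u _.
rewrite Ex_sum; last by move=> v; apply: itgZ; exact: itg_data2.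
rewrite mulr_sumr; apply: eq_bigr => v _.
by rewrite ExZ ?Ex_data2; [rewrite -{1}sS mxE; ring|exact: itg_data2].
Qed.

Lemma dot_conj (A B : 'M[R]_d) : dot A (S *m B *m S) =
  \sum_u \sum_v \sum_u' \sum_v' A u v * B u' v' * (S u u' * S v v').
Proof.
rewrite /dot; apply: eq_bigr => u _; apply: eq_bigr => v _.
rewrite exchange_big /= mxE mulr_sumr; apply: eq_bigr => v' _.
rewrite mxE mulr_suml mulr_sumr; apply: eq_bigr => u' _.
by have -> : S v v' = S v' v by [rewrite -{1}sS mxE]; ring.
Qed.

(** Isserlis' three pairings of the rows [i, j, k, l]. Pairing [i] with [l] and [j] with [k] crosses
    the two indices of [B], whence its transpose. *)
Lemma Ex_bil2 A B i j k l : Ex P (fun w => bil A w i j * bil B w k l) =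
  (i == j)%:R * (k == l)%:R * (dot A S * dot B S) +
  (i == k)%:R * (j == l)%:R * dot A (S *m B *m S) +
  (i == l)%:R * (j == k)%:R * dot A (S *m B^T *m S).
Proof.
pose F (u v u' v' : 'I_d) := A u v * B u' v' *
  ((i == j)%:R * S v u * ((k == l)%:R * S v' u') +
   (i == k)%:R * S u' u * ((j == l)%:R * S v' v) +
   (i == l)%:R * S v' u * ((j == k)%:R * S u' v)).
transitivity (\sum_u \sum_v \sum_u' \sum_v' F u v u' v').
  under eq_Ex do rewrite bil2E.
  rewrite Ex_sum => [|u]; last by do 3 (apply: itg_sum => ?); apply: itgZ; exact: itg_data4.
  apply: eq_bigr => u _.
  rewrite Ex_sum => [|v]; last by do 2 (apply: itg_sum => ?); apply: itgZ; exact: itg_data4.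
  apply: eq_bigr => v _.
  rewrite Ex_sum => [|u']; last by apply: itg_sum => ?; apply: itgZ; exact: itg_data4.
  apply: eq_bigr => u' _.
  rewrite Ex_sum => [|v']; last by apply: itgZ; exact: itg_data4.
  apply: eq_bigr => v' _; rewrite ExZ; last exact: itg_data4.
  rewrite /F -!cov_delta -(gvec_isserlis gX); congr (_ * _).
  by apply: eq_Ex => w; rewrite !dot_delta.
have Ssym u v : S u v = S v u by rewrite -{1}sS mxE.
have -> : dot A S * dot B S =
    \sum_u \sum_v \sum_u' \sum_v' A u v * B u' v' * (S u v * S u' v').
  rewrite /dot mulr_suml; apply: eq_bigr => u _.
  rewrite mulr_suml; apply: eq_bigr => v _; rewrite mulr_sumr; apply: eq_bigr => u' _.
  by rewrite mulr_sumr; apply: eq_bigr => v' _; ring.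
rewrite !dot_conj [X in _ + _ * X](_ : _ = 
   \sum_u \sum_v \sum_u' \sum_v' A u v * B u' v' * (S u v' * S v u')); last first.
  apply: eq_bigr => u _; apply: eq_bigr => v _; rewrite exchange_big /=.
  by apply: eq_bigr => u' _; apply: eq_bigr => v' _; rewrite mxE.
rewrite !mulr_sumr -!big_split; apply: eq_bigr => u _.
rewrite !mulr_sumr -!big_split; apply: eq_bigr => v _.
rewrite !mulr_sumr -!big_split; apply: eq_bigr => u' _.
rewrite !mulr_sumr -!big_split; apply: eq_bigr => v' _ /=.
by rewrite /F (Ssym v u) (Ssym v' u') (Ssym u' u) (Ssym v' v) (Ssym v' u) (Ssym u' v); ring.
Qed.

Lemma itg_dot_quad (Y : T -> 'M[R]_n) (A B : R) : mmeas Y -> 0 <= A -> 0 <= B ->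
  (forall w, nrm (Y w) <= A * dot (x w) (x w) + B) ->
  itg P (fun w => dot (Y w) (Y w)).
Proof.
move=> mY A0 B0 h.
apply: (@itg_dom _ _ _ P _ (fun w => 2 * A ^+ 2 * dot (x w) (x w) ^+ 2 + 2 * B ^+ 2)).
- exact: mmeas_dot2.
- by apply: itgD; [apply: itgZ; exact: gvec_itg_dot2 gX|exact: itg_cst].
- move=> w; rewrite ger0_norm ?dot_ge0// -nrm_sqr.
  have := h w; have := nrm_ge0 (Y w); have := dot_ge0 (x w).
  move: (dot _ _) (nrm _) => D N D0 N0 ND.
  apply: (@le_trans _ _ ((A * D + B) ^+ 2)).
    by rewrite ler_pXn2r// nnegrE (le_trans N0).
  by rewrite -subr_ge0; have := sqr_ge0 (A * D - B); rewrite !expr2; lra.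
Qed.

End gram_moments.

(** * The Fortet-Mourier distance *)

Section fortet_mourier.
Context {R : realType} {n : nat}.
Local Notation MX := 'M[R]_n.

Lemma nrm_eq0 (A : MX) : nrm A = 0 -> A = 0.
Proof.
move=> A0; apply/matrixP => i j; rewrite mxE; apply/eqP.
by rewrite -normr_le0 (le_trans (nrm_entry _ _ _))// A0.
Qed.

(** Each norm is below the sum because the other one is nonnegative; for [lip_norm] this takes two
    distinct matrices, hence [0 < n]. *)
Lemma dFM_test (g : MX -> R) : (0 < n)%N -> (sup_norm g + lip_norm g <= 1)%E ->
  (forall x, `|g x| <= 1) /\ (forall x y, `|g x - g y| <= nrm (x - y)).
Proof.
move=> n0 hg; pose i0 := Ordinal n0.
have s0 x : (`|g x|%:E <= sup_norm g)%E by apply: ereal_sup_ubound; exists x.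
have l0 x y : x <> y -> ((`|g x - g y| / nrm (x - y))%:E <= lip_norm g)%E.
  by move=> xy; apply: ereal_sup_ubound; exists x, y.
have sup0 : (0 <= sup_norm g)%E by apply: (le_trans _ (s0 0)); rewrite lee_fin.
have ne : (0 : MX) <> delta_mx i0 i0.
  by move=> /matrixP /(_ i0 i0); rewrite !mxE !eqxx => /eqP; rewrite eq_sym oner_eq0.
have lip0 : (0 <= lip_norm g)%E.
  by apply: (le_trans _ (l0 _ _ ne)); rewrite lee_fin divr_ge0 ?nrm_ge0.
split=> [x|x y].
  rewrite -lee_fin (le_trans (s0 x))// (le_trans _ hg)//; exact: leeDl.
have [->|/eqP xy] := eqVneq x y; first by rewrite subrr normr0 nrm_ge0.
have d0 : 0 < nrm (x - y).
  rewrite lt_def nrm_ge0 andbT; apply/eqP => /nrm_eq0 /eqP; rewrite subr_eq0 => /eqP.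
  by move=> /xy.
rewrite -[leRHS]mul1r -ler_pdivrMr// -lee_fin (le_trans (l0 _ _ xy))//.
by rewrite (le_trans _ hg)//; exact: leeDr.
Qed.

Lemma dFM_ge0 (M N : random_matrix R n) : (0 < n)%N -> (0 <= dFM M N)%E.
Proof.
move=> n0; apply: ereal_sup_ubound; exists (fun=> 0); split.
  rewrite (_ : sup_norm _ = 0%E); last first.
    apply/eqP; rewrite eq_le; apply/andP; split.
      by apply: ge_ereal_sup => _ [A ->]; rewrite normr0.
    by apply: ereal_sup_ubound; exists 0; rewrite normr0.
  rewrite add0e; apply: ge_ereal_sup => _ [A [B [_ ->]]].
  by rewrite subrr normr0 mul0r lee_fin.
rewrite !unlock !integral_cst//= !mul0e sube0//.
Qed.

Lemma dFM_le (M N : random_matrix R n) (K : R) : (0 < n)%N ->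
  (forall g : MX -> R, (forall x y, `|g x - g y| <= nrm (x - y)) ->
     (forall x, `|g x| <= 1) ->
     Ex (rm_prob M) (fun w => g (M w)) - Ex (rm_prob N) (fun w => g (N w)) <= K) ->
  (dFM M N <= K%:E)%E.
Proof.
move=> n0 h; apply: ge_ereal_sup => _ [g [/(dFM_test n0)[gB gL] ->]].
have gL1 (x y : MX) : `|g x - g y| <= 1 * nrm (x - y) by rewrite mul1r.
have ig (L : random_matrix R n) : itg (rm_prob L) (fun w => g (L w)).
  apply: (@itg_bnd _ _ _ (rm_prob L) _ 1) => [|w]; last exact: gB.
  exact: (mmeas_lip (@rm_measurable _ _ L) ler01 gL1 gB).
by rewrite !expectation_Ex// -EFinB lee_fin; exact: h.
Qed.

End fortet_mourier.

Definition toep {R : realType} (s : int -> R) (d : nat) : 'M[R]_d :=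
  \matrix_(u < d, v < d) s (u%:Z - v%:Z).

(* The variance of the off-diagonal entries of the Wishart matrix. *)
Definition sg2 {R : realType} (s : int -> R) (d : nat) : R :=
  d%:R^-1 * dot (toep s d) (toep s d).

(* The trace of [S^4], as [S := toep s d] is symmetric for even [s]. *)
Definition tr4 {R : realType} (s : int -> R) (d : nat) : R :=
  dot (toep s d *m toep s d) (toep s d *m toep s d).

Section toeplitz.
Context {R : realType} {s : int -> R}.
Hypotheses (seven : forall k, s (- k) = s k) (s0 : s 0 = 1).
Context {d : nat}.
Local Notation S := (toep s d).

Lemma toep_sym : S^T = S.
Proof. by apply/matrixP => u v; rewrite !mxE -seven opprB. Qed.

Lemma dot1_toep : dot 1%:M S = d%:R.
Proof.
rewrite /dot (eq_bigr (fun=> 1)); first by rewrite sumr_const card_ord.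
move=> u _; rewrite (bigD1 u)//= !mxE eqxx subrr s0 mul1r big1 ?addr0// => v vu.
by rewrite mxE eq_sym (negbTE vu) mul0r.
Qed.

(** The diagonal of the Toeplitz matrix alone contributes [d]. *)
Lemma sg2_ge1 : (0 < d)%N -> 1 <= sg2 s d.
Proof.
move=> d0; rewrite /sg2 mulrC ler_pdivlMr ?ltr0n// mul1r.
rewrite -[in leLHS](card_ord d) -sumr_const; apply: ler_sum => u _.
rewrite (bigD1 u)//= !mxE subrr s0 mul1r lerDl.
by apply: sumr_ge0 => v _; rewrite -expr2 sqr_ge0.
Qed.

End toeplitz.

Section wishart_stein.
Context {R : realType} {d0 : measure_display} {T : measurableType d0}
  {P : probability T R} {X : nat -> nat -> {RV P >-> R}} {s : int -> R}.
Hypotheses (hX : gaussian_array s X) (seven : forall k, s (- k) = s k) (s0 : s 0 = 1).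
Context {n d : nat}.
Hypotheses (d_gt0 : (0 < d)%N).

Local Notation S := (toep s d).
Local Notation x := (data_mx X n d).
Local Notation W := (wishart_mx X n d).

Lemma data_gvec : gvec P x (fun y => dot y (y *m S)).
Proof.
have [jg cX covX] := hX.
have gX := @jg_gvec R _ T P n d (nat * nat)%type _
  (fun p : 'I_n * 'I_d => (p.1 : nat, p.2 : nat)) x _ _ jg cX.
have {}gX : gvec P x (fun a => Ex P (fun w => dot a (x w) ^+ 2)).
  apply: gX => [[i j] [k l] /= [/val_inj -> /val_inj ->]//|w p].
  by rewrite mxE.
apply: (gvec_eq _ gX) => y.
under eq_Ex do rewrite expr2.
rewrite -[LHS]/(cov (P := P) (Y := x) y y) (gvec_cov_sum gX).
rewrite dot_pair; apply: eq_bigr => -[i j] _ /=.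
have iE (i' : 'I_n) (j' : 'I_d) : Ex P (fun w => x w i j * x w i' j') =
    (i == i')%:R * s (j%:Z - j'%:Z).
  have := covX i j i' j'; rewrite expectation_Ex; last first.
    have := gvec_itg_mul gX (delta_mx i j) (delta_mx i' j').
    by under [X in itg _ X]eq_fun do rewrite !dot_delta !mxE.
  by move=> [<-]; apply: eq_Ex => w; rewrite !mxE.
rewrite -(pair_bigA _ (fun i' j' => y i j * y i' j' * Ex P (fun w => x w i j * x w i' j'))) /=.
rewrite (bigD1 i)//= [X in _ + X]big1 ?addr0; last first.
  move=> i' ne; apply: big1 => j' _.
  by rewrite iE eq_sym (negbTE ne) mul0r mulr0.
rewrite mxE mulr_sumr; apply: eq_bigr => j' _.
by rewrite iE eqxx mul1r mxE -seven opprB mulrA.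
Qed.

Let mxx : mmeas x := data_gvec.1.
Let sS : S^T = S := toep_sym seven.
Let sd : R := Num.sqrt d%:R.
Let c : R := sd / d%:R.
Let d_neq0 : d%:R != 0 :> R.
Proof. by rewrite pnatr_eq0 -lt0n. Qed.

Lemma sqr_scale : c * c = d%:R^-1.
Proof.
have h : sd * sd = d%:R by rewrite -expr2 sqr_sqrtr.
by rewrite /c mulrACA h; field.
Qed.

Lemma bil1_gram w : bil (x := x) 1%:M w = x w *m (x w)^T.
Proof. by rewrite /bil mulmx1. Qed.

Lemma wishartE w : W w = c *: (bil (x := x) 1%:M w - d%:R%:M).
Proof.
apply/matrixP => i j; rewrite bil1_gram /wishart_mx !mxE -/sd /c.
by case: (i == j) => /=; rewrite ?mulr1n ?mulr0n; field.
Qed.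

Lemma wishart_entry w i j :
  W w i j = c * (bil (x := x) 1%:M w i j - (i == j)%:R * d%:R).
Proof.
rewrite wishartE [in LHS]mxE [in LHS]mxE; congr (_ * (_ + _)).
by rewrite 2!mxE; case: (i == j); rewrite ?mulr1n ?mulr0n ?mul1r ?mul0r.
Qed.

Lemma wishart_sym w : (W w)^T = W w.
Proof.
by rewrite wishartE linearZ /= linearB /= tr_scalar_mx bil1_gram trmx_mul trmxK.
Qed.

Lemma mmeas_wishart : mmeas W.
Proof. exact: wishart_measurable. Qed.

Lemma nrm_data w : nrm (x w) * nrm (x w)^T = dot (x w) (x w).
Proof. by rewrite -nrm_sqr expr2; congr (_ * _); rewrite /nrm dot_tr. Qed.

Lemma itg_wishart : itg P (fun w => dot (W w) (W w)).
Proof.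
apply: (itg_dot_quad data_gvec (A := `|c|) (B := `|c| * nrm (d%:R%:M : 'M[R]_n))) => //.
- exact: mmeas_wishart.
- by rewrite mulr_ge0 ?nrm_ge0.
move=> w; rewrite wishartE nrmZ -mulrDr ler_wpM2l// (le_trans (nrmD _ _))//.
by rewrite nrmN lerD2r bil1_gram (le_trans (nrm_mulmx _ _))// nrm_data.
Qed.

(* For symmetric [a], the Stein identity of the Wishart matrix reads
   [E <a, W> sin (t <a, W> + b) = 2 t E <a, a M> cos (t <a, W> + b)] with [M] this
   matrix, whose mean is the scalar matrix [sg2]. *)
Definition stein_mx w : 'M[R]_n := d%:R^-1 *: bil (x := x) S w.

Lemma stein_mx_sym w : (stein_mx w)^T = stein_mx w.
Proof. by rewrite /stein_mx linearZ /= /bil !trmx_mul trmxK sS mulmxA. Qed.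

Lemma mmeas_bil A : mmeas (bil (x := x) A).
Proof.
move=> i j; under [X in measurable_fun _ X]eq_fun do rewrite bilE.
apply: measurable_sum => u; apply: measurable_sum => v.
by apply: measurable_funM => //; apply: measurable_funM; exact: mxx.
Qed.

Lemma mmeas_stein : mmeas stein_mx.
Proof.
move=> i j; under [X in measurable_fun _ X]eq_fun do rewrite mxE.
by apply: measurable_funM => //; exact: mmeas_bil.
Qed.

Lemma itg_stein : itg P (fun w => dot (stein_mx w - (sg2 s d)%:M) (stein_mx w - (sg2 s d)%:M)).
Proof.
apply: (itg_dot_quad data_gvec (A := `|d%:R^-1| * nrm S) (B := nrm ((sg2 s d)%:M : 'M[R]_n))).
- move=> i j; under [X in measurable_fun _ X]eq_fun do rewrite !mxE.
  apply: measurable_funB => //; apply: measurable_funM => //.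
  by move: (mmeas_bil S i j); under [X in measurable_fun _ X -> _]eq_fun do rewrite mxE.
- by rewrite mulr_ge0 ?nrm_ge0.
- exact: nrm_ge0.
move=> w; rewrite (le_trans (nrmD _ _))// nrmN lerD2r nrmZ -mulrA ler_wpM2l//.
rewrite /bil (le_trans (nrm_mulmx _ _))// -nrm_data mulrCA mulrA.
by rewrite ler_wpM2r ?nrm_ge0// nrm_mulmx.
Qed.

Lemma dot_bil (a : 'M[R]_n) A w : dot a (bil (x := x) A w) = dot (a *m x w) (x w *m A).
Proof. by rewrite /bil dot_mulmxr. Qed.

Lemma dot_wishart (a : 'M[R]_n) w : dot a (W w) =
  c * (qform a (x w) - Ex P (fun w => qform a (x w))).
Proof.
have qE w' : qform a (x w') = dot a (bil (x := x) 1%:M w').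
  by rewrite dot_bil mulmx1 /qform dotC.
rewrite wishartE dotZr dotBr qE; congr (_ * (_ - _)).
under eq_Ex do rewrite qE dot_pair.
have iZ (p : 'I_n * 'I_n) : itg P (fun w => a p.1 p.2 * bil (x := x) 1%:M w p.1 p.2).
  by apply: itgZ; exact: itg_bil data_gvec _ _ _.
rewrite Ex_sum// dot_pair; apply: eq_bigr => p _.
rewrite ExZ; last exact: itg_bil data_gvec _ _ _.
rewrite (Ex_bil sS data_gvec) (dot1_toep s0) mxE.
by case: (p.1 == p.2); rewrite ?mulr1n ?mulr0n ?mul1r ?mul0r.
Qed.

(** [<a, W>] is [c] times a centred quadratic form, to which [gvec_quad_stein] applies with
    frequency [t c]; the two factors [c] combine into [1 / d], the scaling of [stein_mx]. *)
Lemma wishart_stein_eq (a : 'M[R]_n) : a^T = a -> forall t b,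
  Ex P (fun w => dot a (W w) * sin (t * dot a (W w) + b)) =
  2 * t * Ex P (fun w => dot a (a *m stein_mx w) * cos (t * dot a (W w) + b)).
Proof.
move=> sa t b; set E := Ex P (fun w => qform a (x w)).
have aE w : t * dot a (W w) + b = t * c * qform a (x w) + (b - t * c * E).
  by rewrite dot_wishart -/E; ring.
have mq (Y : T -> 'M[R]_(n, d)) : mmeas Y ->
    measurable_fun setT (fun w => dot (Y w) (Y w *m S)).
  by move=> mY; apply: mmeas_dot2 => //; exact: mmeas_mulr.
have gmx : mmeas (fun w => a *m x w) by exact: mmeas_mull.
have st := gvec_quad_stein data_gvec sa (t * c) (b - t * c * E) mq.
have mcos : measurable_fun setT (fun w => cos (t * dot a (W w) + b)).
  under [X in measurable_fun _ X]eq_fun do rewrite -dotZl.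
  by apply: mmeas_cos; exact: mmeas_wishart.
have msin : measurable_fun setT (fun w => sin (t * dot a (W w) + b)).
  apply: measurableT_comp; first exact: continuous_measurable_fun (@continuous_sin R).
  apply: measurable_funD => //; apply: measurable_funM => //.
  by apply: mmeas_dot; exact: mmeas_wishart.
have iq : itg P (fun w => qform a (x w)).
  apply: (@itg_dom _ _ _ P _ (fun w => nrm a * (dot (x w) (x w) + dot (x w) (x w)))).
  - exact: mmeas_qform.
  - by apply: itgZ; apply: itgD; exact: gvec_itg_dot1 data_gvec.
  - by move=> w; exact: dot_mul_le.
have i1 : itg P (fun w => (qform a (x w) - E) * sin (t * dot a (W w) + b)).
  apply: (@itg_dom _ _ _ P _ (fun w => `|qform a (x w) - E|)).
  - apply: measurable_funM => //; apply: measurable_funB => //.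
    exact: mmeas_qform.
  - by apply: itg_norm; apply: itgB => //; exact: itg_cst.
  - by move=> w; rewrite normrM ler_piMr// sin_max.
have i2 : itg P (fun w => dot (a *m x w) (a *m x w *m S) * cos (t * dot a (W w) + b)).
  apply: (@itg_dom _ _ _ P _ (fun w => nrm a * (nrm a * nrm S) * dot (x w) (x w))).
  - by apply: measurable_funM => //; exact: mq.
  - by apply: itgZ; exact: gvec_itg_dot1 data_gvec.
  - move=> w; rewrite normrM (le_trans (ler_piMr _ (cos_max _)))//.
    rewrite (le_trans (dot_le_nrm _ _))// -nrm_sqr.
    rewrite (_ : _ * nrm (x w) ^+ 2 = (nrm a * nrm (x w)) * ((nrm a * nrm (x w)) * nrm S)); last by ring.
    rewrite ler_pM ?nrm_ge0 ?nrm_mulmx// (le_trans (nrm_mulmx _ _))//.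
    by rewrite ler_wpM2r ?nrm_ge0// nrm_mulmx.
transitivity (c * Ex P (fun w => (qform a (x w) - E) *
    sin (t * c * qform a (x w) + (b - t * c * E)))).
  under [in RHS]eq_Ex do rewrite -aE.
  by rewrite -ExZ//; apply: eq_Ex => w; rewrite {1}dot_wishart mulrA.
rewrite st; under eq_Ex do rewrite -aE.
transitivity (2 * t * (c * c * Ex P (fun w => dot (a *m x w) (a *m x w *m S) *
    cos (t * dot a (W w) + b)))); first by ring.
rewrite sqr_scale -ExZ//; congr (_ * _); apply: eq_Ex => w.
have -> : dot a (a *m stein_mx w) = d%:R^-1 * dot (a *m x w) (a *m x w *m S).
  by rewrite /stein_mx -scalemxAr dotZr dot_mulmxr /bil !mulmxA.
by rewrite mulrA.
Qed.

(** By [Ex_bil2] with [A = B = S], an entry of the centred Stein matrix has variance [tr S^4 / d^2],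
    doubled on the diagonal; the doubled value bounds all [n^2] entries. *)
Lemma Ex_dot_stein :
  Ex P (fun w => dot (stein_mx w - (sg2 s d)%:M) (stein_mx w - (sg2 s d)%:M)) <=
  2 * n%:R ^+ 2 * (tr4 s d / d%:R ^+ 2).
Proof.
have dE w i j : (stein_mx w - (sg2 s d)%:M) i j =
    d%:R^-1 * (bil (x := x) S w i j - (i == j)%:R * dot S S).
  rewrite !mxE /sg2; case: (i == j); rewrite ?mulr1n ?mulr0n ?mul1r ?mul0r; ring.
have ib i j : itg P (fun w => bil (x := x) S w i j) by exact: itg_bil data_gvec _ _ _.
have ib2 i j k l : itg P (fun w => bil (x := x) S w i j * bil (x := x) S w k l).
  exact: itg_bil2 data_gvec _ _ _ _ _ _.
have t4 : dot S (S *m S *m S) = tr4 s d.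
  by rewrite /tr4 [RHS]dot_mulmxl sS mulmxA.
pose v (p : 'I_n * 'I_n) := d%:R^-1 ^+ 2 * ((1 + (p.1 == p.2)%:R) * tr4 s d).
have -> : Ex P (fun w => dot (stein_mx w - (sg2 s d)%:M) (stein_mx w - (sg2 s d)%:M)) =
    \sum_p v p.
  under eq_Ex do rewrite dot_pair.
  have iT (p : 'I_n * 'I_n) : itg P (fun w => bil (x := x) S w p.1 p.2 *
      bil (x := x) S w p.1 p.2 + (- (2 * ((p.1 == p.2)%:R * dot S S)) *
      bil (x := x) S w p.1 p.2 + ((p.1 == p.2)%:R * dot S S) ^+ 2)).
    by apply: itgD => //; apply: itgD; [exact: itgZ|exact: itg_cst].
  have pE (p : 'I_n * 'I_n) : (fun w => (stein_mx w - (sg2 s d)%:M) p.1 p.2 *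
      (stein_mx w - (sg2 s d)%:M) p.1 p.2) = (fun w => d%:R^-1 ^+ 2 *
      (bil (x := x) S w p.1 p.2 *
      bil (x := x) S w p.1 p.2 + (- (2 * ((p.1 == p.2)%:R * dot S S)) *
      bil (x := x) S w p.1 p.2 + ((p.1 == p.2)%:R * dot S S) ^+ 2))).
    by apply/funext => w; rewrite !dE; ring.
  rewrite Ex_sum; last by move=> p; rewrite pE; exact: itgZ.
  apply: eq_bigr => p _; rewrite pE ExZ// ExD//; last by apply: itgD; [exact: itgZ|exact: itg_cst].
  rewrite ExD; [|exact: itgZ|exact: itg_cst].
  rewrite ExZ// Ex_cst (Ex_bil sS data_gvec) (Ex_bil2 sS data_gvec) sS t4 !eqxx /v.
  by rewrite (eq_sym p.2); case: (p.1 == p.2) => /=; ring.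
have t40 : 0 <= tr4 s d by exact: dot_ge0.
rewrite (@le_trans _ _ (\sum_(p : 'I_n * 'I_n) 2 * (tr4 s d / d%:R ^+ 2)))//.
  apply: ler_sum => p _; 
  rewrite (_ : v p = (1 + (p.1 == p.2)%:R) * (tr4 s d / d%:R ^+ 2)); last by rewrite /v; field.
  rewrite ler_wpM2r// ?mulr_ge0 ?invr_ge0 ?exprn_ge0//.
  by case: (p.1 == p.2) => /=; lra.
rewrite sumr_const card_prod !card_ord -[_ *+ (n * n)]mulr_natl natrM.
by rewrite le_eqVlt; apply/orP; left; apply/eqP; ring.
Qed.

Lemma Ex_wishart2 i j k l : Ex P (fun w => W w i j * W w k l) =
  sg2 s d * ((i == k)%:R * (j == l)%:R + (i == l)%:R * (j == k)%:R).
Proof.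
have ib i' j' : itg P (fun w => bil (x := x) 1%:M w i' j') by exact: itg_bil data_gvec _ _ _.
have ib2 : itg P (fun w => bil (x := x) 1%:M w i j * bil (x := x) 1%:M w k l).
  exact: itg_bil2 data_gvec _ _ _ _ _ _.
have pE : (fun w => W w i j * W w k l) = (fun w => d%:R^-1 *
   (bil (x := x) 1%:M w i j * bil (x := x) 1%:M w k l + (
    - ((i == j)%:R * d%:R) * bil (x := x) 1%:M w k l + (
    - ((k == l)%:R * d%:R) * bil (x := x) 1%:M w i j +
    (i == j)%:R * (k == l)%:R * d%:R ^+ 2)))).
  by apply/funext => w; rewrite !wishart_entry -sqr_scale; ring.
have i3 : itg P (fun w => - ((k == l)%:R * d%:R) * bil (x := x) 1%:M w i j +
    (i == j)%:R * (k == l)%:R * d%:R ^+ 2).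
  by apply: itgD; [exact: itgZ|exact: itg_cst].
have i4 : itg P (fun w => - ((i == j)%:R * d%:R) * bil (x := x) 1%:M w k l + (
    - ((k == l)%:R * d%:R) * bil (x := x) 1%:M w i j +
    (i == j)%:R * (k == l)%:R * d%:R ^+ 2)).
  by apply: itgD => //; exact: itgZ.
rewrite pE ExZ; last exact: itgD.
rewrite ExD// ExD//; last exact: itgZ.
rewrite ExD; [|exact: itgZ|exact: itg_cst].
rewrite Ex_cst !ExZ// !(Ex_bil sS data_gvec) (Ex_bil2 sS data_gvec).
have t2 : dot 1%:M (S *m 1%:M *m S) = dot S S by rewrite mulmx1 dotC dot_mulmxl sS mulmx1.
by rewrite tr_scalar_mx t2 (dot1_toep s0) /sg2; ring.
Qed.

Lemma Ex_wishart1 i j : Ex P (fun w => W w i j) = 0.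
Proof.
have ib : itg P (fun w => bil (x := x) 1%:M w i j) by exact: itg_bil data_gvec _ _ _.
have wE w : W w i j = c * bil (x := x) 1%:M w i j - c * d%:R * (i == j)%:R.
  by rewrite wishart_entry; ring.
under eq_Ex do rewrite wE.
rewrite ExB; [|exact: itgZ|exact: itg_cst].
by rewrite ExZ// Ex_cst (Ex_bil sS data_gvec) (dot1_toep s0); ring.
Qed.

Lemma itg_wishart_mul i j k l : itg P (fun w => W w i j * W w k l).
Proof.
apply: (@itg_dom _ _ _ P _ (fun w => dot (W w) (W w) + dot (W w) (W w))).
- by apply: measurable_funM; exact: mmeas_wishart.
- by apply: itgD; exact: itg_wishart.
- move=> w; have e i' j' := nrm_entry (W w) i' j'; rewrite normrM -nrm_sqr.
  apply: (le_trans (ler_pM (normr_ge0 _) (normr_ge0 _) (e i j) (e k l))).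
  by rewrite expr2 lerDl mulr_ge0// nrm_ge0.
Qed.

End wishart_stein.

Lemma stein_rate (R : realType) (n d : nat) (v t V : R) : 0 < v -> 0 <= t ->
  0 < d%:R :> R -> 0 <= V -> V <= 2 * n%:R ^+ 2 * (t / d%:R ^+ 2) ->
  Num.sqrt (2 * n%:R * v) / v * Num.sqrt V <=
  2 * Num.sqrt (n%:R ^+ 3 * (t / (d%:R ^+ 2 * v))).
Proof.
move=> v0 t0 dp V0 E; have v0' := ltW v0; have dp' := ltW dp.
rewrite -(@ler_pXn2r _ 2)// ?nnegrE ?mulr_ge0 ?invr_ge0 ?sqrtr_ge0//.
rewrite !exprMn !sqr_sqrtr//; [|by rewrite !(invr_ge0, mulr_ge0, exprn_ge0)..].
rewrite (_ : 2 ^+ 2 * _ = 2 * n%:R * v * v^-1 ^+ 2 *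
   (2 * n%:R ^+ 2 * (t / d%:R ^+ 2))).
  by rewrite ler_wpM2l// !mulr_ge0 ?exprn_ge0 ?invr_ge0.
by field; rewrite !gt_eqF.
Qed.

Section wishart_gaussian.
Context {R : realType} {d0 : measure_display} {T : measurableType d0}
  {P : probability T R} {X : nat -> nat -> {RV P >-> R}} {s : int -> R}.
Hypotheses (hX : gaussian_array s X) (seven : forall k, s (- k) = s k) (s0 : s 0 = 1).
Context {n d : nat} {G : random_matrix R n}.
Hypotheses (n_gt0 : (0 < n)%N) (d_gt0 : (0 < d)%N)
  (hG : gaussian_counterpart (wishart X n d) G).

(** The covariances of the Wishart matrix already have the form of those of [Z], with [sg2] in place
    of the squared norm of [s]; hence [G] and [Z] can only differ in law by a scalar factor. *)
Lemma counterpart_gvec :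
  gvec (rm_prob G) G (fun a => sg2 s d * (dot a a + dot a a^T)).
Proof.
have [sG jg cG covG] := hG.
have gG : gvec (rm_prob G) G (fun a => Ex (rm_prob G) (fun w => dot a (G w) ^+ 2)).
  by apply: (jg_gvec (ent := id) _ _ jg cG) => // w [].
apply: (gvec_eq _ gG) => a; under eq_Ex do rewrite expr2.
rewrite -[LHS]/(cov (P := rm_prob G) (Y := G) a a) (gvec_cov_sum gG).
have EG (p q : 'I_n * 'I_n) : Ex (rm_prob G) (fun w => G w p.1 p.2 * G w q.1 q.2) =
    sg2 s d * ((p.1 == q.1)%:R * (p.2 == q.2)%:R + (p.1 == q.2)%:R * (p.2 == q.1)%:R).
  rewrite -(Ex_wishart2 hX seven s0 d_gt0).
  have iG : itg (rm_prob G) (fun w => G w p.1 p.2 * G w q.1 q.2).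
    have := gvec_itg_mul gG (delta_mx p.1 p.2) (delta_mx q.1 q.2).
    by under [X in itg _ X]eq_fun do rewrite !dot_delta.
  have := covG p q; rewrite !covariance.unlock.
  have iW i j : itg P (fun w => wishart_mx X n d w i j).
    have := itg_wishart_mul hX seven d_gt0 i j i j.
    have mW := @mmeas_wishart _ _ _ _ X n d.
    move=> i2; apply: (@itg_dom _ _ _ P _ (fun w => 1 + wishart_mx X n d w i j * wishart_mx X n d w i j)).
    - exact: mW.
    - by apply: itgD => //; exact: itg_cst.
    - by move=> w; rewrite ler_norml; move: (wishart_mx _ _ _ _ _ _) => z; nra.
  have EW (i : 'I_n * 'I_n) : ('E_P[@rm_entry R n (wishart X n d) i] = 0)%E.
    rewrite expectation_Ex; last exact: iW.
    have -> // : Ex P (@rm_entry R n (wishart X n d) i) = 0.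
    by exact: (Ex_wishart1 hX seven s0 d_gt0).
  rewrite !cG !EW /=.
  have -> : ((@rm_entry R n G p \- cst 0) * (@rm_entry R n G q \- cst 0))%R =
      (fun w => G w p.1 p.2 * G w q.1 q.2).
    apply/funext => w.
    by rewrite -[LHS]/((G w p.1 p.2 - 0) * (G w q.1 q.2 - 0)) !subr0.
  have -> : ((@rm_entry R n (wishart X n d) p \- cst 0) *
       (@rm_entry R n (wishart X n d) q \- cst 0))%R =
      (fun w => wishart_mx X n d w p.1 p.2 * wishart_mx X n d w q.1 q.2).
    apply/funext => w.
    rewrite -[LHS]/((wishart_mx X n d w p.1 p.2 - 0) * (wishart_mx X n d w q.1 q.2 - 0)).
    by rewrite !subr0.
  rewrite !expectation_Ex//; last exact: (itg_wishart_mul hX seven d_gt0).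
  by move=> [].
under eq_bigr do under eq_bigr do rewrite EG.
rewrite !dot_pair -big_split mulr_sumr; apply: eq_bigr => -[i j] _ /=.
rewrite -(pair_bigA _ (fun k l => a i j * a k l * (sg2 s d *
  ((i == k)%:R * (j == l)%:R + (i == l)%:R * (j == k)%:R)))) /=.
have sum1 (i0 : 'I_n) (f : 'I_n -> R) : \sum_k (i0 == k)%:R * f k = f i0.
  rewrite (bigD1 i0)//= eqxx mul1r big1 ?addr0// => k.
  by rewrite eq_sym => /negbTE ->; rewrite mul0r.
transitivity (sg2 s d * a i j * (\sum_k (i == k)%:R * (\sum_l (j == l)%:R * a k l) +
    \sum_k (j == k)%:R * (\sum_l (i == l)%:R * a k l))).
  rewrite -big_split mulr_sumr; apply: eq_bigr => k _.
  rewrite !mulr_sumr -big_split mulr_sumr; apply: eq_bigr => l _ /=; ring.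
by rewrite !sum1 mxE; ring.
Qed.

Lemma dFM_wishart_gaussian : (dFM (wishart X n d) G <=
  (2 * Num.sqrt (n%:R ^+ 3 * (tr4 s d / (d%:R ^+ 2 * sg2 s d))))%:E)%E.
Proof.
have sg1 : 1 <= sg2 s d by exact: sg2_ge1.
have sg0 : 0 < sg2 s d by rewrite (lt_le_trans ltr01).
apply: dFM_le => // g gL gB.
have [sG _ _ _] := hG.
have := @stein_bound R n _ _ _ _ P (rm_prob G) (wishart_mx X n d)
  (@stein_mx _ _ _ P X s n d) G _ (sg2 s d) sg0 _ _ _ _ _ _ _ counterpart_gvec sG _ g gL gB.
move=> h; apply: (le_trans (ler_norm _)); apply: (le_trans (h _ _ _ _ _ _ _ _)).
- exact: mmeas_wishart.
- by move=> w; exact: wishart_sym.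
- by apply: (itg_wishart hX).
- by apply: (mmeas_stein hX).
- by move=> w; exact: stein_mx_sym.
- by apply: (itg_stein hX).
- by apply: (wishart_stein_eq hX).
- by [].
have E := Ex_dot_stein hX seven (n := n) d_gt0.
apply: stein_rate E => //; [exact: dot_ge0|by rewrite ltr0n|].
by apply: Ex_ge0 => w; exact: dot_ge0.
Qed.

End wishart_gaussian.

(** * Independent Gaussian entries *)

Section step_approximation.
Context {R : realType}.

(** The sum is the integer part of [x]. *)
Lemma layer_sum (N : nat) (x : R) : 0 <= x <= N%:R ->
  `|\sum_(k < N) (k.+1%:R <= x)%R%:R - x| <= 1.
Proof.
elim: N => [|N IH] /andP[x0 xN].
  by rewrite big_ord0 sub0r normrN (_ : x = 0) ?normr0//; apply/eqP; rewrite eq_le x0 xN.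
rewrite big_ord_recr /=; have [xl|xl] := leP x N%:R.
  rewrite (_ : ((N.+1%:R : R) <= x) = false) ?addr0; last first.
    by apply/negbTE; rewrite -ltNge (le_lt_trans xl)// ltr_nat.
  by apply: IH; rewrite x0.
rewrite (eq_bigr (fun=> 1)) => [|k _]; last first.
  by rewrite (le_trans _ (ltW xl))// ler_nat.
rewrite sumr_const card_ord; move: xN xl; rewrite -natr1.
by case: (leP (N%:R + 1) x) => /= h h1 h2; rewrite ?mulr1n ?mulr0n ler_norml; lra.
Qed.

Context {d : measure_display} {T : measurableType d} {P : probability T R}.

(* Layer-cake approximation of [h] by sums of indicators. *)
Lemma Ex_step (U Y : T -> R) (k : R) (h : R -> R) : itg P U ->
  measurable_fun setT Y -> measurable_fun setT h -> (forall y, 0 <= h y <= 1) ->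
  (forall B, measurable B -> Ex P (fun w => U w * \1_B (Y w)) =
     k * Ex P (fun w => \1_B (Y w))) ->
  Ex P (fun w => U w * h (Y w)) = k * Ex P (fun w => h (Y w)).
Proof.
move=> iU mY mh h01 hB.
pose E := Ex P (fun w => `|U w|) + `|k|.
have E0 : 0 <= E by rewrite addr_ge0//; apply: Ex_ge0.
have mB N (j : nat) : measurable [set y | j.+1%:R <= N.+1%:R * h y].
  have := @measurable_funM _ _ _ _ (cst (N.+1%:R : R)) h (measurable_cst _) mh.
  move=> /(_ measurableT `[(j.+1%:R : R), +oo[%classic (measurable_itv _)).
  rewrite setTI; congr measurable; apply/seteqP; split => y /=; by rewrite in_itv /= andbT.
(* [h] rounded down to a multiple of [1 / (N + 1)]: a finite combination of indicators, to which
   [hB] applies. *)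
pose hN N y := N.+1%:R^-1 * \sum_(j < N.+1) \1_[set y | j.+1%:R <= N.+1%:R * h y] y : R.
have hNh N y : `|hN N y - h y| <= N.+1%:R^-1.
  have := @layer_sum N.+1 (N.+1%:R * h y).
  have /andP[h0 h1] := h01 y.
  rewrite mulr_ge0//= ler_piMr// => /(_ isT) hs.
  have -> : hN N y - h y = N.+1%:R^-1 * (\sum_(j < N.+1) (j.+1%:R <= N.+1%:R * h y)%R%:R - N.+1%:R * h y).
    rewrite mulrBr mulKf ?pnatr_eq0//; congr (_ * _ - _).
    apply: eq_bigr => j _; rewrite indicE; congr (_%:R).
    by congr nat_of_bool; apply/idP/idP; rewrite inE.
  by rewrite normrM gtr0_norm ?invr_gt0// ler_piMr ?invr_ge0.
have m1 N (j : nat) : measurable_fun setT (fun w => \1_[set y | j.+1%:R <= N.+1%:R * h y] (Y w) : R).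
  by apply: measurableT_comp mY; exact: measurable_indic.
have mhY : measurable_fun setT (fun w => h (Y w)) by exact: measurableT_comp.
have ihY : itg P (fun w => h (Y w)).
  by apply: (@itg_bnd _ _ _ P _ 1) => // w; have /andP[h0 h1] := h01 (Y w); rewrite ger0_norm.
have i1 N (j : nat) : itg P (fun w => \1_[set y | j.+1%:R <= N.+1%:R * h y] (Y w) : R).
  by apply: (@itg_bnd _ _ _ P _ 1) => // w; rewrite indicE; case: (_ \in _); rewrite ?normr1 ?normr0.
have iU1 N (j : nat) : itg P (fun w => U w * \1_[set y | j.+1%:R <= N.+1%:R * h y] (Y w)).
  apply: (@itg_dom _ _ _ P _ (fun w => `|U w|)).
  - by apply: measurable_funM => //; exact: itg_meas iU.
  - exact: itg_norm.
  - by move=> w; rewrite normrM ler_piMr// indicE; case: (_ \in _); rewrite ?normr1 ?normr0.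
have iUh : itg P (fun w => U w * h (Y w)).
  apply: (@itg_dom _ _ _ P _ (fun w => `|U w|)).
  - by apply: measurable_funM => //; exact: itg_meas iU.
  - exact: itg_norm.
  - by move=> w; rewrite normrM ler_piMr//; have /andP[h0 h1] := h01 (Y w); rewrite ger0_norm.
have ihN N : itg P (fun w => hN N (Y w)) by apply: itgZ; apply: itg_sum => j; exact: i1.
have UhE N w : U w * hN N (Y w) = N.+1%:R^-1 * \sum_(j < N.+1) (U w * \1_[set y | j.+1%:R <= N.+1%:R * h y] (Y w)).
  by rewrite /hN mulrCA mulr_sumr.
have iUhN N : itg P (fun w => U w * hN N (Y w)).
  under [X in itg _ X]eq_fun do rewrite UhE.
  by apply: itgZ; apply: itg_sum => j; exact: iU1.
have step N : Ex P (fun w => U w * hN N (Y w)) = k * Ex P (fun w => hN N (Y w)).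
  under eq_Ex do rewrite UhE.
  rewrite ExZ; last by apply: itg_sum => j; exact: iU1.
  rewrite Ex_sum; last by move=> j; exact: iU1.
  rewrite ExZ; last by apply: itg_sum => j; exact: i1.
  rewrite Ex_sum; last by move=> j; exact: i1.
  rewrite [RHS]mulrCA; congr (_ * _); rewrite mulr_sumr; apply: eq_bigr => j _; exact: hB.
have bnd N : `|Ex P (fun w => U w * h (Y w)) - k * Ex P (fun w => h (Y w))| <= E / N.+1%:R.
  have -> : Ex P (fun w => U w * h (Y w)) - k * Ex P (fun w => h (Y w)) =
     Ex P (fun w => U w * h (Y w) - U w * hN N (Y w)) +
     k * Ex P (fun w => hN N (Y w) - h (Y w)).
    by rewrite !ExB// step mulrBr addrA subrK.
  rewrite (le_trans (ler_normD _ _))// /E mulrDl lerD//.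
    rewrite -ExZr; last exact: itg_norm.
    apply: Ex_norm_le; [exact: itgB| |].
      by under [X in itg _ X]eq_fun do rewrite mulrC; apply: itgZ; exact: itg_norm.
    by move=> w; rewrite -mulrBr normrM ler_wpM2l// distrC.
  rewrite normrM ler_wpM2l//; apply: Ex_bnd => [|w]; last exact: hNh.
  exact: itg_meas (itgB (ihN N) ihY).
apply/eqP; rewrite -subr_eq0 -normr_eq0 eq_le normr_ge0 andbT.
apply/ler_addgt0Pl => e e0; rewrite addr0.
have [N hNN] : exists N : nat, E / e < N%:R.
  by exists (Num.bound (E / e)); have := archi_boundP (divr_ge0 E0 (ltW e0)).
apply: (le_trans (bnd N)); rewrite ler_pdivrMr// mulrC -ler_pdivrMr//.
by rewrite (le_trans (ltW hNN))// ler_nat.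
Qed.

Lemma Ex_indep_cos (U Y : T -> R) (k s b : R) : itg P U ->
  measurable_fun setT Y ->
  (forall B, measurable B -> Ex P (fun w => U w * \1_B (Y w)) =
     k * Ex P (fun w => \1_B (Y w))) ->
  Ex P (fun w => U w * cos (s * Y w + b)) = k * Ex P (fun w => cos (s * Y w + b)).
Proof.
move=> iU mY hB.
pose h y := (cos (s * y + b) + 1) / 2.
have mc : measurable_fun setT (fun y : R => cos (s * y + b)).
  apply: measurableT_comp; first exact: continuous_measurable_fun (@continuous_cos R).
  by apply: measurable_funD => //; exact: measurable_funM.
have mh : measurable_fun setT h.
  by apply: measurable_funM => //; exact: measurable_funD.
have h01 y : 0 <= h y <= 1.
  by have := cos_geN1 (s * y + b); have := cos_le1 (s * y + b); rewrite /h => ? ?; apply/andP; split; lra.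
have ic : itg P (fun w => cos (s * Y w + b)).
  by apply: (@itg_bnd _ _ _ P _ 1) => [|w]; [exact: (measurableT_comp mc mY)|exact: cos_max].
have iUc : itg P (fun w => U w * cos (s * Y w + b)).
  apply: (@itg_dom _ _ _ P _ (fun w => `|U w|)).
  - by apply: measurable_funM; [exact: itg_meas iU|exact: itg_meas ic].
  - exact: itg_norm.
  - by move=> w; rewrite normrM ler_piMr// cos_max.
have h1 : Ex P U = k.
  have := hB _ measurableT.
  under eq_Ex do rewrite indicT mulr1.
  by under [in RHS]eq_Ex do rewrite indicT; rewrite Ex_cst mulr1.
have := Ex_step iU mY mh h01 hB.
have -> : (fun w => U w * h (Y w)) = (fun w => 2^-1 * (U w * cos (s * Y w + b)) + 2^-1 * U w).
  by apply/funext => w; rewrite /h; ring.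
have -> : (fun w => h (Y w)) = (fun w => 2^-1 * cos (s * Y w + b) + 2^-1).
  by apply/funext => w; rewrite /h; ring.
rewrite !ExD ?ExZ ?Ex_cst ?h1; [lra|..] => //; try exact: itgZ.
exact: itg_cst.
Qed.

End step_approximation.

(** * Characteristic functions of independent Gaussian variables *)

Section independent_gaussians.
Context {R : realType} {d : measure_display} {T : measurableType d}
  {P : probability T R} {I : finType} {D : pred I} {Y : I -> T -> R} {v : I -> R}.
Hypotheses (indep : independent_on P D Y) (v0 : forall i, 0 <= v i)
  (gY : forall i, i \in D -> has_gauss_law P (Y i) 0 (v i)).

Let ind (J : {set I}) (B : I -> set R) w : R := \prod_(i in J) \1_(B i) (Y i w).

Lemma Ex_ind (J : {set I}) B : {subset J <= D} -> (forall i, measurable (B i)) ->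
  itg P (ind J B) /\ Ex P (ind J B) = \prod_(i in J) Ex P (fun w => \1_(B i) (Y i w)).
Proof.
move=> JD mB.
have mE i : i \in J -> measurable (Y i @^-1` B i).
  move=> iJ; have [mY _] := gY (JD _ iJ); rewrite -[X in measurable X]setTI.
  exact: mY.
pose A := \bigcap_(i in [set` J]) (Y i @^-1` B i).
have mA : measurable A by apply: fin_bigcap_measurable => // i /= iJ; exact: mE.
have indE : ind J B = \1_A.
  apply/funext => w; rewrite /ind indicE; case: (pselect (A w)) => hA.
    rewrite mem_set//; apply: big1 => i iJ; rewrite indicE mem_set//; exact: hA.
  rewrite (memNset hA).
  have [i [iJ hi]] : exists i, i \in J /\ ~ B i (Y i w).
    apply: contrapT => hn; apply: hA => i /= iJ; apply: contrapT => hi.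
    by apply: hn; exists i.
  by rewrite (bigD1 i)//= indicE (memNset hi) mul0r.
have i1 (A' : set T) : measurable A' -> itg P (\1_A').
  move=> mA'; apply: (@itg_bnd _ _ _ P _ 1); first exact: measurable_indic.
  by move=> w; rewrite indicE; case: (_ \in _); rewrite ?normr1 ?normr0.
have E1 (A' : set T) : measurable A' -> (Ex P (\1_A'))%:E = P A'.
  by move=> mA'; rewrite EFin_Ex ?integral_indic ?setIT//; exact: i1.
rewrite indE; split; first exact: i1.
apply: EFin_inj; rewrite E1// /A (indep JD mB) -prodEFin.
by apply: eq_bigr => i iJ; rewrite -E1//; exact: mE.
Qed.

(* The remaining indicators in [J] are what lets the product rule for events
   reach the cosine, one variable at a time. *)
Lemma indep_cos (c : I -> R) (r : seq I) : uniq r -> {subset r <= D} ->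
  forall (J : {set I}) B b, {subset J <= D} -> (forall i, i \in r -> i \notin J) ->
  (forall i, measurable (B i)) ->
  Ex P (fun w => ind J B w * cos (\sum_(i <- r) c i * Y i w + b)) =
  \prod_(i in J) Ex P (fun w => \1_(B i) (Y i w)) *
  (expR (- (\sum_(i <- r) v i * c i ^+ 2) / 2) * cos b).
Proof.
elim: r => [|i r IH] /=.
  move=> _ _ J B b JD _ mB; have [iE EE] := Ex_ind JD mB.
  under eq_Ex do rewrite big_nil add0r.
  by rewrite ExZr// EE big_nil oppr0 mul0r expR0 mul1r.
move=> /andP[ir ur] rD J B b JD rJ mB.
have iD : i \in D by apply: rD; rewrite mem_head.
have {}rD : {subset r <= D} by move=> j jr; apply: rD; rewrite inE jr orbT.
have {}IH := IH ur rD.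
have iJ : i \notin J by apply: rJ; rewrite mem_head.
have {}rJ j : j \in r -> j \notin J by move=> jr; apply: rJ; rewrite inE jr orbT.
have mYi := (gY iD).1.
pose S w := \sum_(j <- r) c j * Y j w.
have mS : measurable_fun setT S.
  rewrite /S; elim: r rD {IH ir ur rJ S} => [|j r IH] rD.
    by under [X in measurable_fun _ X]eq_fun do rewrite big_nil; exact: measurable_cst.
  under [X in measurable_fun _ X]eq_fun do rewrite big_cons.
  apply: measurable_funD.
    by apply: measurable_funM => //; exact: (gY (rD _ (mem_head _ _))).1.
  by apply: IH => k kr; apply: rD; rewrite inE kr orbT.
have [iI EI] := Ex_ind JD mB.
set p := \prod_(j in J) _ in EI *; pose K := expR (- (\sum_(j <- r) v j * c j ^+ 2) / 2).
have iU b' : itg P (fun w => ind J B w * cos (S w + b')).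
  apply: (@itg_dom _ _ _ P _ (fun w => `|ind J B w|)).
  - apply: measurable_funM; first exact: itg_meas iI.
    apply: measurableT_comp; first exact: continuous_measurable_fun (@continuous_cos R).
    exact: measurable_funD.
  - exact: itg_norm.
  - by move=> w; rewrite normrM ler_piMr// cos_max.
have key b' b'' : Ex P (fun w => ind J B w * cos (S w + b') * cos (c i * Y i w + b'')) =
    p * (K * cos b') * (expR (- (v i * c i ^+ 2 / 2)) * cos b'').
  rewrite -(gauss_cos _ _ (v0 i) (gY iD)); apply: Ex_indep_cos => // B' mB'.
  (* The event that [Y i] lies in [B'] joins the indicators, so that the induction hypothesis is
     used with [i |: J]. *)
  pose B'' j := if j == i then B' else B j.
  have mB'' j : measurable (B'' j) by rewrite /B''; case: ifP.
  have JE (F : I -> set R -> R) : \prod_(j in i |: J) F j (B'' j) = F i B' * \prod_(j in J) F j (B j).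
    rewrite big_setU1//= /B'' eqxx; congr (_ * _); apply: eq_bigr => j jJ.
    by case: eqP => // ji; move: iJ; rewrite -ji jJ.
  have := IH (i |: J) B'' b' _ _ mB''.
  rewrite (JE (fun j b => Ex P (fun w => \1_b (Y j w)))) => IH'.
  have E2 z : z * p * (K * cos b') = p * (K * cos b') * z by ring.
  rewrite -E2 /p /K -IH'.
  - apply: eq_Ex => w; rewrite /ind (JE (fun j b => \1_b (Y j w))); ring.
  - by move=> j; rewrite in_setU1 => /orP[/eqP->|/JD].
  - move=> j jr; rewrite in_setU1 negb_or rJ// andbT.
    by apply/eqP => ji; move: ir; rewrite -ji jr.
(* The addition formula, with sines written as shifted cosines so that [key] covers both terms; the
   second one vanishes because [cos (pi / 2) = 0]. *)
have cE w : ind J B w * cos (\sum_(j <- i :: r) c j * Y j w + b) =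
    ind J B w * cos (S w + b) * cos (c i * Y i w + 0) +
    ind J B w * cos (S w + (b - pi / 2)) * cos (c i * Y i w + pi / 2).
  rewrite big_cons -/(S w) addr0 addrA cosBpihalf cosDpihalf.
  by rewrite (addrC (c i * _)) -addrA (addrC (c i * _)) addrA cosD; ring.
have i2 b' b'' : itg P (fun w => ind J B w * cos (S w + b') * cos (c i * Y i w + b'')).
  apply: (@itg_dom _ _ _ P _ (fun w => `|ind J B w * cos (S w + b')|)).
  - apply: measurable_funM; first exact: itg_meas (iU b').
    apply: measurableT_comp; first exact: continuous_measurable_fun (@continuous_cos R).
    by apply: measurable_funD => //; exact: measurable_funM.
  - exact: itg_norm.
  - by move=> w; rewrite normrM ler_piMr// cos_max.
under eq_Ex do rewrite cE.
rewrite ExD// !key cos0 cos_pihalf !mulr0 addr0 mulr1 big_cons.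
rewrite /K -!mulrA; congr (_ * _); rewrite mulrC mulrAC -mulrA mulrC -expRD.
by congr (expR _ * _); field.
Qed.

Lemma indep_cf (c : I -> R) b :
  Ex P (fun w => cos (\sum_(i in D) c i * Y i w + b)) =
  expR (- (\sum_(i in D) v i * c i ^+ 2) / 2) * cos b.
Proof.
have := @indep_cos c (enum D) (enum_uniq _) _ finset.set0 (fun=> setT) b.
rewrite big_set0 mul1r !big_enum /= => <- //.
- by apply: eq_Ex => w; rewrite /ind big_set0 mul1r big_enum.
- by move=> i; rewrite mem_enum.
- by move=> i; rewrite inE.
- by move=> i _; rewrite inE.
Qed.

End independent_gaussians.

Section symmetric_independent.
Context {R : realType} {n : nat}.

Definition lowp := [pred p : 'I_n * 'I_n | (p.1 <= p.2)%N].

Lemma sum_low (F : 'I_n -> 'I_n -> R) : \sum_i \sum_j F i j =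
  \sum_(p in lowp) (if p.1 == p.2 then F p.1 p.2 else F p.1 p.2 + F p.2 p.1).
Proof.
rewrite pair_bigA /= (bigID (mem lowp)) /=.
have -> : \sum_(p : 'I_n * 'I_n | p \notin lowp) F p.1 p.2 =
    \sum_(p in lowp) (if p.1 == p.2 then 0 else F p.2 p.1).
  have sK : involutive (fun p : 'I_n * 'I_n => (p.2, p.1)) by case.
  rewrite (reindex_inj (inv_inj sK)) /=.
  rewrite [RHS](bigID (fun p => p.1 == p.2)) /= [X in _ = X + _]big1 ?add0r => [|p]; last first.
    by move=> /andP[_ ->].
  rewrite [RHS](eq_bigr (fun p => F p.2 p.1)) => [|p /andP[_ /negbTE ->]//].
  apply: eq_bigl => -[i j]; rewrite !inE /= -ltnNge ltn_neqAle andbC.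
  by congr (_ && _).
by rewrite -big_split; apply: eq_bigr => p _ /=; case: ifP => _; rewrite ?addr0.
Qed.

Context {d : measure_display} {T : measurableType d} {P : probability T R}
  {Z : T -> 'M[R]_n} {v : R}.
Hypotheses (v0 : 0 <= v) (sZ : forall w, (Z w)^T = Z w)
  (indep : independent_on P lowp (fun p w => Z w p.1 p.2))
  (gd : forall i, has_gauss_law P (fun w => Z w i i) 0 (2 * v))
  (go : forall i j : 'I_n, (i < j)%N -> has_gauss_law P (fun w => Z w i j) 0 v).

(** Off the diagonal the two equal entries add their coefficients, which contributes
    [(a_ij + a_ji)^2]; the doubled diagonal variance is exactly what completes the sum to
    [|a|^2 + <a, a^T>]. *)
Lemma goe_cf a b : Ex P (fun w => cos (dot a (Z w) + b)) =
  expR (- (v * (dot a a + dot a a^T) / 2)) * cos b.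
Proof.
pose vv (p : 'I_n * 'I_n) := if p.1 == p.2 then 2 * v else v.
pose c (p : 'I_n * 'I_n) := if p.1 == p.2 then a p.1 p.2 else a p.1 p.2 + a p.2 p.1.
have gv p : p \in lowp -> has_gauss_law P (fun w => Z w p.1 p.2) 0 (vv p).
  case: p => i j; rewrite inE /vv /= leq_eqVlt => /orP[/eqP/val_inj ->|ij].
    by rewrite eqxx.
  have /negbTE -> : i != j by rewrite neq_ltn ij.
  exact: go.
have vv0 p : 0 <= vv p by rewrite /vv; case: ifP => // _; rewrite mulr_ge0.
have := indep_cf indep vv0 gv c b.
have -> : \sum_(i in lowp) vv i * c i ^+ 2 = v * (dot a a + dot a a^T).
  rewrite /dot -big_split /=; under [in RHS]eq_bigr do rewrite -big_split /=.
  rewrite sum_low mulr_sumr; apply: eq_bigr => -[i j] _; rewrite /vv /c /= !mxE.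
  by case: eqP => [->|_]; ring.
rewrite mulNr => <-; apply: eq_Ex => w; congr (cos (_ + _)).
rewrite /dot sum_low; apply: eq_bigr => -[i j] _; rewrite /c /=.
case: eqP => // _; have -> : Z w j i = Z w i j by rewrite -{1}(sZ w) mxE.
by rewrite mulrDl.
Qed.

Lemma goe_itg : itg P (fun w => dot (Z w) (Z w)) /\
  Ex P (fun w => dot (Z w) (Z w)) <= 2 * v * n%:R ^+ 2.
Proof.
have e2 (p : 'I_n * 'I_n) : itg P (fun w => Z w p.1 p.2 ^+ 2) /\
    Ex P (fun w => Z w p.1 p.2 ^+ 2) <= 2 * v.
  case: p => i j /=; have v20 : 0 <= 2 * v by rewrite mulr_ge0.
  have [ij|ji|/val_inj ->] := ltngtP i j.
  - have g := go ij; split; first exact: gauss_itg_pow v0 g.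
    by have [_ -> _] := gauss_moments v0 g; rewrite expr0n add0r; lra.
  - have g := go ji.
    have -> : (fun w => Z w i j ^+ 2) = (fun w => Z w j i ^+ 2).
      by apply/funext => w; rewrite -{1}(sZ w) mxE.
    split; first exact: gauss_itg_pow v0 g.
    by have [_ -> _] := gauss_moments v0 g; rewrite expr0n add0r; lra.
  - have g := gd j; split; first exact: gauss_itg_pow v20 g.
    by have [_ -> _] := gauss_moments v20 g; rewrite expr0n add0r.
have -> : (fun w => dot (Z w) (Z w)) = (fun w => \sum_(p : 'I_n * 'I_n) Z w p.1 p.2 ^+ 2).
  by apply/funext => w; rewrite dot_pair; apply: eq_bigr => p _; rewrite expr2.
split; first by apply: itg_sum => p; have [] := e2 p.
rewrite Ex_sum => [|p]; last by have [] := e2 p.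
rewrite (@le_trans _ _ (\sum_(p : 'I_n * 'I_n) 2 * v))//.
  by apply: ler_sum => p _; have [] := e2 p.
rewrite sumr_const card_prod !card_ord -[_ *+ (n * n)]mulr_natl natrM.
by rewrite le_eqVlt; apply/orP; left; apply/eqP; ring.
Qed.

End symmetric_independent.

Section gaussian_goe.
Context {R : realType} {n : nat} {G Z : random_matrix R n} {s : int -> R} {v : R}.
Hypotheses (n_gt0 : (0 < n)%N) (v1 : 1 <= v) (hZ : goe_like s Z)
  (gG : gvec (rm_prob G) G (fun a => v * (dot a a + dot a a^T))).
Let u := ell2_norm s ^+ 2.
Hypothesis u1 : 1 <= u.

Let u0 : 0 <= u. Proof. exact: sqr_ge0. Qed.

Let cfZ a b : Ex (rm_prob Z) (fun w => cos (dot a (Z w) + b)) =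
  expR (- (u * (dot a a + dot a a^T) / 2)) * cos b.
Proof. by have [sZ iZ gd go] := hZ; exact: goe_cf. Qed.

Lemma same_law_goe : v = u -> same_law G Z.
Proof.
move=> vu B hB; apply: (cf_law _ _ _ hB); [exact: rm_measurable..|move=> a b].
by rewrite (gvec_cf gG) cfZ vu.
Qed.

(* [G] has the law of [sqrt (v / u) Z]. *)
Lemma dFM_gaussian_goe : (dFM G Z <= (2 * n%:R * `|v - u|)%:E)%E.
Proof.
have [sZ iZ gd go] := hZ; have [itZ EZ] := goe_itg u0 sZ gd go.
have u_gt0 : 0 < u by rewrite (lt_le_trans ltr01).
have v_gt0 : 0 < v by rewrite (lt_le_trans ltr01).
have mZ : mmeas Z := @rm_measurable _ _ Z.
apply: dFM_le => // g gL gB.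
have gL1 (x y : 'M[R]_n) : `|g x - g y| <= 1 * nrm (x - y) by rewrite mul1r.
pose r := Num.sqrt v / Num.sqrt u.
have r0 : 0 <= r by rewrite divr_ge0 ?sqrtr_ge0.
have r2 : r ^+ 2 = v / u by rewrite expr_div_n !sqr_sqrtr ?ltW.
have mrZ : mmeas (fun w => r *: Z w).
  by move=> i j; under [X in measurable_fun _ X]eq_fun do rewrite mxE; exact: measurable_funM.
have -> : Ex (rm_prob G) (fun w => g (G w)) = Ex (rm_prob Z) (fun w => g (r *: Z w)).
  apply: (cf_lip gG.1 mrZ _ ler01 gL1 gB) => a b.
  rewrite (gvec_cf gG); under [in RHS]eq_Ex do rewrite dotZr -dotZl.
  rewrite cfZ; have -> : dot (r *: a) (r *: a) + dot (r *: a) (r *: a)^T =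
      r ^+ 2 * (dot a a + dot a a^T).
    have -> : (r *: a)^T = r *: a^T by rewrite linearZ.
    by rewrite !dotZl !dotZr; ring.
  by rewrite r2 mulrA (mulrC u) divfK// gt_eqF.
have ig (Y : rm_space Z -> 'M[R]_n) : mmeas Y -> itg (rm_prob Z) (fun w => g (Y w)).
  move=> mY; apply: (@itg_bnd _ _ _ (rm_prob Z) _ 1) => [|w]; last exact: gB.
  exact: (mmeas_lip mY ler01 gL1 gB).
have mnZ : measurable_fun setT (fun w => nrm (Z w)).
  by apply: measurableT_comp; [exact: continuous_measurable_fun (@sqrt_continuous R)|exact: mmeas_dot2].
have inZ2 : itg (rm_prob Z) (fun w => nrm (Z w) ^+ 2).
  by under [X in itg _ X]eq_fun do rewrite nrm_sqr.
have inZ : itg (rm_prob Z) (fun w => nrm (Z w)).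
  apply: (@itg_dom _ _ _ (rm_prob Z) _ (fun w => 1 + nrm (Z w) ^+ 2)) => //.
    by apply: itgD => //; exact: itg_cst.
  by move=> w; rewrite ler_norml; move: (nrm _) => x; nra.
have EnZ : Ex (rm_prob Z) (fun w => nrm (Z w)) <= 2 * n%:R * Num.sqrt u.
  have -> : (fun w => nrm (Z w)) = (fun w => `|nrm (Z w)|).
    by apply/funext => w; rewrite ger0_norm ?nrm_ge0.
  apply: (le_trans (Ex_abs_sqrt inZ2 mnZ)).
  under eq_Ex do rewrite nrm_sqr.
  rewrite -(@ler_pXn2r _ 2)// ?nnegrE ?mulr_ge0 ?sqrtr_ge0// sqr_sqrtr; last first.
    by apply: Ex_ge0 => w; exact: dot_ge0.
  rewrite (le_trans EZ)// !exprMn sqr_sqrtr//.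
  rewrite (_ : 2 * u * _ = 2 * (u * n%:R ^+ 2)); last by ring.
  rewrite (_ : 2 ^+ 2 * _ * u = 4 * (u * n%:R ^+ 2)); last by ring.
  have : 0 <= u * n%:R ^+ 2 by apply: mulr_ge0; [exact: u0|exact: exprn_ge0].
  by move: (u * _) => x x0; lra.
rewrite -ExB; [|exact: ig..].
apply: (le_trans (ler_norm _)).
apply: (@le_trans _ _ (Ex (rm_prob Z) (fun w => `|r - 1| * nrm (Z w)))).
  apply: Ex_norm_le; [by apply: itgB; exact: ig|exact: itgZ|] => w.
  by rewrite (le_trans (gL _ _))// -{2}(scale1r (Z w)) -scalerBl nrmZ.
rewrite ExZ// (le_trans (ler_wpM2l (normr_ge0 _) EnZ))//.
rewrite mulrCA ler_wpM2l ?mulr_ge0//.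
have su : 0 < Num.sqrt u by rewrite sqrtr_gt0.
have -> : `|r - 1| * Num.sqrt u = `|Num.sqrt v - Num.sqrt u|.
  have -> : Num.sqrt v - Num.sqrt u = (r - 1) * Num.sqrt u.
    by rewrite mulrBl mul1r /r divfK// gt_eqF.
  by rewrite normrM (gtr0_norm su).
(* As [sqrt u >= 1], the difference of the roots is at most [|v - u|]. *)
have -> : v - u = (Num.sqrt v - Num.sqrt u) * (Num.sqrt v + Num.sqrt u).
  by rewrite -subr_sqr !sqr_sqrtr// ltW.
rewrite normrM ler_peMr// ger0_norm ?addr_ge0 ?sqrtr_ge0//.
have : 1 <= Num.sqrt u by rewrite -[leLHS]sqrtr1 ler_wsqrtr.
by have := sqrtr_ge0 v; lra.
Qed.

End gaussian_goe.

(** * Covariance of fractional Gaussian noise *)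

Section mean_value.
Context {R : realType}.

Lemma mean_value (f f1 : R -> R) (a b : R) : a < b ->
  (forall x, a <= x <= b -> is_derive x (1 : R) f (f1 x)) ->
  exists2 c, a < c < b & f b - f a = f1 c * (b - a).
Proof.
move=> ab df; have [||c hc e] := @MVT _ f f1 a b ab.
- by move=> x; rewrite in_itv /= => /andP[/ltW h1 /ltW h2]; apply: df; rewrite h1.
- apply: derivable_within_continuous => x; rewrite in_itv /= => h.
  exact: (@ex_derive _ _ _ _ _ _ _ (df x h)).
- by exists c => //; move: hc; rewrite in_itv.
Qed.

(* The mean value theorem for [t |-> f (k + t) + f (k - t) - m t^2]. *)
Lemma second_diff (f f1 f2 : R -> R) (k m : R) :
  (forall x, k - 1 <= x <= k + 1 -> is_derive x (1 : R) f (f1 x)) ->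
  (forall x, k - 1 <= x <= k + 1 -> is_derive x (1 : R) f1 (f2 x)) ->
  (forall x, k - 1 <= x <= k + 1 -> m <= f2 x) ->
  m <= f (k + 1) + f (k - 1) - 2 * f k.
Proof.
move=> d1 d2 hm.
pose g t := f (k + t) + f (k - t) - m * t ^+ 2.
have [|c /andP[c0 c1] gE] := @mean_value g
    (fun t => f1 (k + t) - f1 (k - t) - m * (2 * t)) 0 1 ltr01.
  move=> t /andP[t0 t1]; rewrite /g.
  have h1 : is_derive (k + t) (1 : R) f (f1 (k + t)).
    by apply: d1; apply/andP; split; lra.
  have h2 : is_derive (k - t) (1 : R) f (f1 (k - t)).
    by apply: d1; apply/andP; split; lra.
  have e1 : is_derive t (1 : R) (fun t => k + t) 1 by der; ring.
  have e2 : is_derive t (1 : R) (fun t => k - t) (-1) by der; ring.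
  have h1' := dr_comp h1 e1.
  have h2' := @dr_comp _ (fun t => k - t) f t (-1) _ h2 e2.
  by der; ring.
have [||z /andP[z0 z1] zE] := @mean_value f1 f2 (k - c) (k + c).
- by lra.
- by move=> x /andP[x0 x1]; apply: d2; apply/andP; split; lra.
have mz : m <= f2 z by apply: hm; apply/andP; split; lra.
move: gE; rewrite zE /g addr0 subr0 expr1n expr0n mulr0 mulr1 => gE.
have : m * (2 * c) <= f2 z * (2 * c) by rewrite ler_wpM2r//; lra.
lra.
Qed.

Lemma second_diff_norm (f f1 f2 : R -> R) (k m : R) :
  (forall x, k - 1 <= x <= k + 1 -> is_derive x (1 : R) f (f1 x)) ->
  (forall x, k - 1 <= x <= k + 1 -> is_derive x (1 : R) f1 (f2 x)) ->
  (forall x, k - 1 <= x <= k + 1 -> `|f2 x| <= m) ->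
  `|f (k + 1) + f (k - 1) - 2 * f k| <= m.
Proof.
move=> d1 d2 hm; rewrite ler_norml; apply/andP; split.
  apply: second_diff d1 d2 _ => x hx; have := hm x hx.
  by rewrite ler_norml => /andP[].
have : - m <= - f (k + 1) + - f (k - 1) - 2 * - f k; last by lra.
apply: (@second_diff (fun x => - f x) (fun x => - f1 x) (fun x => - f2 x)) => x hx.
- by have := d1 x hx => h; der.
- by have := d2 x hx => h; der.
- by have := hm x hx; rewrite ler_norml => /andP[_]; rewrite lerN2.
Qed.

Lemma dr_powR (p x : R) : 0 < x -> is_derive x (1 : R) (fun y : R => y `^ p) (p * x `^ (p - 1)).
Proof. exact: is_derive1_powR. Qed.

Lemma powR_mono_neg (p x y : R) : p <= 0 -> 0 < x -> x <= y -> y `^ p <= x `^ p.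
Proof.
move=> p0 x0 xy; have y0 := lt_le_trans x0 xy.
rewrite -[p]opprK [leLHS]powRN [leRHS]powRN lef_pV2 ?posrE ?powR_gt0//.
by rewrite ge0_ler_powR ?nnegrE ?oppr_ge0// ltW.
Qed.

Lemma powR_half_le (p x : R) : 0 <= p <= 2 -> 0 < x -> (x / 2) `^ (- p) <= 4 * x `^ (- p).
Proof.
move=> /andP[p0 p2] x0; rewrite powRM ?invr_ge0 ?(ltW x0)// mulrC.
rewrite ler_wpM2r ?powR_ge0//.
rewrite -powR_inv1// -powRrM mulN1r opprK.
rewrite (le_trans (ler_powR _ p2))//; first by rewrite ler1n.
by rewrite powR_mulrn// -natrX.
Qed.

End mean_value.

Section fgn.
Context {R : realType}.
Implicit Type H : R.

Lemma s_fgn_even H k : s_fgn H (- k) = s_fgn H k.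
Proof.
rewrite /s_fgn rmorphN /= normrN.
by rewrite -[`|_ + 1|]normrN -[`|_ - 1|]normrN !opprD !opprK [X in _ * (X - _)]addrC.
Qed.

Lemma s_fgn0 H : 0 < H -> s_fgn H 0 = 1.
Proof.
move=> H0; rewrite /s_fgn mulr0z add0r sub0r normrN normr1 normr0 powR0 ?powR1; first by field.
by rewrite mulf_neq0 ?gt_eqF.
Qed.

Lemma s_fgnE H (k : nat) : (0 < k)%N -> s_fgn H k%:Z =
  2^-1 * ((k%:R + 1) `^ (2 * H) + (k%:R - 1) `^ (2 * H) - 2 * k%:R `^ (2 * H)).
Proof.
move=> k0; rewrite /s_fgn -pmulrn !ger0_norm//.
by rewrite subr_ge0 ler1n.
Qed.

Let k1 (k : nat) : (1 < k)%N -> 2 <= k%:R :> R.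
Proof. by move=> h; rewrite -[leLHS]/(2%:R) ler_nat. Qed.

Lemma s_fgn_bound H (k : nat) : 0 < H <= 3 / 4 -> (0 < k)%N ->
  `|s_fgn H k%:Z| <= 2 * k%:R `^ (- (2 - 2 * H)).
Proof.
move=> /andP[H0 H1] k0; rewrite s_fgnE//; set h := 2 * H.
have h0 : 0 < h by rewrite /h; lra.
have h1 : h <= 3 / 2 by rewrite /h; lra.
case: k k0 => [//|[|k]] _.
  (* For [k = 1] the interval [[k - 1, k + 1]] reaches 0, where powers are singular; the value
     [(2^h - 2) / 2] is bounded directly. *)
  rewrite subrr powR0 ?gt_eqF// !powR1 addr0 mulr1.
  have a1 : 1 <= (1 + 1 : R) `^ h.
    by rewrite -[leLHS](powRr0 (1 + 1)) ler_powR ?ltW//; lra.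
  have a2 : (1 + 1 : R) `^ h <= 4.
    have : (1 + 1 : R) `^ h <= (1 + 1) `^ 2%:R by apply: ler_powR; lra.
    by rewrite powR_mulrn; lra.
  by rewrite ler_norml; apply/andP; split; lra.
set x := k.+2%:R; have x2 : 2 <= x by exact: k1.
set a := x `^ (- (2 - h)).
have dx (y : R) : 0 < y -> is_derive y (1 : R) (fun z : R => z `^ h) (h * y `^ (h - 1)).
  exact: dr_powR.
have dx1 (y : R) : 0 < y -> is_derive y (1 : R) (fun z : R => h * z `^ (h - 1))
    (h * ((h - 1) * y `^ (h - 1 - 1))).
  by move=> y0; have hy := dr_powR (h - 1) y0; der; ring.
have : `|(x + 1) `^ h + (x - 1) `^ h - 2 * x `^ h| <= 4 * a.
  apply: (@second_diff_norm _ (fun z : R => z `^ h) (fun z => h * z `^ (h - 1))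
    (fun z => h * ((h - 1) * z `^ (h - 1 - 1)))) => y /andP[y1 y2].
  - by apply: dx; lra.
  - by apply: dx1; lra.
  have y0 : 0 < y by lra.
  rewrite mulrA normrM [X in _ * X]ger0_norm ?powR_ge0//.
  (* [|h (h - 1)| <= 1] since [0 < h <= 3 / 2]; then [y >= x / 2] costs the factor 4. *)
  apply: (@le_trans _ _ (1 * y `^ (h - 1 - 1))).
    by rewrite ler_wpM2r ?powR_ge0// ler_norml; apply/andP; split; nra.
  rewrite mul1r (_ : h - 1 - 1 = - (2 - h)); last by ring.
  apply: (le_trans _ (@powR_half_le _ (2 - h) x _ _)); [|by apply/andP; split; lra|by lra].
  by apply: powR_mono_neg; lra.
rewrite normrM ger0_norm ?invr_ge0//; lra.
Qed.

(** The second derivative [(3 / 4) y^(-1/2)] is at least [(3 / 4) (2 / 3) k^(-1/2)] for [y <= 2 k],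
    so the covariance is at least [k^(-1/2) / 4]; its square gives the 16. *)
Lemma s_fgn_lower (k : nat) : (1 < k)%N ->
  16^-1 / k%:R <= s_fgn (3 / 4 : R) k%:Z ^+ 2.
Proof.
move=> k2; have k0 : (0 < k)%N by exact: ltnW.
rewrite s_fgnE// (_ : 2 * (3 / 4) = 3 / 2 :> R); last by field.
set x : R := k%:R; have x2 : 2 <= x by exact: k1.
pose a := x `^ (- (1 / 2)).
have a0 : 0 < a by rewrite powR_gt0//; lra.
have aa : a ^+ 2 = x^-1.
  rewrite -powR_mulrn ?powR_ge0// -powRrM -[RHS]powR_inv1; last by lra.
  by rewrite (_ : - (1 / 2) * 2%:R = -1)//; field.
have c2 : 2 / 3 <= 2 `^ (- (1 / 2)) :> R.
  have -> : 2 `^ (- (1 / 2)) = (Num.sqrt 2)^-1 :> R.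
    by rewrite powRN (_ : 1 / 2 = 2^-1) ?powR12_sqrt//; field.
  rewrite -[leLHS]invrK lef_pV2 ?posrE ?invr_gt0 ?sqrtr_gt0 ?divr_gt0//.
  rewrite -(@ler_pXn2r _ 2)// ?nnegrE ?sqrtr_ge0 ?invr_ge0 ?divr_ge0//.
  by rewrite sqr_sqrtr//; lra.
have hS : 2^-1 * a <= (x + 1) `^ (3 / 2) + (x - 1) `^ (3 / 2) - 2 * x `^ (3 / 2).
  apply: (@second_diff _ (fun z : R => z `^ (3 / 2))
    (fun z : R => (3 / 2) * z `^ (3 / 2 - 1))
    (fun y : R => (3 / 2) * ((3 / 2 - 1) * y `^ (3 / 2 - 1 - 1)))) => y /andP[y1 y2].
  - by apply: dr_powR; lra.
  - have y0 : 0 < y by lra.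
    by have hy := dr_powR (3 / 2 - 1) y0; der; ring.
  - rewrite mulrA (_ : 3 / 2 - 1 - 1 = - (1 / 2)); last by field.
    have : (2 * x) `^ (- (1 / 2)) <= y `^ (- (1 / 2)) by apply: powR_mono_neg; lra.
    rewrite powRM; [|by lra..].
    rewrite -/a => h2; have : 2 / 3 * a <= 2 `^ (- (1 / 2)) * a by rewrite ler_wpM2r// ltW.
    nra.
rewrite -aa -/x; move: hS; move: (_ - _) => z hz; nra.
Qed.

Lemma s_fgn_half (k : int) : k != 0 -> s_fgn (1 / 2 : R) k = 0.
Proof.
move=> k0; wlog kp : k k0 / 0 < k.
  move=> hw; have [|kn] := ltP 0 k; first exact: hw.
  by rewrite -s_fgn_even; apply: hw; rewrite ?oppr_eq0// oppr_gt0 lt_neqAle k0.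
case: k kp k0 => [[//|k]|//] _ _; rewrite s_fgnE//.
rewrite (_ : 2 * (1 / 2) = 1 :> R); last by field.
rewrite (_ : k.+1%:R - 1 = k%:R); last by rewrite -natr1 addrK.
by rewrite !powRr1// -natr1; ring.
Qed.

End fgn.

(** * Comparison of power and harmonic sums with integrals *)

Section power_sums.
Context {R : realType}.

Lemma powR_step (q : R) (k : nat) : (0 < k)%N -> exists2 c : R, k%:R < c < k.+1%:R &
  k.+1%:R `^ q - k%:R `^ q = q * c `^ (q - 1).
Proof.
move=> k0; have kp : 0 < k%:R :> R by rewrite ltr0n.
have [||c hc e] := @mean_value R (fun x => x `^ q) (fun x => q * x `^ (q - 1)) k%:R k.+1%:R.
- by rewrite ltr_nat.
- by move=> x /andP[kx _]; apply: dr_powR; exact: lt_le_trans kx.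
- by exists c => //; rewrite e -natr1 addrAC subrr add0r mulr1.
Qed.

(** Telescoping: the mean value point between [k] and [k + 1] lies to the left of [k + 1], which is
    why the summand is taken there. *)
Lemma tail_sum (q : R) (D N : nat) : 1 < q -> (0 < D <= N)%N ->
  \sum_(D <= k < N) k.+1%:R `^ (- q) <= D%:R `^ (1 - q) / (q - 1).
Proof.
move=> q1 /andP[D0 DN].
have hq : 0 < q - 1 by lra.
have h : \sum_(D <= k < N) k.+1%:R `^ (- q) <= (D%:R `^ (1 - q) - N%:R `^ (1 - q)) / (q - 1).
  rewrite ler_pdivlMr// -(subnKC DN); elim: (N - D)%N => [|m IH].
    by rewrite addn0 big_geq// subrr mul0r.
  rewrite addnS big_nat_recr ?leq_addr//= mulrDl.
  have [c /andP[c1 c2] e] := @powR_step (1 - q) (D + m) (ltn_addr _ D0).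
  have c0 : 0 < c by rewrite (le_lt_trans _ c1)//.
  have : (D + m).+1%:R `^ (- q) <= c `^ (- q) by apply: powR_mono_neg => //; [lra|exact: ltW].
  move: e; rewrite (_ : 1 - q - 1 = - q); last by ring.
  move: ((D + m).+1%:R `^ (- q)) (c `^ _) => u v e uv; nra.
apply: (le_trans h); rewrite ler_wpM2r ?invr_ge0 ?(ltW hq)//.
by rewrite lerBlDr lerDl powR_ge0.
Qed.

Lemma sum_pow_gt1 (q : R) (d : nat) : 1 < q ->
  \sum_(1 <= k < d) k%:R `^ (- q) <= 1 + (q - 1)^-1.
Proof.
move=> q1; have hq : 0 < q - 1 by lra.
have h0 : 0 <= 1 + (q - 1)^-1 by rewrite addr_ge0 ?invr_ge0// ltW.
case: d => [|[|d]]; [by rewrite big_geq|by rewrite big_geq|].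
rewrite big_ltn// powR1 lerD2l big_add1 /=.
case: d => [|d]; first by rewrite big_geq// invr_ge0 ltW.
have := @tail_sum q 1 d.+2 q1 isT; rewrite powR1 mul1r; exact: le_trans.
Qed.

Lemma sum_pow_lt1 (p : R) (d : nat) : 0 <= p < 1 ->
  \sum_(1 <= k < d) k%:R `^ (- p) <= d%:R `^ (1 - p) / (1 - p).
Proof.
move=> /andP[p0 p1]; have hp : 0 < 1 - p by lra.
have h (m : nat) : (\sum_(1 <= k < m.+1) k%:R `^ (- p)) * (1 - p) <= m%:R `^ (1 - p).
  elim: m => [|m IH]; first by rewrite big_geq// mul0r powR_ge0.
  rewrite big_nat_recr//= mulrDl; case: m IH => [|m] IH.
    by rewrite big_geq// mul0r add0r !powR1 mul1r lerBlDr lerDl.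
  have [c /andP[c1 c2] e] := @powR_step (1 - p) m.+1 isT.
  have c0 : 0 < c by rewrite (le_lt_trans _ c1).
  have : m.+2%:R `^ (- p) <= c `^ (- p) by apply: powR_mono_neg => //; [lra|exact: ltW].
  move: e IH; rewrite (_ : 1 - p - 1 = - p); last by ring.
  move: (\sum_(1 <= k < m.+2) _) (m.+2%:R `^ (- p)) (c `^ _) => S u v e IH uv; nra.
rewrite ler_pdivlMr//; case: d => [|d]; first by rewrite big_geq// mul0r powR_ge0.
apply: (le_trans (h d)); rewrite ge0_ler_powR ?nnegrE ?ler_nat// ltW//.
Qed.

Lemma ln_step (k : nat) : (0 < k)%N ->
  (k.+1%:R : R)^-1 <= ln (k.+1%:R : R) - ln (k%:R : R) <= k%:R^-1.
Proof.
move=> k0; have kp : 0 < k%:R :> R by rewrite ltr0n.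
have kp' : 0 < k.+1%:R :> R by rewrite ltr0n.
rewrite -ln_div ?posrE//; apply/andP; split.
  rewrite -lerN2 -lnV ?posrE ?divr_gt0// invf_div.
  have -> : k%:R / k.+1%:R = 1 + - (k.+1%:R)^-1 :> R.
    by rewrite -natr1; field; rewrite natr1 gt_eqF.
  by apply: le_ln1Dx; rewrite ltrN2 invf_lt1// ltr1n.
have -> : k.+1%:R / k%:R = 1 + (k%:R)^-1 :> R by rewrite -natr1; field; rewrite gt_eqF.
by apply: le_ln1Dx; rewrite (lt_trans (ltrN10 _))// invr_gt0.
Qed.

Lemma sum_inv_le (d : nat) : (0 < d)%N -> \sum_(1 <= k < d) k%:R^-1 <= 1 + ln d%:R :> R.
Proof.
have h (m : nat) : \sum_(1 <= k < m.+2) k%:R^-1 <= 1 + ln m.+1%:R :> R.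
  elim: m => [|m IH]; first by rewrite big_nat1 invr1 ln1 addr0.
  rewrite big_nat_recr//=; have /andP[h _] := @ln_step m.+1 isT.
  by apply: (le_trans (lerD IH h)); rewrite -addrA lerD2l addrC subrK.
case: d => [|[|d]] // _; first by rewrite big_geq// ln1 addr0.
by apply: (le_trans (h d)); rewrite lerD2l ler_ln ?posrE ?ltr0n ?ler_nat.
Qed.

Lemma sum_inv_ge (d : nat) : (0 < d)%N -> ln d%:R <= \sum_(1 <= k < d) k%:R^-1 :> R.
Proof.
case: d => // d _; elim: d => [|d IH]; first by rewrite big_geq// ln1.
rewrite big_nat_recr//=; have /andP[_ h] := @ln_step d.+1 isT.
by rewrite -[leLHS](subrK (ln d.+1%:R)) addrC lerD.
Qed.

(** The elementary lower bound in Stirling's formula, used to average the logarithmic growth of the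
    windows at [H = 3 / 4]. *)
Lemma sum_ln_ge (d : nat) : (0 < d)%N ->
  d%:R * (ln d%:R - 1) <= \sum_(1 <= k < d.+1) ln k%:R :> R.
Proof.
case: d => // d _; elim: d => [|d IH]; first by rewrite big_nat1 ln1; lra.
rewrite big_nat_recr//=; have /andP[_ h] := @ln_step d.+1 isT.
move: IH h; move: (\sum_(1 <= k < d.+2) _) (ln d.+1%:R) (ln d.+2%:R) => S a b IH h.
have dp : 0 < d.+1%:R :> R by [].
have : d.+1%:R * (b - a) <= 1 by rewrite -[leRHS](divff (lt0r_neq0 dp)) ler_wpM2l// ltW.
rewrite -[d.+2%:R]natr1; nra.
Qed.

End power_sums.

(** * Sums over Toeplitz matrices *)

Section toeplitz_sums.
Context {R : realType}.
Implicit Type g : int -> R.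

Definition psum g (D : nat) : R := \sum_(1 <= k < D) g k%:Z.

Lemma psum_mono g D D' : (forall k, 0 <= g k) -> (D <= D')%N -> psum g D <= psum g D'.
Proof.
move=> g0 DD; rewrite /psum; case: D DD => [|D] DD.
  by rewrite big_geq// sumr_ge0.
by rewrite [leRHS](@big_cat_nat _ _ _ D.+1)//= lerDl sumr_ge0.
Qed.

Lemma row_sum g (u d : nat) : (forall k, g (- k) = g k) -> (u < d)%N ->
  \sum_(0 <= v < d) g (u%:Z - v%:Z) = g 0 + psum g u.+1 + psum g (d - u).
Proof.
move=> ge ud; rewrite (@big_cat_nat _ _ _ u)//=; last exact: ltnW.
rewrite [X in _ + X]big_ltn// subrr addrCA addrA; congr (_ + _ + _).
  rewrite /psum big_add1 /= big_nat_rev /= add0n big_nat_cond [RHS]big_nat_cond.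
  apply: eq_bigr => v /andP[/andP[_ vu] _]; congr g.
  by rewrite subzn ?leq_subr// subKn.
rewrite /psum -{1}(add1n u) big_addn; apply: eq_bigr => v _.
by rewrite -ge; congr g; rewrite PoszD opprB addrK.
Qed.

Lemma row_le g (u d : nat) : (forall k, g (- k) = g k) -> (forall k, 0 <= g k) ->
  (u < d)%N -> \sum_(v < d) g (u%:Z - v%:Z) <= g 0 + 2 * psum g d.
Proof.
move=> ge g0 ud; rewrite -(big_mkord xpredT (fun v => g (u%:Z - v%:Z))) row_sum//.
have := psum_mono g0 ud; have := psum_mono g0 (leq_subr u d); lra.
Qed.

(** Row [u] splits at the diagonal into [psum] up to [u + 1] and up to [d - u]; over all rows each
    bound from 1 to [d] occurs twice. *)
Lemma sg2E (s : int -> R) (d : nat) : (forall k, s (- k) = s k) -> (0 < d)%N ->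
  sg2 s d = s 0 ^+ 2 + 2 / d%:R * \sum_(1 <= D < d.+1) psum (fun k => s k ^+ 2) D.
Proof.
move=> se d0; set g := fun k => s k ^+ 2.
have ge k : g (- k) = g k by rewrite /g se.
have dp : d%:R != 0 :> R by rewrite pnatr_eq0 -lt0n.
have -> : sg2 s d = d%:R^-1 * \sum_(0 <= u < d) (g 0 + psum g u.+1 + psum g (d - u)).
  rewrite /sg2 /dot big_mkord; congr (_ * _); apply: eq_bigr => u _.
  rewrite -row_sum// big_mkord; apply: eq_bigr => v _.
  by rewrite !mxE -expr2.
have e1 : \sum_(0 <= u < d) psum g u.+1 = \sum_(1 <= D < d.+1) psum g D.
  by rewrite big_add1.
have e2 : \sum_(0 <= u < d) psum g (d - u) = \sum_(1 <= D < d.+1) psum g D.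
  rewrite -e1 big_nat_rev /= add0n big_nat_cond [RHS]big_nat_cond.
  apply: eq_bigr => u /andP[/andP[_ ud] _]; congr psum.
  by rewrite subnBA// addnC addnK.
rewrite !big_split /= e1 e2 sumr_const_nat subn0 -(mulr_natl (g 0)) -/(g 0).
by move: (g 0) (\sum_(1 <= D < _) _) => x y; field.
Qed.

(* Cauchy-Schwarz as [(sum b^3 c^3)^2 <= (sum b^4 c^4) (sum b^2 c^2)], so that only
   the sums of [|s|^(4/3)] enter. *)
Lemma tr4_le (s b : int -> R) (d : nat) : (forall k, b (- k) = b k) ->
  (forall k, 0 <= b k) -> (forall k, `|s k| <= b k ^+ 3) ->
  tr4 s d <= d%:R * (b 0 ^+ 4 + 2 * psum (fun k => b k ^+ 4) d) ^+ 3.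
Proof.
move=> be b0 sb; set A := b 0 ^+ 4 + _.
pose c (u v : 'I_d) := b (u%:Z - v%:Z).
have c0 u v : 0 <= c u v by exact: b0.
have cC u v : c u v = c v u by rewrite /c -be opprB.
have cA (u : 'I_d) : \sum_v c u v ^+ 4 <= A.
  by apply: row_le => [k|k|//]; [rewrite be|rewrite exprn_ge0].
have A0 : 0 <= A.
  by rewrite addr_ge0 ?exprn_ge0// mulr_ge0// sumr_ge0// => k _; rewrite exprn_ge0.
have SS (u v : 'I_d) : (toep s d *m toep s d) u v ^+ 2 <=
    (\sum_w c u w ^+ 4 * c w v ^+ 4) * A.
  apply: (@le_trans _ _ ((\sum_w (c u w ^+ 2 * c w v ^+ 2) * (c u w * c w v)) ^+ 2)).
    rewrite -(real_normK (num_real _)) ler_pXn2r// ?nnegrE//; last first.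
      by apply: sumr_ge0 => w _; rewrite !mulr_ge0 ?exprn_ge0.
    rewrite mxE (le_trans (ler_norm_sum _ _ _))//; apply: ler_sum => w _.
    rewrite !mxE normrM (_ : _ * _ * _ = c u w ^+ 3 * c w v ^+ 3); last by ring.
    by rewrite ler_pM// sb.
  apply: (le_trans (cauchy_sum _ _)).
  rewrite (eq_bigr (fun w => c u w ^+ 4 * c w v ^+ 4)) => [|w _]; last by ring.
  rewrite ler_wpM2l//; first by apply: sumr_ge0 => w _; rewrite mulr_ge0 ?exprn_ge0.
  apply: (@le_trans _ _ (\sum_w (c u w ^+ 4 + c v w ^+ 4) / 2)).
    apply: ler_sum => w _; rewrite (cC w v); have := sqr_ge0 (c u w ^+ 2 - c v w ^+ 2).
    by rewrite sqrrB -!exprM exprMn; lra.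
  by rewrite -mulr_suml big_split /=; have := cA u; have := cA v; lra.
rewrite /tr4 /dot.
apply: (@le_trans _ _ (\sum_(u < d) \sum_(v < d) (\sum_w c u w ^+ 4 * c w v ^+ 4) * A)).
  by apply: ler_sum => u _; apply: ler_sum => v _; rewrite -expr2 SS.
apply: (@le_trans _ _ (\sum_(u < d) A * A * A)).
  apply: ler_sum => u _; rewrite -mulr_suml ler_wpM2r// exchange_big /=.
  apply: (@le_trans _ _ (\sum_w c u w ^+ 4 * A)).
    by apply: ler_sum => w _; rewrite -mulr_sumr ler_wpM2l ?exprn_ge0.
  by rewrite -mulr_suml ler_wpM2r.
rewrite sumr_const card_ord -[_ *+ d]mulr_natl.
by rewrite le_eqVlt; apply/orP; left; apply/eqP; ring.
Qed.

End toeplitz_sums.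

Section square_sum.
Context {R : realType} {s : int -> R}.
Hypothesis se : forall k, s (- k) = s k.
Local Notation s2 := (fun k => s k ^+ 2).

(** The window [|k| < D] as a duplicate-free list, linking the unordered sum over [int] to
    [psum]. *)
Definition zwin (D : nat) : seq int :=
  0 :: [seq k%:Z | k <- index_iota 1 D] ++ [seq - k%:Z | k <- index_iota 1 D].

Lemma mem_zwin D k : (`|k| < D)%N -> k \in zwin D.
Proof.
move=> kD; rewrite inE mem_cat; case: k kD => [[|k]|k] kD //=.
  by rewrite (map_f Posz)// mem_index_iota.
rewrite NegzE; apply/orP; right.
by rewrite (map_f (fun k : nat => - k%:Z))// mem_index_iota.
Qed.

Lemma zwin_uniq D : uniq (zwin D).
Proof.
rewrite /= mem_cat negb_or cat_uniq !map_inj_uniq ?iota_uniq/=; last 2 first.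
- by move=> i j /oppr_inj[].
- by move=> i j [].
rewrite andbT -andbA; apply/and3P; split.
- by apply/mapP => -[[|k]]//; rewrite mem_index_iota.
- by apply/mapP => -[[|k]]//; rewrite mem_index_iota.
- apply/hasPn => _ /mapP[[|k] hk ->]; first by move: hk; rewrite mem_index_iota.
  by apply/mapP => -[[|l]].
Qed.

Lemma sum_zwin D : \sum_(k <- zwin D) s2 k = s 0 ^+ 2 + 2 * psum s2 D.
Proof.
rewrite /zwin big_cons big_cat /= !big_map /psum; congr (_ + _).
under [X in _ + X]eq_bigr do rewrite se.
ring.
Qed.

Lemma sq_sum_ge D : ((s 0 ^+ 2 + 2 * psum s2 D)%:E <= sq_sum s)%E.
Proof.
rewrite -sum_zwin -sumEFin; apply: esum_ge; exists [set` zwin D].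
  by split => //; exact: finite_seq.
by rewrite fsbig_seq ?zwin_uniq.
Qed.

Lemma sq_sum_le (B : R) : (forall D, s 0 ^+ 2 + 2 * psum s2 D <= B) ->
  (sq_sum s <= B%:E)%E.
Proof.
move=> hB; apply: ge_ereal_sup => _ [A [fA _] <-].
rewrite fsbig_finite//=; set r := finmap.enum_fset (fset_set A).
pose D := (\max_(k <- r) `|k|%N).+1.
have rD : {subset r <= zwin D}.
  by move=> k kr; apply: mem_zwin; rewrite /D ltnS; exact: leq_bigmax_seq.
rewrite sumEFin lee_fin (le_trans _ (hB D))// -sum_zwin.
rewrite [leLHS](_ : _ = \sum_(k <- zwin D | k \in r) s2 k); last first.
  rewrite -[RHS]big_filter; apply: perm_big; apply: uniq_perm.
  - exact: finmap.fset_uniq.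
  - exact/filter_uniq/zwin_uniq.
  - move=> k; rewrite mem_filter; case: (boolP (k \in r)) => //= kr.
    by rewrite rD.
rewrite big_mkcond /=; apply: ler_sum => k _; case: ifP => // _; exact: sqr_ge0.
Qed.

End square_sum.

(** * Rates of convergence *)

Section closeness.
Context {R : realType}.

(** Everything is asked for [0 < n] and [1 < d] only, which hold eventually along the sequences; the
    default values at [d = 0] and the zero of the logarithm at [d = 1] never enter. *)
Lemma phi_close_rate (phi : nat -> nat -> \bar R) (psi : nat -> nat -> R)
    (r : R -> R) (M N : forall n d : nat, random_matrix R n) :
  (forall n d, (0 < n)%N -> (1 < d)%N -> phi n d = (psi n d)%:E) ->
  (forall n d, (0 < n)%N -> (1 < d)%N -> (dFM (M n d) (N n d) <= (r (psi n d))%:E)%E) ->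
  r x @[x --> (0 : R)] --> (0 : R) -> phi_close phi M N.
Proof.
move=> hphi hd hr n_ d_ hn hd' hp.
have en : \forall k \near \oo, (0 < n_ k)%N by exact: hn (nbhs_infty_ge 1).
have ed : \forall k \near \oo, (1 < d_ k)%N by exact: hd' (nbhs_infty_ge 2).
have hpsi : psi (n_ k) (d_ k) @[k --> \oo] --> (0 : R).
  have /fine_cvgP[_ hp'] := hp.
  apply: cvg_trans hp'; apply: near_eq_cvg.
  near=> k; rewrite /= hphi//; [near: k; exact: en|near: k; exact: ed].
have hrp : r (psi (n_ k) (d_ k)) @[k --> \oo] --> (0 : R).
  exact: (cvg_comp _ _ hpsi hr).
have h1 : \forall k \near \oo, (0 <= dFM (M (n_ k) (d_ k)) (N (n_ k) (d_ k)) <=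
    (r (psi (n_ k) (d_ k)))%:E)%E.
  near=> k; have nk : (0 < n_ k)%N by near: k; exact: en.
  by rewrite dFM_ge0// hd//; near: k; exact: ed.
have h2 : (r (psi (n_ k) (d_ k)))%:E @[k --> \oo] --> 0%E.
  by apply/fine_cvgP; split => //; near=> k.
exact: (squeeze_cvge h1 (cvg_cst _) h2).
Unshelve. all: by end_near.
Qed.

Lemma sqrt_rate (K : R) : K * Num.sqrt x @[x --> (0 : R)] --> (0 : R).
Proof.
rewrite -[X in _ --> X](mulr0 K) -{2}(@sqrtr0 R).
by apply: cvgM; [exact: cvg_cst|exact: sqrt_continuous].
Qed.

Lemma lin_rate (K : R) : K * x @[x --> (0 : R)] --> (0 : R).
Proof.
rewrite -[X in _ --> X](mulr0 K).
by apply: cvgM; [exact: cvg_cst|exact: cvg_id].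
Qed.

End closeness.

Section fgn_rates.
Context {R : realType} {H : R}.
Hypotheses (H0 : 0 < H) (H1 : H <= 3 / 4).
Local Notation s := (s_fgn H).
Local Notation s2 := (fun k => s_fgn H k ^+ 2).

Let se k : s (- k) = s k. Proof. exact: s_fgn_even. Qed.
Let s0 : s 0 = 1. Proof. exact: s_fgn0. Qed.
Let H01 : 0 < H <= 3 / 4. Proof. by rewrite H0. Qed.
(* [|s k|^(4/3)] decays like [k^-p]; the threshold [p = 1] is [H = 5/8]. *)
Let p : R := 4 / 3 * (2 - 2 * H).

Lemma tr4_fgn (d : nat) :
  tr4 s d <= d%:R * (1 + 8 * \sum_(1 <= k < d) k%:R `^ (- p)) ^+ 3.
Proof.
have [b [be b0 b3 b4]] : exists b : int -> R, [/\ forall k, b (- k) = b k,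
    forall k, 0 <= b k, forall k, b k ^+ 3 = `|s k| &
    forall k, b k ^+ 4 = `|s k| `^ (4 / 3)].
  exists (fun k => `|s k| `^ 3^-1); split => k.
  - by rewrite se.
  - exact: powR_ge0.
  - by rewrite -powR_mulrn ?powR_ge0// -powRrM mulVf ?powRr1.
  - by rewrite -powR_mulrn ?powR_ge0// -powRrM mulrC.
have sb k : `|s k| <= b k ^+ 3 by rewrite b3.
apply: (le_trans (tr4_le d be b0 sb)).
have -> : b 0 ^+ 4 = 1 by rewrite b4 s0 normr1 powR1.
have h1 := H1.
have A0 : 0 <= 1 + 2 * psum (fun k => b k ^+ 4) d.
  by rewrite addr_ge0// mulr_ge0// sumr_ge0// => k _; rewrite b4 powR_ge0.
rewrite ler_wpM2l// ler_pXn2r// ?nnegrE//; last first.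
  rewrite addr_ge0// mulr_ge0// sumr_ge0// => k _; exact: powR_ge0.
(* The 2 counts the two sides of the window; the 4 bounds [2^(4/3)], where the base 2 is the
   constant of [s_fgn_bound]. *)
rewrite lerD2l (_ : 8 = 2 * 4 :> R); last by ring.
rewrite -mulrA ler_wpM2l// /psum mulr_sumr big_nat_cond [leRHS]big_nat_cond.
apply: ler_sum => k /andP[/andP[k1 _] _]; rewrite b4.
apply: (@le_trans _ _ ((2 * k%:R `^ (- (2 - 2 * H))) `^ (4 / 3))).
  rewrite ge0_ler_powR ?nnegrE ?mulr_ge0 ?powR_ge0//.
  exact: s_fgn_bound.
rewrite powRM ?powR_ge0// -powRrM mulNr [_ * (4 / 3)]mulrC -/p ler_wpM2r ?powR_ge0//.
apply: (@le_trans _ _ (2 `^ 2%:R)); first by apply: ler_powR; lra.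
by rewrite powR_mulrn//; lra.
Qed.

Lemma sg2_fgn (d : nat) : (0 < d)%N ->
  sg2 s d = 1 + 2 / d%:R * \sum_(1 <= D < d.+1) psum s2 D.
Proof. by move=> d0; rewrite sg2E// s0 expr1n. Qed.

(** Keeps [sg2] in the denominator: it is the source of the logarithm at [H = 3 / 4], whereas
    [tr4_div_le] only retains [1 <= sg2]. *)
Lemma tr4_div_sg2_le (d : nat) (A : R) : (0 < d)%N ->
  1 + 8 * \sum_(1 <= k < d) k%:R `^ (- p) <= A ->
  tr4 s d / (d%:R ^+ 2 * sg2 s d) <= A ^+ 3 / (d%:R * sg2 s d).
Proof.
move=> d0 hA; have dp : 0 < d%:R :> R by rewrite ltr0n.
have sg1 : 0 < sg2 s d by rewrite (lt_le_trans ltr01)// sg2_ge1.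
have B0 : 0 <= 1 + 8 * \sum_(1 <= k < d) k%:R `^ (- p) :> R.
  by rewrite addr_ge0// mulr_ge0// sumr_ge0// => k _; exact: powR_ge0.
have h : tr4 s d <= d%:R * A ^+ 3.
  by rewrite (le_trans (tr4_fgn d))// ler_wpM2l// ler_pXn2r// nnegrE// (le_trans B0).
rewrite (_ : A ^+ 3 / _ = d%:R * A ^+ 3 / (d%:R ^+ 2 * sg2 s d)).
  by rewrite ler_wpM2r// invr_ge0 mulr_ge0 ?exprn_ge0 ?(ltW sg1).
move: (sg2 s d) sg1 => v v0.
by field; rewrite !gt_eqF.
Qed.

Lemma tr4_div_le (d : nat) (A : R) : (0 < d)%N ->
  1 + 8 * \sum_(1 <= k < d) k%:R `^ (- p) <= A ->
  tr4 s d / (d%:R ^+ 2 * sg2 s d) <= A ^+ 3 / d%:R.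
Proof.
move=> d0 hA; have dp : 0 < d%:R :> R by rewrite ltr0n.
have B0 : 0 <= 1 + 8 * \sum_(1 <= k < d) k%:R `^ (- p) :> R.
  by rewrite addr_ge0// mulr_ge0// sumr_ge0// => k _; exact: powR_ge0.
apply: (le_trans (tr4_div_sg2_le d0 hA)); rewrite ler_wpM2l ?exprn_ge0 ?(le_trans B0 hA)//.
have v1 := sg2_ge1 s0 d0; move: (sg2 s d) v1 => v v1.
by rewrite lef_pV2 ?posrE ?mulr_gt0 ?(lt_le_trans ltr01 v1)// ler_peMr// ltW.
Qed.

Lemma tr4_rate_lt58 : H < 5 / 8 -> exists K : R, forall d : nat, (1 < d)%N ->
  tr4 s d / (d%:R ^+ 2 * sg2 s d) <= K * d%:R^-1.
Proof.
move=> h; have p1 : 1 < p by rewrite /p; lra.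
exists ((1 + 8 * (1 + (p - 1)^-1)) ^+ 3) => d d1.
apply: tr4_div_le; first exact: ltnW.
by rewrite lerD2l ler_wpM2l// sum_pow_gt1.
Qed.

Let ln2 (d : nat) : (1 < d)%N -> 0 < ln (2 : R) <= ln (d%:R : R).
Proof.
move=> d1; rewrite ln_gt0 ?ltr1n//= ler_ln ?posrE ?ltr0n ?(ltnW d1)//.
by rewrite ler_nat.
Qed.

Lemma tr4_rate_eq58 : H = 5 / 8 -> exists K : R, forall d : nat, (1 < d)%N ->
  tr4 s d / (d%:R ^+ 2 * sg2 s d) <= K * (ln d%:R ^+ 3 / d%:R).
Proof.
move=> h; have p1 : p = 1 by rewrite /p h; field.
(* The sum is bounded by [9 + 8 ln d], and [1 <= ln d / ln 2] absorbs the 9. *)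
exists ((9 / ln 2 + 8) ^+ 3) => d d1.
have /andP[l2 ld] := ln2 d1.
rewrite mulrA -exprMn; apply: tr4_div_le; first exact: ltnW.
rewrite p1; under eq_bigr do rewrite powR_inv1//.
apply: (@le_trans _ _ (1 + 8 * (1 + ln d%:R))).
  by rewrite lerD2l ler_wpM2l// sum_inv_le// ltnW.
have h1 : 1 <= ln (d%:R : R) / ln (2 : R) by rewrite ler_pdivlMr// mul1r.
rewrite [leRHS](_ : _ = 9 * (ln d%:R / ln 2) + 8 * ln d%:R); last by ring.
lra.
Qed.

Lemma sum_pow_rate_gt58 : 5 / 8 < H -> exists2 K : R, 0 <= K & forall d : nat, (1 < d)%N ->
  1 + 8 * \sum_(1 <= k < d) k%:R `^ (- p) <= K * d%:R `^ (1 - p).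
Proof.
move=> h; have p1 : 0 < 1 - p by rewrite /p; lra.
have p0 : 0 <= p by have := H1; rewrite /p; lra.
exists (1 + 8 / (1 - p)) => [|d d1]; first by rewrite addr_ge0// divr_ge0// ltW.
have d1' : 1 <= d%:R `^ (1 - p) :> R.
  by rewrite -[leLHS](powRr0 d%:R) ler_powR ?ler1n ?(ltnW d1)// ltW.
have hs : \sum_(1 <= k < d) k%:R `^ (- p) <= d%:R `^ (1 - p) / (1 - p).
  by apply: sum_pow_lt1; rewrite p0 /=; lra.
rewrite [leRHS](_ : _ = d%:R `^ (1 - p) + 8 * (d%:R `^ (1 - p) / (1 - p))); last by ring.
lra.
Qed.

Lemma cube_powR_rate (d : nat) : (d%:R `^ (1 - p)) ^+ 3 = d%:R `^ (8 * H - 5) :> R.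
Proof.
by rewrite -powR_mulrn ?powR_ge0// -powRrM; congr (_ `^ _); rewrite /p; field.
Qed.

Lemma tr4_rate_gt58 : 5 / 8 < H -> exists K : R, forall d : nat, (1 < d)%N ->
  tr4 s d / (d%:R ^+ 2 * sg2 s d) <= K * d%:R `^ (8 * H - 6).
Proof.
move=> h; have [K K0 hK] := sum_pow_rate_gt58 h; exists (K ^+ 3) => d d1.
have d0 : (0 < d)%N by exact: ltnW.
apply: (le_trans (tr4_div_le d0 (hK d d1))).
rewrite exprMn cube_powR_rate -mulrA -[_^-1](powR_inv1 (ler0n _ _)) -powRD.
  by rewrite (_ : 8 * H - 5 + -1 = 8 * H - 6)//; ring.
by rewrite pnatr_eq0 -lt0n d0 implybT.
Qed.

Lemma psum_s2_step (D N : nat) : H < 3 / 4 -> (0 < D <= N)%N ->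
  psum s2 N <= psum s2 D + 64 / (3 - 4 * H) * D%:R `^ (- (3 - 4 * H)).
Proof.
move=> h /andP[D0 DN]; rewrite /psum (@big_cat_nat _ _ _ D)//= lerD2l.
have q1 : 1 < 4 - 4 * H by lra.
have := @tail_sum R (4 - 4 * H) D N q1; rewrite D0 DN => /(_ isT) ht.
rewrite (_ : 3 - 4 * H = 4 - 4 * H - 1); last by ring.
rewrite opprB mulrAC -mulrA; apply: le_trans (ler_wpM2l (ler0n R 64) ht).
rewrite mulr_sumr big_nat_cond [leRHS]big_nat_cond.
apply: ler_sum => k /andP[/andP[Dk _] _].
have k0 : (0 < k)%N by exact: leq_trans Dk.
have kp : 0 < k.+1%:R :> R by [].
(* [tail_sum] is stated with powers of [k + 1]; since [k >= (k + 1) / 2], the change costs the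
   factor 4 of [powR_half_le]. Squaring the 8 gives the 64. *)
have hb : `|s k%:Z| <= 8 * k.+1%:R `^ (- (2 - 2 * H)).
  apply: (le_trans (s_fgn_bound H01 k0)).
  rewrite (_ : 8 = 2 * 4 :> R); last by ring.
  rewrite -mulrA ler_wpM2l//; apply: (le_trans _ (@powR_half_le _ (2 - 2 * H) k.+1%:R _ kp)); last by have := H0; have := H1; move=> ? ?; apply/andP; split; lra.
  apply: powR_mono_neg; [have := H1; lra|by rewrite divr_gt0|].
  have : 1 <= k%:R :> R by rewrite ler1n.
  by rewrite ler_pdivrMr// -natr1; lra.
rewrite -(real_normK (num_real _)).
apply: (@le_trans _ _ ((8 * k.+1%:R `^ (- (2 - 2 * H))) ^+ 2)).
  by rewrite ler_pXn2r// nnegrE mulr_ge0// powR_ge0.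
rewrite exprMn -[X in _ * X <= _]powR_mulrn ?powR_ge0// -powRrM.
rewrite (_ : - (2 - 2 * H) * 2%:R = - (4 - 4 * H)); last by ring.
by rewrite (_ : 8 ^+ 2 = 64 :> R); last by ring.
Qed.

(** For fixed [N], the tail estimate [psum_s2_step] is averaged over [D] from 1 to [d]: the averaged
    windows rebuild [sg2], and the averaged tails form the error. *)
Lemma sq_sum_bound (d : nat) : H < 3 / 4 -> (0 < d)%N -> (sq_sum s <=
  (sg2 s d + 2 / d%:R * \sum_(1 <= D < d.+1) 64 / (3 - 4 * H) * D%:R `^ (- (3 - 4 * H)))%:E)%E.
Proof.
move=> h d0; have dp : 0 < d%:R :> R by rewrite ltr0n.
apply: sq_sum_le => // N; rewrite sg2_fgn// s0 expr1n -addrA lerD2l -mulrDr -big_split /=.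
rewrite -mulrA ler_wpM2l// mulrC ler_pdivlMr//.
have -> : psum s2 N * d%:R = \sum_(1 <= D < d.+1) psum s2 N.
  by rewrite sumr_const_nat subn1 mulr_natr.
rewrite [leLHS]big_nat_cond [leRHS]big_nat_cond.
apply: ler_sum => D /andP[/andP[D1 Dd] _].
(* [N] may be smaller than [D], so the window is enlarged by monotonicity first. *)
apply: (@le_trans _ _ (psum s2 (maxn N d))).
  by apply: psum_mono => [k|]; [exact: sqr_ge0|exact: leq_maxl].
by apply: psum_s2_step => //; rewrite D1 (leq_trans _ (leq_maxr N d)).
Qed.

Lemma fgn_ell2 : H < 3 / 4 -> in_ell2 s.
Proof. by move=> h; apply: le_lt_trans (sq_sum_bound h (ltn0Sn 0)) _; exact: ltry. Qed.

(** [sg2] is an average of partial sums of [sq_sum], hence lies below the squared norm;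
    [sq_sum_bound] is the opposite inequality. *)
Lemma sg2_gap (d : nat) : H < 3 / 4 -> (0 < d)%N ->
  `|sg2 s d - ell2_norm s ^+ 2| <=
  2 / d%:R * (64 / (3 - 4 * H) * \sum_(1 <= D < d.+1) D%:R `^ (- (3 - 4 * H))).
Proof.
move=> h d0; have hf := fgn_ell2 h; have hub := sq_sum_bound h d0.
have dp : 0 < d%:R :> R by rewrite ltr0n.
have hlb D : ((1 + 2 * psum s2 D)%:E <= sq_sum s)%E.
  by have := sq_sum_ge se D; rewrite s0 expr1n.
rewrite -mulr_sumr in hub.
rewrite /ell2_norm; rewrite /in_ell2 in hf.
case: (sq_sum s) hf hub hlb => [u| |] // _ hub hlb; last by have := hlb 0%N.
rewrite lee_fin in hub.
have u1 D : 1 + 2 * psum s2 D <= u by have := hlb D; rewrite lee_fin.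
have u0 : 0 <= u.
  by apply: le_trans (u1 0%N); rewrite /psum big_geq// mulr0 addr0.
have hv : sg2 s d <= u.
  rewrite sg2_fgn//; set S := \sum_(1 <= D < _) _.
  have -> : 2 / d%:R * S = 2 * S / d%:R by ring.
  rewrite -lerBrDl ler_pdivrMr// /S mulr_sumr.
  have -> : (u - 1) * d%:R = \sum_(1 <= D < d.+1) (u - 1).
    by rewrite sumr_const_nat subn1 mulr_natr.
  by apply: ler_sum => D _; have := u1 D; lra.
rewrite /= sqr_sqrtr// distrC ger0_norm ?subr_ge0//.
by rewrite lerBlDl.
Qed.

Lemma sg2_gap_lt12 : H < 1 / 2 -> exists K : R, forall d : nat, (1 < d)%N ->
  `|sg2 s d - ell2_norm s ^+ 2| <= K * d%:R^-1.
Proof.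
move=> h; exists (2 * (64 / (3 - 4 * H) * (1 + (2 - 4 * H)^-1))) => d d1.
have h3 : 0 < 3 - 4 * H by lra.
have d0 : (0 < d)%N by exact: ltnW.
apply: (le_trans (sg2_gap _ d0)); first by lra.
rewrite -!mulrA ler_wpM2l// [leRHS]mulrA [leRHS]mulrA [leRHS]mulrC ler_wpM2l ?invr_ge0//.
rewrite -mulrA ler_wpM2l// ler_wpM2l ?invr_ge0 ?(ltW h3)//.
have := @sum_pow_gt1 R (3 - 4 * H) d.+1.
by rewrite (_ : 3 - 4 * H - 1 = 2 - 4 * H); [apply; lra|ring].
Qed.

Lemma sg2_gap_gt12 : 1 / 2 < H < 3 / 4 -> exists K : R, forall d : nat, (1 < d)%N ->
  `|sg2 s d - ell2_norm s ^+ 2| <= K * d%:R `^ (4 * H - 3).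
Proof.
move=> /andP[h h']; set q := 3 - 4 * H.
have q0 : 0 < q by rewrite /q; lra.
have q1 : 0 < 1 - q by rewrite /q; lra.
(* The inner 2 absorbs the sum running up to [d]: [d + 1 <= 2 d] and [2^(1 - q) <= 2]. *)
exists (2 * (64 / q * (2 / (1 - q)))) => d d1.
have d0 : (0 < d)%N by exact: ltnW.
have dp : 0 < d%:R :> R by rewrite ltr0n.
apply: (le_trans (sg2_gap h' d0)); rewrite -/q.
have hs : \sum_(1 <= D < d.+1) D%:R `^ (- q) <= 2 / (1 - q) * (d%:R * d%:R `^ (- q)).
  apply: (@le_trans _ _ (d.+1%:R `^ (1 - q) / (1 - q))).
    by apply: sum_pow_lt1; apply/andP; split; lra.
  rewrite [leRHS]mulrAC ler_wpM2r ?invr_ge0 ?(ltW q1)//.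
  have -> : d%:R * d%:R `^ (- q) = d%:R `^ (1 - q).
    by rewrite -{1}(powRr1 (ler0n R d)) -powRD// pnatr_eq0 -lt0n d0 implybT.
  apply: (@le_trans _ _ ((2 * d%:R) `^ (1 - q))).
    rewrite ge0_ler_powR ?nnegrE ?mulr_ge0 ?(ltW q1)//.
    by rewrite -natrM ler_nat mul2n -addnn -addn1 leq_add2l.
  rewrite powRM// ler_wpM2r ?powR_ge0//.
  rewrite -[leRHS](powRr1 (ler0n R 2)); apply: ler_powR; first by rewrite ler1n.
  by lra.
have -> : 4 * H - 3 = - q by rewrite /q; ring.
rewrite [leRHS](_ : _ = 2 / d%:R * (64 / q * (2 / (1 - q) * (d%:R * d%:R `^ (- q))))); last first.
  move: (d%:R `^ _) => z; field; rewrite !gt_eqF//.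
rewrite ler_wpM2l ?divr_ge0// ler_wpM2l// divr_ge0// ltW//.
Qed.

End fgn_rates.

(** * The critical exponent [H = 3 / 4] *)

Section fgn_critical.
Context {R : realType}.
Local Notation s := (s_fgn (3 / 4 : R)).
Local Notation s2 := (fun k => s_fgn (3 / 4 : R) k ^+ 2).

Let H0 : 0 < 3 / 4 :> R. Proof. by rewrite divr_gt0. Qed.

(** [s_fgn_lower] starts at [k = 2]; the first term of the harmonic sum, which is lost, accounts for
    the [- 1]. *)
Lemma psum_critical (D : nat) : (0 < D)%N -> 16^-1 * (ln D%:R - 1) <= psum s2 D.
Proof.
case: D => [//|[|D]] _.
  by rewrite ln1 /psum big_geq// sub0r mulrN1 oppr_le0 invr_ge0.
apply: (@le_trans _ _ (16^-1 * ((\sum_(1 <= k < D.+2) k%:R^-1) - 1))).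
  by rewrite ler_wpM2l ?invr_ge0// lerD2r sum_inv_ge.
rewrite /psum big_ltn// invr1 addrAC subrr add0r [leRHS]big_ltn//.
rewrite -[leLHS]add0r lerD ?sqr_ge0// mulr_sumr [leLHS]big_nat_cond [leRHS]big_nat_cond.
by apply: ler_sum => k /andP[/andP[k2 _] _]; exact: s_fgn_lower.
Qed.

(** The windows contribute at least [ln d / 8 - 1 / 4], and the diagonal term 1 outweighs the
    negative constant. *)
Lemma sg2_critical (d : nat) : (0 < d)%N -> 8^-1 * ln d%:R <= sg2 s d.
Proof.
move=> d0; have dp : 0 < d%:R :> R by rewrite ltr0n.
rewrite sg2_fgn//.
have h : 16^-1 * (d%:R * (ln d%:R - 1) - d%:R) <= \sum_(1 <= D < d.+1) psum s2 D.
  apply: (@le_trans _ _ (\sum_(1 <= D < d.+1) 16^-1 * (ln D%:R - 1))).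
    rewrite -mulr_sumr ler_wpM2l ?invr_ge0// big_split /= sumr_const_nat subn1 /=.
    by rewrite mulNrn lerD2r sum_ln_ge.
  rewrite big_nat_cond [leRHS]big_nat_cond.
  by apply: ler_sum => D /andP[/andP[D0 _] _]; exact: psum_critical.
apply: (@le_trans _ _ (1 + 2 / d%:R * (16^-1 * (d%:R * (ln d%:R - 1) - d%:R)))).
  rewrite (_ : 2 / d%:R * _ = 8^-1 * ln d%:R - 4^-1); first by lra.
  by field; rewrite gt_eqF.
by rewrite lerD2l ler_wpM2l// divr_ge0.
Qed.

Lemma fgn_not_ell2 : ~ in_ell2 s.
Proof.
move=> hf; rewrite /in_ell2 in hf.
have hlb D : ((1 + 2 * psum s2 D)%:E <= sq_sum s)%E.
  have := sq_sum_ge (@s_fgn_even R (3 / 4)) D.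
  by rewrite (s_fgn0 H0) expr1n.
case: (sq_sum s) hf hlb => [u| |] // _ hlb; last by have := hlb 0%N.
(* With [ln D >= 8 u + 2] the partial sum [1 + 2 psum s2 D] is at least [u + 9 / 8], above the
   supposed total [u]. *)
pose D := (Num.bound (expR (8 * u + 2))).+1.
have D0 : (0 < D)%N by [].
have hD : 8 * u + 2 <= ln (D%:R : R).
  rewrite -[leLHS]expRK ler_ln ?posrE ?expR_gt0 ?ltr0n//.
  have := archi_boundP (ltW (expR_gt0 (8 * u + 2))) => /ltW h.
  by rewrite (le_trans h)// ler_nat.
have := hlb D; rewrite lee_fin; have := psum_critical D0; lra.
Qed.

(** The cubed sum grows like [d] and cancels the [d] of the denominator: the only decay left is that
    of [1 / sg2], whence the 8 of [sg2_critical]. *)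
Lemma tr4_rate_34 : exists K : R, forall d : nat, (1 < d)%N ->
  tr4 s d / (d%:R ^+ 2 * sg2 s d) <= K * (ln d%:R)^-1.
Proof.
have h1 : 3 / 4 <= 3 / 4 :> R by [].
have h2 : 5 / 8 < 3 / 4 :> R by lra.
have [K K0 hK] := sum_pow_rate_gt58 h1 h2.
exists (8 * K ^+ 3) => d d1.
have d0 : (0 < d)%N by exact: ltnW.
have dp : 0 < d%:R :> R by rewrite ltr0n.
apply: (le_trans (tr4_div_sg2_le H0 h1 d0 (hK d d1))).
rewrite exprMn cube_powR_rate (_ : 8 * (3 / 4) - 5 = 1 :> R); last by field.
rewrite powRr1// invfM mulrA mulfK ?gt_eqF//.
have l0 : 0 < ln (d%:R : R) by rewrite ln_gt0// ltr1n.
have hv := sg2_critical d0.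
have v0 : 0 < 8^-1 * ln (d%:R : R) by rewrite mulr_gt0// invr_gt0.
rewrite [leRHS](_ : _ = K ^+ 3 / (8^-1 * ln d%:R)); last by field; rewrite gt_eqF.
rewrite ler_wpM2l ?exprn_ge0// lef_pV2 ?posrE//.
exact: lt_le_trans hv.
Qed.

End fgn_critical.

Lemma sg2_half (R : realType) (d : nat) : (0 < d)%N -> sg2 (s_fgn (1 / 2 : R)) d = 1.
Proof.
move=> d0; have h0 : 0 < 1 / 2 :> R by rewrite divr_gt0.
rewrite sg2_fgn//.
rewrite big1 ?mulr0 ?addr0// => D _; rewrite /psum big_nat_cond big1// => k /andP[/andP[k1 _] _].
by rewrite s_fgn_half ?expr0n//; case: k k1.
Qed.

Lemma sq_sum_half (R : realType) : sq_sum (s_fgn (1 / 2 : R)) = 1%E.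
Proof.
have h0 : 0 < 1 / 2 :> R by rewrite divr_gt0.
have p0 D : psum (fun k => s_fgn (1 / 2 : R) k ^+ 2) D = 0.
  rewrite /psum big_nat_cond big1// => k /andP[/andP[k1 _] _].
  by rewrite s_fgn_half ?expr0n//; case: k k1.
apply/eqP; rewrite eq_le; apply/andP; split.
  apply: sq_sum_le => [k|D]; first exact: s_fgn_even.
  by rewrite p0 s_fgn0// expr1n mulr0 addr0.
have := sq_sum_ge (@s_fgn_even R (1 / 2)) 0.
by rewrite p0 s_fgn0// expr1n mulr0 addr0.
Qed.

(** * From rates to closeness *)

Section assembly.
Context {R : realType} {H : R} (H0 : 0 < H) (H1 : H <= 3 / 4)
  {disp : measure_display} {T : measurableType disp} {P : probability T R}
  {X : nat -> nat -> {RV P >-> R}} (hX : gaussian_array (s_fgn H) X)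
  {G : forall n d : nat, random_matrix R n}
  (hG : forall n d : nat, (0 < n)%N -> (0 < d)%N ->
    gaussian_counterpart (wishart X n d) (G n d))
  {Z : forall n : nat, random_matrix R n}
  (hZ : in_ell2 (s_fgn H) -> forall n : nat, (0 < n)%N -> goe_like (s_fgn H) (Z n)).
Local Notation s := (s_fgn H).

Let se k : s (- k) = s k. Proof. exact: s_fgn_even. Qed.
Let s0 : s 0 = 1. Proof. exact: s_fgn0. Qed.

Lemma wishart_close (phi : nat -> nat -> \bar R) (e : nat -> R) :
  (forall n d, (1 < d)%N -> phi n d = (n%:R ^+ 3 * e d)%:E) ->
  (exists K : R, forall d : nat, (1 < d)%N ->
    tr4 s d / (d%:R ^+ 2 * sg2 s d) <= K * e d) ->
  phi_close phi (wishart X) G.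
Proof.
move=> hphi [K hK].
apply: (@phi_close_rate _ phi (fun n d => n%:R ^+ 3 * e d) (fun x => 2 * Num.sqrt (K * x))).
- by move=> n d _; exact: hphi.
- move=> n d n0 d1; have d0 : (0 < d)%N by exact: ltnW.
  apply: (le_trans (dFM_wishart_gaussian hX se s0 n0 d0 (hG n0 d0))).
  rewrite lee_fin ler_wpM2l// ler_wsqrtr// [leRHS]mulrCA ler_wpM2l ?exprn_ge0//.
  exact: hK.
- apply: (cvg_comp (fun x : R => K * x) (fun y => 2 * Num.sqrt y)); last exact: sqrt_rate.
  exact: lin_rate.
Qed.

Lemma ell2_norm_ge1 : in_ell2 s -> 1 <= ell2_norm s ^+ 2.
Proof.
rewrite /in_ell2 /ell2_norm => hf; have hlb := sq_sum_ge se 0.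
rewrite s0 expr1n /psum big_geq// mulr0 addr0 in hlb.
case: (sq_sum s) hf hlb => [u| |] // _; rewrite lee_fin => u1.
by rewrite /= sqr_sqrtr// (le_trans ler01).
Qed.

Lemma gaussian_close (phi : nat -> nat -> \bar R) (e : nat -> R) : H < 3 / 4 ->
  (forall n d, (1 < d)%N -> phi n d = (n%:R * e d)%:E) ->
  (exists K : R, forall d : nat, (1 < d)%N ->
    `|sg2 s d - ell2_norm s ^+ 2| <= K * e d) ->
  phi_close phi G (fun n _ => Z n).
Proof.
move=> h hphi [K hK]; have hl2 := fgn_ell2 H0 H1 h.
apply: (@phi_close_rate _ phi (fun n d => n%:R * e d) (fun x => 2 * K * x)).
- by move=> n d _; exact: hphi.
- move=> n d n0 d1; have d0 : (0 < d)%N by exact: ltnW.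
  have gG := counterpart_gvec hX se s0 d0 (hG n0 d0).
  apply: (le_trans (dFM_gaussian_goe n0 (sg2_ge1 s0 d0) (hZ hl2 n0) gG (ell2_norm_ge1 hl2))).
  rewrite lee_fin [leRHS](_ : _ = 2 * n%:R * (K * e d)); last by ring.
  by rewrite ler_wpM2l ?mulr_ge0// hK.
- exact: lin_rate.
Qed.

Lemma half_same_law : H = 1 / 2 -> forall n d : nat, (0 < n)%N -> (0 < d)%N ->
  same_law (G n d) (Z n).
Proof.
move=> h n d n0 d0; have hl2 : in_ell2 s by rewrite /in_ell2 h sq_sum_half ltry.
have gG := counterpart_gvec hX se s0 d0 (hG n0 d0).
apply: (same_law_goe (hZ hl2 n0) gG).
by rewrite h sg2_half// /ell2_norm sq_sum_half/= sqr_sqrtr.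
Qed.

End assembly.

Theorem corollary1p4 (R : realType) (H : R) (hH0 : 0 < H) (hH1 : H <= 3 / 4)
    (disp : measure_display) (T : measurableType disp) (P : probability T R)
    (X : nat -> nat -> {RV P >-> R}) (hX : gaussian_array (s_fgn H) X)
    (G : forall n d : nat, random_matrix R n)
    (hG : forall n d : nat, (0 < n)%N -> (0 < d)%N ->
      gaussian_counterpart (wishart X n d) (G n d))
    (Z : forall n : nat, random_matrix R n)
    (hZ : in_ell2 (s_fgn H) -> forall n : nat, (0 < n)%N ->
      goe_like (s_fgn H) (Z n)) :
  (H < 1 / 2 ->
     phi_close (fun n d => (n%:R ^+ 3 / d%:R)%:E) (wishart X) G /\
     phi_close (fun n d => (n%:R / d%:R)%:E) G (fun n _ => Z n)) /\
  (H = 1 / 2 ->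
     phi_close (fun n d => (n%:R ^+ 3 / d%:R)%:E) (wishart X) G /\
     forall n d : nat, (0 < n)%N -> (0 < d)%N -> same_law (G n d) (Z n)) /\
  (1 / 2 < H < 5 / 8 ->
     phi_close (fun n d => (n%:R ^+ 3 / d%:R)%:E) (wishart X) G /\
     phi_close (fun n d => (n%:R * d%:R `^ (4 * H - 3))%:E) G (fun n _ => Z n)) /\
  (H = 5 / 8 ->
     phi_close (fun n d => (n%:R ^+ 3 * ln d%:R ^+ 3 / d%:R)%:E) (wishart X) G /\
     phi_close (fun n d => (n%:R / Num.sqrt d%:R)%:E) G (fun n _ => Z n)) /\
  (5 / 8 < H < 3 / 4 ->
     phi_close (fun n d => (n%:R ^+ 3 * d%:R `^ (8 * H - 6))%:E) (wishart X) G /\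
     phi_close (fun n d => (n%:R * d%:R `^ (4 * H - 3))%:E) G (fun n _ => Z n)) /\
  (H = 3 / 4 ->
     phi_close (fun n d => ((n%:R ^+ 3)%:E * (ln d%:R)%:E^-1)%E) (wishart X) G /\
     ~ in_ell2 (s_fgn H)).
Proof.
have wl : H < 5 / 8 -> phi_close (fun n d => (n%:R ^+ 3 / d%:R)%:E) (wishart X) G.
  by move=> h; apply: (wishart_close hH0 hX hG (e := fun d => d%:R^-1)) => //; exact: tr4_rate_lt58.
have gh : 1 / 2 < H < 3 / 4 ->
    phi_close (fun n d => (n%:R * d%:R `^ (4 * H - 3))%:E) G (fun n _ => Z n).
  move=> h; have [/andP[_ h'] hg] := (h, sg2_gap_gt12 hH0 hH1 h).
  exact: (gaussian_close hH0 hH1 hX hG hZ h' _ hg).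
split=> [h|].
  split; first by apply: wl; lra.
  have h' : H < 3 / 4 by lra.
  exact: (gaussian_close hH0 hH1 hX hG hZ h' _ (sg2_gap_lt12 hH0 hH1 h)).
split=> [h|].
  split; first by apply: wl; lra.
  exact: (half_same_law hH0 hX hG hZ h).
split=> [/andP[h h']|].
  by split; [exact: wl|apply: gh; rewrite h; lra].
split=> [h|].
  split.
    apply: (wishart_close hH0 hX hG (e := fun d => ln d%:R ^+ 3 / d%:R)) => //.
      by move=> n d _; rewrite mulrA.
    exact: tr4_rate_eq58.
  have h' : H < 3 / 4 by lra.
  have hh : 1 / 2 < H < 3 / 4 by apply/andP; split; lra.
  apply: (gaussian_close hH0 hH1 hX hG hZ h' _ (sg2_gap_gt12 hH0 hH1 hh)) => n d _.
  (* At [H = 5 / 8] the general exponent [4 H - 3] is [- 1 / 2]. *)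
  by congr (_ * _)%:E; rewrite -powR12_sqrt// -powRN; congr (_ `^ _); rewrite h; field.
split=> [/andP[h h']|h].
  have hh : 1 / 2 < H < 3 / 4 by apply/andP; split; lra.
  by split; [exact: (wishart_close hH0 hX hG _ (tr4_rate_gt58 hH0 hH1 h))|exact: gh].
split.
  apply: (wishart_close hH0 hX hG (e := fun d => (ln d%:R)^-1)) => //.
    (* For [1 < d] the logarithm is positive, so the inverse in the extended reals is the real
       one. *)
    move=> n d d1; rewrite inver gt_eqF ?EFinM// ln_gt0// ltr1n//.
  by rewrite h; exact: tr4_rate_34.
by rewrite h; exact: fgn_not_ell2.
Qed.
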